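(* Let $\Gamma$ be a countably infinite discrete group with Kazhdan's property (T). Then there exist a compact Hausdorff space $X$, a free action of $\Gamma$ on $X$ by homeomorphisms, a $C^*$-norm $\eta$ on $C_c(\Gamma,C(X))$ and a Hilbert space $\mathcal H$ such that $C(X)\rtimes_\eta\Gamma$ is (identified with) a $C^*$-subalgebra of $B(\mathcal H)$ which contains the compact operators $\mathcal K(\mathcal H)$ as an exotic ideal, i.e. $\{0\}\ne\mathcal K(\mathcal H)\subseteq C(X)\rtimes_\eta\Gamma$ and $\mathcal K(\mathcal H)\cap C(X)=\{0\}$. Moreover, for this $C(X)\rtimes_\eta\Gamma$, if $J$ is a non-zero proper ideal of $C(X)\rtimes_\eta\Gamma$, then $$\mathcal K(\mathcal H)\subseteq J\subseteq \mathcal L_\eta .$$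
   Context: ''Ideal'' in a $C^*$-algebra means closed two-sided ideal. An action of $\Gamma$ on $X$ is free if $sx\neq x$ for every $x\in X$ and every $e\neq s\in\Gamma$. With $\tau_s(a)(x)=a(s^{-1}x)$ for $a\in C(X)$, $C_c(\Gamma,C(X))$ is the $*$-algebra of finitely supported functions $\Gamma\to C(X)$ with $(ab)(t)=\sum_{s}a(s)\tau_s(b(s^{-1}t))$ and $a^*(t)=\tau_t(a(t^{-1}))^*$; $C(X)$ is the subalgebra of functions supported at $e$. For a $C^*$-norm $\eta$ on $C_c(\Gamma,C(X))$, $C(X)\rtimes_\eta\Gamma$ is the completion of $C_c(\Gamma,C(X))$ with respect to $\eta$; $C(X)\rtimes_r\Gamma$ is the reduced crossed product. When the action is free, the reduced norm is dominated by every $C^*$-norm $\eta$ on $C_c(\Gamma,C(X))$, so there is a unique $*$-epimorphism $\Lambda_\eta:C(X)\rtimes_\eta\Gamma\to C(X)\rtimes_r\Gamma$ extending the identity on $C_c(\Gamma,C(X))$. Let $E_r:C(X)\rtimes_r\Gamma\to C(X)$ be the canonical faithful conditional expectation ($E_r(a)=a(e)$ for $a\in C_c(\Gamma,C(X))$), let $E_\eta=E_r\circ\Lambda_\eta$, and let $\mathcal L_\eta=\{x\in C(X)\rtimes_\eta\Gamma: E_\eta(x^*x)=0\}$. *)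

(* Defs.v *)
From HB Require Import structures.
From mathcomp Require Import all_boot all_order all_algebra.
From mathcomp Require Import sesquilinear complex.
From mathcomp Require Import all_classical all_reals all_analysis.

Set Implicit Arguments.
Unset Strict Implicit.
Unset Printing Implicit Defensive.

Import Order.TTheory GRing.Theory Num.Theory.
Import numFieldNormedType.Exports.
Local Open Scope classical_set_scope.
Local Open Scope ring_scope.

(* Norms of modules over [R[i]] take values in [R[i]]; [rnorm] is the same
   number as an element of [R].  [R[i]^o] is [R[i]] with its usual norm and
   topology. *)
Definition rnorm (R : realType) (V : normedModType R[i]) (x : V) : R :=
  complex.Re `|x|.

(* The inner product is linear in the first variable and conjugate-linear in
   the second. *)
Record hilbertSpace (R : realType) := HilbertSpace {
  hilbert_sort :> completeNormedModType R[i];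
  inner : {dot hilbert_sort for (@Num.conj R[i])};
  inner_norm : forall x : hilbert_sort, inner x x = `|x| ^+ 2
}.

Section Operators.
Context (R : realType) (H : hilbertSpace R).
Implicit Type T : H -> H.

Definition bounded_operator T := linear T /\ continuous T.

Definition opnorm T : R := sup [set rnorm (T x) | x in [set x : H | `|x| <= 1]].

(* Boundedness is automatic here. *)
Definition compact_operator T :=
  linear T /\ precompact (T @` [set x : H | `|x| <= 1]).

End Operators.

Section PropertyT.
Context (R : realType) (G : groupType).

Definition unitary_rep (H : hilbertSpace R) (pi : G -> H -> H) :=
  [/\ forall x, pi 1%g x = x,
      forall s t x, pi (s * t)%g x = pi s (pi t x),
      forall s, linear (pi s)
    & forall s x y, inner H (pi s x) (pi s y) = inner H x y].

(* [Q] is finite because [G] is discrete. *)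
Definition property_T := exists (Q : set G) (eps : R),
  [/\ finite_set Q, 0 < eps &
      forall (H : hilbertSpace R) (pi : G -> H -> H), unitary_rep pi ->
        (exists x : H, x <> 0 /\
           forall s, Q s -> rnorm (pi s x - x) < eps * rnorm x) ->
        exists x : H, x <> 0 /\ forall s, pi s x = x].

End PropertyT.

Record cstarAlgebra (R : realType) := CStarAlgebra {
  cstar_sort :> completeNormedModType R[i];
  cmul : cstar_sort -> cstar_sort -> cstar_sort;
  cadj : cstar_sort -> cstar_sort;
  cmulA : associative cmul;
  cmul_linearr : forall a, linear (cmul a);
  cmul_linearl : forall a, linear (cmul^~ a);
  cadjK : involutive cadj;
  cadjM : forall a b, cadj (cmul a b) = cmul (cadj b) (cadj a);
  cadj_antilinear : forall k a b,
    cadj (k *: a + b) = Num.conj k *: cadj a + cadj b;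
  cnormM : forall a b, `|cmul a b| <= `|a| * `|b|;
  cnorm_adjM : forall a, `|cmul (cadj a) a| = `|a| ^+ 2
}.

Section CStarAlgebras.
Context (R : realType).

Definition star_hom (A B : cstarAlgebra R) (f : A -> B) :=
  [/\ linear f, forall a b, f (cmul a b) = cmul (f a) (f b)
    & forall a, f (cadj a) = cadj (f a)].

(* An isometric *-representation identifies [A] with a C*-subalgebra of
   B(H). *)
Definition isometric_star_rep (A : cstarAlgebra R) (H : hilbertSpace R)
    (rho : A -> H -> H) :=
  (forall a, bounded_operator (rho a)) /\
  [/\ forall k a b x, rho (k *: a + b) x = k *: rho a x + rho b x,
      forall a b x, rho (cmul a b) x = rho a (rho b x),
      forall a x y, inner H (rho (cadj a) x) y = inner H x (rho a y)
    & forall a, opnorm (rho a) = rnorm a].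

Definition ideal (A : cstarAlgebra R) (J : set A) :=
  [/\ closed J, J 0, forall k a b, J a -> J b -> J (k *: a + b)
    & forall a b, J b -> J (cmul a b) /\ J (cmul b a)].

End CStarAlgebras.

Section Actions.
Context (G : groupType) (X : topologicalType) (act : G -> X -> X).

Definition continuous_action :=
  [/\ forall x, act 1%g x = x,
      forall s t x, act (s * t)%g x = act s (act t x)
    & forall s, continuous (act s)].

Definition free_action := forall x s, s <> 1%g -> act s x <> x.

End Actions.

Section CrossedProducts.
Context (R : realType) (G : groupType) (X : topologicalType).
Context (act : G -> X -> X).
Local Notation C := (R[i]^o).
Implicit Types (a b : G -> X -> C) (f : X -> C).

(* The *-algebra C_c(G, C(X)) is a subset of [G -> X -> C]; every notion
   below only refers to its elements. *)
Definition Cc : set (G -> X -> C) :=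
  [set a | (forall s, continuous (a s)) /\ finite_set [set s | a s <> 0]].

Definition conv a b : G -> X -> C := fun t x =>
  \sum_(s \in [set: G]) a s x * b (s^-1 * t)%g (act s^-1%g x).

Definition ccadj a : G -> X -> C := fun t x =>
  Num.conj (a t^-1%g (act t^-1%g x)).

(* The inclusion of C(X) into C_c(G, C(X)). *)
Definition at_unit f : G -> X -> C := fun t => if t == 1%g then f else 0.

Definition cstar_norm (eta : (G -> X -> C) -> R) :=
  [/\ forall a, Cc a -> eta a = 0 -> a = 0,
      forall a b, Cc a -> Cc b -> eta (a + b) <= eta a + eta b,
      forall (k : R[i]) a, Cc a -> eta (k *: a) = complex.Re `|k| * eta a,
      forall a b, Cc a -> Cc b -> eta (conv a b) <= eta a * eta b
    & forall a, Cc a -> eta (conv (ccadj a) a) = eta a ^+ 2].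

(* [(A, iota)] is the completion of C_c(G, C(X)) with respect to [eta]. *)
Definition is_completion (eta : (G -> X -> C) -> R) (A : cstarAlgebra R)
    (iota : (G -> X -> C) -> A) :=
  [/\ forall (k : R[i]) a b, Cc a -> Cc b ->
        iota (k *: a + b) = k *: iota a + iota b,
      forall a b, Cc a -> Cc b -> iota (conv a b) = cmul (iota a) (iota b),
      forall a, Cc a -> iota (ccadj a) = cadj (iota a),
      forall a, Cc a -> rnorm (iota a) = eta a
    & dense (iota @` Cc)].

(* The regular representation on l^2(G x X), induced by the faithful
   representation of C(X) on l^2(X) by multiplication operators: [f] acts on
   the fibre over [t] as the function [x |-> f (t x)], and [s] translates the
   [G]-coordinate by [s^-1].  The reduced norm is the resulting operator norm,
   computed on the dense subspace of finitely supported vectors. *)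
Definition regular_rep a (xi : G * X -> C) : G * X -> C := fun p =>
  \sum_(s \in [set: G]) a s (act p.1 p.2) * xi ((s^-1 * p.1)%g, p.2).

Definition l2norm (xi : G * X -> C) : R :=
  Num.sqrt (\sum_(p \in [set: G * X]) rnorm (xi p) ^+ 2).

Definition reduced_norm a : R :=
  sup [set l2norm (regular_rep a xi) | xi in
        [set xi : G * X -> C |
          finite_set [set p | xi p <> 0] /\ l2norm xi <= 1]].

Definition is_reduced_crossed_product := is_completion reduced_norm.

(* The canonical faithful conditional expectation onto C(X). *)
Definition is_canonical_expectation (B : cstarAlgebra R)
    (iota : (G -> X -> C) -> B) (E : B -> X -> C) :=
  [/\ forall u, continuous (E u),
      forall (k : R[i]) u v, E (k *: u + v) = k *: E u + E v,
      forall u x, `|E u x| <= `|u|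
    & forall u x, 0 <= E (cmul (cadj u) u) x :> R[i]] /\
  [/\ forall f u, continuous f ->
        E (cmul (iota (at_unit f)) u) = (fun x => f x * E u x),
      forall f u, continuous f ->
        E (cmul u (iota (at_unit f))) = (fun x => E u x * f x),
      forall u, E (cmul (cadj u) u) = 0 -> u = 0
    & forall a, Cc a -> E (iota a) = a 1%g].

Definition null_ideal (A B : cstarAlgebra R) (Lambda : A -> B)
    (E : B -> X -> C) : set A :=
  [set x | E (Lambda (cmul (cadj x) x)) = 0].

End CrossedProducts.

Definition compacts_in (R : realType) (A : cstarAlgebra R)
    (H : hilbertSpace R) (rho : A -> H -> H) : set A :=
  [set a | compact_operator (rho a)].

(* K(H) is a nonzero ideal of [rho A] that meets C(X) only in 0. *)
Definition contains_compacts_as_exotic_ideal (R : realType) (G : groupType)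
    (X : topologicalType) (A : cstarAlgebra R)
    (iota : (G -> X -> R[i]^o) -> A) (H : hilbertSpace R)
    (rho : A -> H -> H) :=
  [/\ exists T : H -> H, compact_operator T /\ T <> (fun=> 0),
      forall T : H -> H, compact_operator T -> exists a, rho a = T,
      ideal (compacts_in rho)
    & forall f : X -> R[i]^o, continuous f ->
        compact_operator (rho (iota (at_unit f))) -> f = (fun=> 0)].

(* Main.v *)
Require Import Defs.
From HB Require Import structures.
From mathcomp Require Import all_boot all_order all_algebra.
From mathcomp Require Import sesquilinear complex.
From mathcomp Require Import all_classical all_reals all_analysis.
From mathcomp Require Import ring lra.

Set Implicit Arguments.
Unset Strict Implicit.
Unset Printing Implicit Defensive.

Import Order.TTheory GRing.Theory Num.Theory.
Import numFieldNormedType.Exports.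
Local Open Scope classical_set_scope.
Local Open Scope ring_scope.
Local Open Scope complex_scope.

(* By greedy colouring one constructs a closed shift-invariant set [X] of
   3-colourings of [G * G] on which [G] acts freely and minimally and which is
   approximated by factors of Bernoulli shifts.  An ultralimit of the Bernoulli
   measures is an invariant mean on [C(X)] for which property (T) yields a spectral
   gap; hence, in the covariant representation on [L^2(X)], the powers of
   [1 - t laplacian] converge in norm to the projection onto the constants, and the
   generated C*-algebra contains the compact operators.  Pinching by the colour
   functions annihilates the coefficients away from the unit.  Therefore the reduced
   norm is dominated by the norm of this algebra, and an ideal on which the
   expectation does not vanish meets [C(X)], so that, by minimality, it is not
   proper. *)

(** Freeness, minimality and the spectral gap have to hold at once. Property (T) gives a gap only
    where there are no invariant vectors, and ergodicity of the limiting mean is not known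
    beforehand. But a Kazhdan pair is chosen before the representation: mixing gives every Bernoulli
    shift, whatever its finite alphabet, a Poincare inequality with the same constants, and such an
    inequality survives an ultralimit. It is therefore enough that [X] be reachable statistically:
    codes send nearly legal configurations close to [X], and a greedy colouring of random labels is
    legal on a given window with probability close to 1. The colouring of index [s] is proper for
    the graph joining [g] to [g s]. The degree is at most two, whence three colours; and a
    configuration fixed by [s] would colour both ends of an edge alike, whence freeness. Averages of
    local functions before the limit and a positive functional after it suffice, so no measure is
    constructed. Minimality also makes the mean faithful and prevents a nonzero function from acting
    as a compact operator. *)

(** * Norms and sequential convergence over the complex scalars *)

Section NormBasics.
Context (R : realType).
Local Notation C := R[i].

Lemma normE (V : normedModType C) (x : V) : `|x| = (rnorm x)%:C.
Proof. by rewrite /rnorm RRe_real // ger0_real. Qed.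

Lemma rnorm_ge0 (V : normedModType C) (x : V) : 0 <= rnorm x.
Proof. by rewrite -ler0c -normE. Qed.

Lemma rnormD (V : normedModType C) (x y : V) : rnorm (x + y) <= rnorm x + rnorm y.
Proof. by rewrite -lecR rmorphD /= -!normE ler_normD. Qed.

Lemma rnorm0 (V : normedModType C) : rnorm (0 : V) = 0.
Proof. by rewrite /rnorm normr0. Qed.

Lemma rnorm_eq0 (V : normedModType C) (x : V) : rnorm x = 0 -> x = 0.
Proof. by move=> h; apply/eqP; rewrite -normr_eq0 normE h. Qed.

Lemma rnormN (V : normedModType C) (x : V) : rnorm (- x) = rnorm x.
Proof. by rewrite /rnorm normrN. Qed.

Lemma rnormB (V : normedModType C) (x y : V) : rnorm (x - y) = rnorm (y - x).
Proof. by rewrite -rnormN opprB. Qed.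

Lemma rnorm_sum (V : normedModType C) (I : Type) (s : seq I) (f : I -> V) :
  rnorm (\sum_(i <- s) f i) <= \sum_(i <- s) rnorm (f i).
Proof.
elim: s => [|a s IH]; first by rewrite !big_nil rnorm0.
by rewrite !big_cons (le_trans (rnormD _ _)) // lerD2l.
Qed.

Lemma rnorm_dist (V : normedModType C) (z x y : V) :
  rnorm (x - y) <= rnorm (x - z) + rnorm (z - y).
Proof. by rewrite (le_trans _ (rnormD _ _)) // addrA subrK. Qed.

Lemma rnorm_le (V : normedModType C) (x : V) (M : R) :
  (`|x| <= M%:C) = (rnorm x <= M).
Proof. by rewrite normE lecR. Qed.

Lemma rnorm_lt (V : normedModType C) (x : V) (M : R) :
  (`|x| < M%:C) = (rnorm x < M).
Proof. by rewrite normE ltcR. Qed.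

Definition cmod (z : C) : R := complex.Re `|z|.

Lemma cmodE (z : C) : `|z| = (cmod z)%:C.
Proof. by rewrite /cmod RRe_real // ger0_real. Qed.

Lemma rnorm_cmod (z : C^o) : rnorm z = cmod z. Proof. by []. Qed.

Lemma cmod_ge0 (z : C) : 0 <= cmod z.
Proof. by rewrite -ler0c -cmodE. Qed.

Lemma cmodM (z w : C) : cmod (z * w) = cmod z * cmod w.
Proof. by apply: complexI; rewrite rmorphM /= -!cmodE normrM. Qed.

Lemma cmodD (z w : C) : cmod (z + w) <= cmod z + cmod w.
Proof. by rewrite -lecR rmorphD /= -!cmodE ler_normD. Qed.

Lemma cmod0 : cmod 0 = 0. Proof. by rewrite /cmod normr0. Qed.

Lemma cmod_eq0 (z : C) : cmod z = 0 -> z = 0.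
Proof. by move=> h; apply/eqP; rewrite -normr_eq0 cmodE h. Qed.

Lemma cmodN (z : C) : cmod (- z) = cmod z. Proof. by rewrite /cmod normrN. Qed.

Lemma cmodC (x : R) : 0 <= x -> cmod x%:C = x.
Proof. by move=> x0; rewrite /cmod ger0_norm // ler0c. Qed.

Lemma cmod_sqr (z : C) : ((cmod z) ^+ 2)%:C = z * Num.conj z.
Proof. by rewrite rmorphXn /= -cmodE normCK. Qed.

Lemma cmod_conj (z : C) : cmod (Num.conj z) = cmod z.
Proof. by rewrite /cmod norm_conjC. Qed.

Lemma conj_conjc (z : C) : Num.conj z = conjc z.
Proof.
have [->|z0] := eqVneq z 0; first by rewrite rmorph0 conjc0.
by apply: (mulfI z0); rewrite -normCK sqr_normc.
Qed.

Lemma Re_le_cmod (z : C) : `|complex.Re z| <= cmod z.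
Proof. by rewrite -lecR -cmodE normc_ge_Re. Qed.

Lemma Im_le_cmod (z : C) : `|complex.Im z| <= cmod z.
Proof.
have -> : complex.Im z = - complex.Re (z * 'i%C) by rewrite ReiNIm opprK.
rewrite normrN (le_trans (Re_le_cmod _)) // cmodM.
by rewrite (_ : cmod 'i%C = 1) ?mulr1 // /cmod normc_def /= expr0n add0r expr1n sqrtr1.
Qed.

Lemma cmod_le_ReIm (z : C) : cmod z <= `|complex.Re z| + `|complex.Im z|.
Proof.
rewrite {1}[z]complexE (le_trans (cmodD _ _)) // cmodM.
rewrite (_ : cmod 'i%C = 1) ?mul1r; last first.
  by rewrite /cmod normc_def /= expr0n add0r expr1n sqrtr1.
by rewrite /cmod !normc_def /= !expr0n !addr0 !sqrtr_sqr.
Qed.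

Lemma rnormZ (V : normedModType C) (k : C) (x : V) : rnorm (k *: x) = cmod k * rnorm x.
Proof. by apply: complexI; rewrite rmorphM /= -cmodE -!normE normrZ. Qed.

Lemma ReD (z w : C) : complex.Re (z + w) = complex.Re z + complex.Re w.
Proof. by case: z; case: w. Qed.

Lemma ReN (z : C) : complex.Re (- z) = - complex.Re z.
Proof. by case: z. Qed.

Lemma ImD (z w : C) : complex.Im (z + w) = complex.Im z + complex.Im w.
Proof. by case: z; case: w. Qed.

Lemma ImN (z : C) : complex.Im (- z) = - complex.Im z.
Proof. by case: z. Qed.

(** Radii in [R[i]]-normed modules are complex numbers. Convergence and completeness are restated
    for sequences with real bounds, non-strict ones since these pass to limits. *)
Definition cvs (V : normedModType C) (u : nat -> V) (l : V) :=
  forall e : R, 0 < e -> exists N, forall n, (N <= n)%N -> rnorm (u n - l) <= e.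

Definition cauchys (V : normedModType C) (u : nat -> V) :=
  forall e : R, 0 < e -> exists N, forall m n, (N <= m)%N -> (N <= n)%N ->
    rnorm (u m - u n) <= e.

Definition seq_complete (V : normedModType C) :=
  forall u : nat -> V, cauchys u -> exists l, cvs u l.

Lemma nbhs_rnorm (V : normedModType C) (x : V) (A : set V) :
  nbhs x A <-> exists2 e : R, 0 < e & forall y, rnorm (y - x) < e -> A y.
Proof.
split.
  rewrite -nbhs_ballE => -[e /= e0 h].
  have eE : e = (complex.Re e)%:C by rewrite RRe_real // gtr0_real.
  exists (complex.Re e); first by rewrite -ltcR -eE.
  by move=> y hy; apply: h; rewrite -ball_normE /= eE distrC rnorm_lt.
case=> e e0 h; rewrite -nbhs_ballE; exists e%:C; first by rewrite /= ltcR.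
by move=> y; rewrite -ball_normE /= distrC rnorm_lt => /h.
Qed.

Lemma small_half (e : R) : 0 < e -> exists n : nat, n.+1%:R^-1 < e.
Proof.
move=> e0; exists (Num.trunc e^-1).
rewrite invf_plt ?posrE // ?ltr0Sn //.
by have := truncnS_gt e^-1.
Qed.

(** A Cauchy filter contains balls of radius [1 / n.+1] about points [x n]. Any two of them meet, so
    the centres form a Cauchy sequence, whose limit is the limit of the filter. *)
Lemma complete_filter (V : normedModType C) : seq_complete V ->
  forall F : set_system V, ProperFilter F -> cauchy F -> cvg F.
Proof.
move=> hV F PF /cauchyP cF.
have /choice [x xP] : forall n : nat, exists x : V, F [set y | rnorm (y - x) < n.+1%:R^-1].
  move=> n; have : 0 < (n.+1%:R^-1 : R)%:C :> C by rewrite ltcR invr_gt0.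
  move=> /cF [x Fx]; exists x; apply: filterS Fx => y.
  by rewrite -ball_normE /= distrC rnorm_lt.
have xx m n : rnorm (x m - x n) < m.+1%:R^-1 + n.+1%:R^-1.
  have [y [/= ym yn]] := filter_ex (filterI (xP m) (xP n)).
  by rewrite (le_lt_trans (rnorm_dist y _ _)) // ltrD // rnormB.
have [l lP] : exists l, cvs x l.
  apply: hV => e e0; have [N hN] := small_half (divr_gt0 e0 (ltr0n _ 2)).
  exists N => m n hm hn; apply/ltW/(lt_le_trans (xx m n)).
  have h k : (N <= k)%N -> (k.+1%:R^-1 : R) <= e / 2.
    by move=> hk; apply: le_trans (ltW hN); rewrite lef_pV2 ?posrE ?ltr0Sn // ler_nat.
  by rewrite (splitr e) lerD // h.
apply/cvg_ex; exists l => A /nbhs_rnorm [e e0 hA].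
have e3 : 0 < e / 3 by rewrite divr_gt0.
have [N hN] := small_half e3; have [N' hN'] := lP _ e3.
set n := maxn N N'.
apply: filterS (xP n) => y /= hy; apply: hA.
apply: le_lt_trans (rnorm_dist (x n) _ _) _.
have h1 := hN' n (leq_maxr _ _).
have h2 : (n.+1%:R^-1 : R) <= N.+1%:R^-1.
  by rewrite lef_pV2 ?posrE ?ltr0Sn // ler_nat ltnS leq_maxl.
have h3 := lt_trans (lt_le_trans hy h2) hN; lra.
Qed.

Lemma complete_seq (V : completeNormedModType C) : seq_complete V.
Proof.
move=> u cu.
have : cvg (u @ \oo).
  apply: cauchy_cvg; apply/cauchyP => e e0.
  have eE : e = (complex.Re e)%:C by rewrite RRe_real // gtr0_real.
  have e0' : 0 < complex.Re e by rewrite -ltcR -eE.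
  have [N hN] := cu _ (divr_gt0 e0' (ltr0n _ 2)).
  exists (u N); exists N => //= n hn; rewrite -ball_normE /= eE rnorm_lt.
  by have := hN N n (leqnn _) hn; lra.
move=> /cvg_ex [l hl]; exists l => e e0.
have : nbhs l [set y | rnorm (y - l) < e] by apply/nbhs_rnorm; exists e.
by move=> /hl [N _ h]; exists N => n /h /= /ltW.
Qed.

Lemma cvs_unique (V : normedModType C) (u : nat -> V) l l' :
  cvs u l -> cvs u l' -> l = l'.
Proof.
move=> h h'; apply/eqP; rewrite -subr_eq0; apply/eqP/rnorm_eq0/eqP.
rewrite eq_le rnorm_ge0 andbT; apply/ler_addgt0Pr => e e0; rewrite add0r.
have [N hN] := h _ (divr_gt0 e0 (ltr0n _ 2)).
have [N' hN'] := h' _ (divr_gt0 e0 (ltr0n _ 2)).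
rewrite (le_trans (rnorm_dist (u (maxn N N')) _ _)) // (splitr e) lerD //.
  by rewrite rnormB hN // leq_maxl.
by rewrite hN' // leq_maxr.
Qed.

Lemma scalar_complete : seq_complete C^o.
Proof.
move=> u cu.
have key (f : C -> R) : (forall z w, f (z - w) = f z - f w) ->
    (forall z, `|f z| <= cmod z) ->
    exists l : R, forall e, 0 < e -> exists N, forall n, (N <= n)%N -> `|f (u n) - l| <= e.
  move=> fB fle; have : cvg ((f \o u : R^nat) @ \oo).
    apply: cauchy_cvg; apply/cauchyP => e e0.
    have [N hN] := cu _ (divr_gt0 e0 (ltr0n _ 2)).
    exists (f (u N)); exists N => //= n hn; rewrite -ball_normE /= -fB.
    apply: le_lt_trans (fle _) _; have := hN N n (leqnn _) hn.
    by rewrite rnorm_cmod; lra.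
  move=> /cvg_ex [l /cvgrPdist_le hl]; exists l => e e0.
  by have [N _ h] := hl _ e0; exists N => n /h /=; rewrite distrC.
have [a ha] : exists l : R, forall e, 0 < e -> exists N, forall n, (N <= n)%N ->
    `|complex.Re (u n) - l| <= e.
  by apply: key => [z w|z]; [rewrite ReD ReN | exact: Re_le_cmod].
have [b hb] : exists l : R, forall e, 0 < e -> exists N, forall n, (N <= n)%N ->
    `|complex.Im (u n) - l| <= e.
  by apply: key => [z w|z]; [rewrite ImD ImN | exact: Im_le_cmod].
exists (a +i* b) => e e0.
have [N hN] := ha _ (divr_gt0 e0 (ltr0n _ 2)).
have [N' hN'] := hb _ (divr_gt0 e0 (ltr0n _ 2)).
exists (maxn N N') => n; rewrite geq_max => /andP[/hN h1 /hN' h2].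
rewrite rnorm_cmod (le_trans (cmod_le_ReIm _)) // (splitr e).
by rewrite ReD ImD ReN ImN /= lerD.
Qed.

Lemma closed_approx (V : normedModType C) (A : set V) : closed A <->
  forall x, (forall e : R, 0 < e -> exists2 y, A y & rnorm (x - y) < e) -> A x.
Proof.
split=> [cA x h|h x cx].
  apply: cA => B /nbhs_rnorm [e e0 hB].
  by have [y Ay hy] := h _ e0; exists y; split => //; apply: hB; rewrite rnormB.
apply: h => e e0.
have : nbhs x [set y | rnorm (y - x) < e] by apply/nbhs_rnorm; exists e.
by move=> /cx [y [Ay hy]]; exists y => //; rewrite rnormB.
Qed.

Lemma dense_approx (V : normedModType C) (A : set V) :
  (forall x (e : R), 0 < e -> exists2 y, A y & rnorm (x - y) < e) -> dense A.
Proof.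
move=> h O [x Ox] oO.
have /nbhs_rnorm [e e0 hO] : nbhs x O by exact: open_nbhs_nbhs.
by have [y Ay hy] := h x _ e0; exists y; split => //; apply: hO; rewrite rnormB.
Qed.

Section Linear.
Context (K : nzRingType) (V W : lmodType K) (f : V -> W) (lf : linear f).

Lemma linD x y : f (x + y) = f x + f y.
Proof. by have := lf 1 x y; rewrite !scale1r. Qed.

Lemma lin0 : f 0 = 0.
Proof. by apply: (addrI (f 0)); rewrite -linD !addr0. Qed.

Lemma linZ k x : f (k *: x) = k *: f x.
Proof. by have := lf k x 0; rewrite lin0 !addr0. Qed.

Lemma linN x : f (- x) = - f x.
Proof. by rewrite -scaleN1r linZ scaleN1r. Qed.

Lemma linB x y : f (x - y) = f x - f y.
Proof. by rewrite linD linN. Qed.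

Lemma lin_sum (I : Type) (s : seq I) (g : I -> V) :
  f (\sum_(i <- s) g i) = \sum_(i <- s) f (g i).
Proof.
elim: s => [|a s IH]; first by rewrite !big_nil lin0.
by rewrite !big_cons linD IH.
Qed.

End Linear.

Lemma continuous_rnorm (V W : normedModType C) (f : V -> W) :
  linear f -> (exists2 M : R, 0 <= M & forall x, rnorm (f x) <= M * rnorm x) ->
  continuous f.
Proof.
move=> lf [M M0 hM] x A /nbhs_rnorm [e e0 hA]; apply/nbhs_rnorm.
have M1 : 0 < M + 1 by lra.
exists (e / (M + 1)); first by rewrite divr_gt0.
move=> y; rewrite ltr_pdivlMr // => hy; apply: hA.
rewrite -(linB lf).
apply: le_lt_trans (hM _) _; apply: le_lt_trans hy.
by rewrite mulrC ler_wpM2l ?rnorm_ge0 //; lra.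
Qed.

Lemma bounded_rnorm (V W : normedModType C) (f : V -> W) :
  linear f -> continuous f -> exists2 M : R, 0 <= M & forall x, rnorm (f x) <= M * rnorm x.
Proof.
move=> lf cf.
have f0 := lin0 lf.
have : nbhs (f 0) [set y : W | rnorm y < 1].
  by apply/nbhs_rnorm; exists 1 => // y; rewrite f0 subr0.
move=> /(cf 0) /nbhs_rnorm [e e0 h].
exists (2 / e); first by rewrite divr_ge0 // ltW.
move=> x; have [->|/eqP x0] := eqVneq x 0; first by rewrite f0 !rnorm0 mulr0.
have xn : 0 < rnorm x.
  by rewrite lt_neqAle rnorm_ge0 andbT eq_sym; apply/eqP => /rnorm_eq0.
have c0 : 0 <= e / 2 / rnorm x by rewrite !divr_ge0 // ltW.
have := h ((e / 2 / rnorm x)%:C *: x); rewrite /= subr0 (linZ lf) !rnormZ cmodC // divfK ?gt_eqF //.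
have -> : (e / 2 < e) = true by apply/idP; lra.
move=> /(_ isT) /= /ltW h1.
rewrite mulrAC ler_pdivlMr // mulrC.
by move: h1; rewrite mulrAC ler_pdivrMr // mul1r; lra.
Qed.

End NormBasics.

(** * Weighted sup-norm spaces, used for Hilbert completions and for operator norms *)

Section FunctionSpace.
Context (R : realType).
Local Notation C := R[i].

(* The closure of [fD], for the norm [sup_j |f j| / fk j], in a space of
   functions with values in a complete space. *)
Record fspace := FSpace {
  fJ : Type;
  fW : normedModType C;
  fk : fJ -> R;
  fD : set (fJ -> fW);
  fWc : seq_complete fW;
  fk_ge0 : forall j, 0 <= fk j;
  fD0 : fD (fun=> 0);
  fDlin : forall k f g, fD f -> fD g -> fD (fun j => k *: f j + g j);
  fDbd : forall f, fD f -> exists2 M : R, 0 <= M & forall j, rnorm (f j) <= M * fk j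
}.

Definition fclose (S : fspace) (f : fJ S -> fW S) :=
  forall e : R, 0 < e -> exists2 g, fD g & forall j, rnorm (f j - g j) <= e * fk j.

Record ffam (S : fspace) := Ffam { fv :> fJ S -> fW S; fvP : fclose fv }.

HB.instance Definition _ S := gen_eqMixin (ffam S).
HB.instance Definition _ S := gen_choiceMixin (ffam S).

Section Structure.
Context (S : fspace).
Implicit Types f g h : ffam S.

Lemma ffamP f g : (forall j, f j = g j) -> f = g.
Proof.
case: f g => [f fP] [g gP] /= fg; have E : f = g by apply/funext.
by move: fP gP; rewrite E => fP gP; rewrite (Prop_irrelevance fP gP).
Qed.

Lemma fD_fclose (f : fJ S -> fW S) : fD f -> fclose f.
Proof.
by move=> Df e e0; exists f => // j; rewrite subrr rnorm0 mulr_ge0 ?fk_ge0 // ltW.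
Qed.

Lemma fclose_lin k (f g : fJ S -> fW S) :
  fclose f -> fclose g -> fclose (fun j => k *: f j + g j).
Proof.
move=> hf hg e e0.
have K1 : 0 < cmod k + 1 by rewrite ltr_wpDl ?cmod_ge0.
have [f' Df' hf'] := hf _ (divr_gt0 (divr_gt0 e0 (ltr0n _ 2)) K1).
have [g' Dg' hg'] := hg _ (divr_gt0 e0 (ltr0n _ 2)).
exists (fun j => k *: f' j + g' j) => [|j]; first exact: fDlin.
rewrite opprD addrACA -scalerBr (le_trans (rnormD _ _)) // rnormZ.
rewrite (splitr e) mulrDl lerD //.
apply: le_trans (_ : (cmod k + 1) * rnorm (f j - f' j) <= _).
  by rewrite ler_wpM2r ?rnorm_ge0 //; lra.
apply: le_trans (ler_wpM2l (ltW K1) (hf' j)) _.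
by rewrite mulrA mulrCA divff ?mulr1 ?gt_eqF.
Qed.

Lemma fclose0 : fclose (fun=> 0 : fW S).
Proof. exact: fD_fclose (fD0 S). Qed.

Definition fzero : ffam S := Ffam fclose0.

Lemma fclose_scale k f : fclose (fun j => k *: f j).
Proof.
have := fclose_lin k (fvP f) fclose0.
by congr fclose; apply/funext => j; rewrite addr0.
Qed.

Lemma fclose_add f g : fclose (fun j => f j + g j).
Proof.
have := fclose_lin 1 (fvP f) (fvP g).
by congr fclose; apply/funext => j; rewrite scale1r.
Qed.

Definition fscale k f : ffam S := Ffam (fclose_scale k f).
Definition fadd f g : ffam S := Ffam (fclose_add f g).

Lemma faddA : associative fadd.
Proof. by move=> f g h; apply: ffamP => j; rewrite /= addrA. Qed.
Lemma faddC : commutative fadd.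
Proof. by move=> f g; apply: ffamP => j; rewrite /= addrC. Qed.
Lemma fadd0 : left_id fzero fadd.
Proof. by move=> f; apply: ffamP => j; rewrite /= add0r. Qed.
Lemma faddN : left_inverse fzero (fscale (-1)) fadd.
Proof. by move=> f; apply: ffamP => j; rewrite /= scaleN1r addNr. Qed.

HB.instance Definition _ := GRing.isZmodule.Build (ffam S) faddA faddC fadd0 faddN.

Lemma fscaleA a b f : fscale a (fscale b f) = fscale (a * b) f.
Proof. by apply: ffamP => j; rewrite /= scalerA. Qed.
Lemma fscale1 : left_id 1 fscale.
Proof. by move=> f; apply: ffamP => j; rewrite /= scale1r. Qed.
Lemma fscaleDr : right_distributive fscale +%R.
Proof. by move=> k f g; apply: ffamP => j; rewrite /= scalerDr. Qed.
Lemma fscaleDl f : {morph fscale^~ f : a b / a + b}.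
Proof. by move=> a b; apply: ffamP => j; rewrite /= scalerDl. Qed.

HB.instance Definition _ :=
  GRing.Zmodule_isLmodule.Build C (ffam S) fscaleA fscale1 fscaleDr fscaleDl.

Lemma fvD f g j : (f + g) j = f j + g j. Proof. by []. Qed.
Lemma fvN f j : (- f) j = - f j. Proof. by rewrite -[in RHS]scaleN1r. Qed.
Lemma fvB f g j : (f - g) j = f j - g j. Proof. by rewrite fvD fvN. Qed.

(** Admissible constants are used instead of the quotients [|f j| / fk j] because the weight may
    vanish. *)
Definition fbound (f : fJ S -> fW S) : set R :=
  [set M | 0 <= M /\ forall j, rnorm (f j) <= M * fk j].

Lemma fbound_ex f : exists M, fbound f M.
Proof.
have [g Dg hg] := fvP f ltr01; have [M M0 hM] := fDbd Dg.
exists (1 + M); split=> [|j]; first by rewrite addr_ge0.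
rewrite -[f j](subrK (g j)) (le_trans (rnormD _ _)) // mulrDl lerD //.
Qed.

Definition fnorm f : R := inf (fbound f).

Lemma fnorm_ge0 f : 0 <= fnorm f.
Proof. by apply: lb_le_inf; [exact: fbound_ex | move=> M []]. Qed.

Lemma le_fnorm f j : rnorm (f j) <= fnorm f * fk j.
Proof.
have [k0|k0] := eqVneq (fk j) 0.
  by have [M [_ /(_ j)]] := fbound_ex f; rewrite k0 !mulr0.
have k1 : 0 < fk j by rewrite lt_neqAle eq_sym k0 fk_ge0.
rewrite -ler_pdivrMr //; apply: lb_le_inf; first exact: fbound_ex.
by move=> M [_ /(_ j)]; rewrite ler_pdivrMr.
Qed.

Lemma fnorm_le f M : 0 <= M -> (forall j, rnorm (f j) <= M * fk j) -> fnorm f <= M.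
Proof. by move=> M0 h; apply: ge_inf => //; exists 0 => N []. Qed.

Lemma fnormD f g : fnorm (f + g) <= fnorm f + fnorm g.
Proof.
apply: fnorm_le => [|j]; first by rewrite addr_ge0 ?fnorm_ge0.
by rewrite mulrDl (le_trans (rnormD _ _)) // lerD // le_fnorm.
Qed.

Lemma fnormZ_le k f : fnorm (k *: f) <= cmod k * fnorm f.
Proof.
apply: fnorm_le => [|j]; first by rewrite mulr_ge0 ?fnorm_ge0 ?cmod_ge0.
by rewrite /= rnormZ -mulrA ler_wpM2l ?cmod_ge0 // le_fnorm.
Qed.

Lemma fnormZ k f : fnorm (k *: f) = cmod k * fnorm f.
Proof.
apply/eqP; rewrite eq_le fnormZ_le /=.
have [->|k0] := eqVneq k 0; first by rewrite cmod0 mul0r fnorm_ge0.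
have c0 : 0 < cmod k.
  by rewrite lt_neqAle cmod_ge0 andbT eq_sym; apply: contraNneq k0 => /cmod_eq0 ->.
rewrite -ler_pdivlMl // -{1}[f]scale1r -(mulVf k0) -scalerA.
apply: le_trans (fnormZ_le _ _) _; rewrite ler_wpM2r ?fnorm_ge0 //.
have /eqP : cmod k^-1 * cmod k = 1 by rewrite -cmodM mulVf // cmodC.
by rewrite -[X in _ == X](mulVf (lt0r_neq0 c0)) (inj_eq (mulIf (lt0r_neq0 c0))) => /eqP ->.
Qed.

Lemma fnorm_eq0 f : fnorm f = 0 -> f = 0.
Proof.
move=> h; apply: ffamP => j; apply: rnorm_eq0; apply/eqP.
by rewrite eq_le rnorm_ge0 andbT (le_trans (le_fnorm f j)) // h mul0r.
Qed.

Definition fnormc f : C := (fnorm f)%:C.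

Lemma fnormcD f g : fnormc (f + g) <= fnormc f + fnormc g.
Proof. by rewrite -rmorphD lecR fnormD. Qed.

Lemma fnormcZ k f : fnormc (k *: f) = `|k| * fnormc f.
Proof. by rewrite /fnormc fnormZ rmorphM /= cmodE. Qed.

Lemma fnormc_eq0 f : fnormc f = 0 -> f = 0.
Proof. by move=> [] /fnorm_eq0. Qed.

HB.instance Definition _ := Lmodule_isNormed.Build C (ffam S) fnormcD fnormcZ fnormc_eq0.

Lemma ffam_le f j : rnorm (f j) <= rnorm f * fk j. Proof. exact: le_fnorm. Qed.

Lemma ffam_norm_le f M :
  0 <= M -> (forall j, rnorm (f j) <= M * fk j) -> rnorm f <= M.
Proof. exact: fnorm_le. Qed.

(** The pointwise limit of a Cauchy sequence is also its limit for the weighted norm, hence still in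
    the closure of [fD]. *)
Lemma ffam_seq_complete : seq_complete (ffam S).
Proof.
move=> u cu.
have cuj j : cauchys (fun n => u n j).
  move=> e e0; have k1 : 0 < fk j + 1 by rewrite ltr_wpDl ?fk_ge0.
  have [N hN] := cu _ (divr_gt0 e0 k1); exists N => m n hm hn.
  rewrite -fvB (le_trans (ffam_le _ _)) // (le_trans (ler_wpM2r _ (hN m n hm hn))) ?fk_ge0 //.
  rewrite mulrAC ler_pdivrMr // ler_wpM2l ?(ltW e0) //; lra.
have /choice [l hl] : forall j, exists y, cvs (fun n => u n j) y.
  by move=> j; apply: fWc.
have ul e : 0 < e -> exists N, forall n, (N <= n)%N -> forall j,
    rnorm (u n j - l j) <= e * fk j.
  move=> e0; have [N hN] := cu _ e0; exists N => n hn j.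
  apply/ler_addgt0Pr => d d0; have [M hM] := hl j _ d0.
  apply: le_trans (rnorm_dist (u (maxn N M) j) _ _) _; rewrite lerD //.
    rewrite -fvB (le_trans (ffam_le _ _)) // ler_wpM2r ?fk_ge0 // hN //.
    exact: leq_maxl.
  by rewrite hM // leq_maxr.
have lP : fclose l.
  move=> e e0; have e2 : 0 < e / 2 by rewrite divr_gt0.
  have [N hN] := ul _ e2; have [g Dg hg] := fvP (u N) e2.
  exists g => // j; rewrite (le_trans (rnorm_dist (u N j) _ _)) // (splitr e) mulrDl.
  by rewrite lerD // rnormB hN.
exists (Ffam lP) => e e0; have [N hN] := ul _ e0; exists N => n hn.
by apply: ffam_norm_le => [|j]; [exact: ltW | rewrite fvB hN].
Qed.

Lemma ffam_cauchy_cvg (F : set_system (ffam S)) :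
  ProperFilter F -> cauchy F -> cvg F.
Proof. exact: complete_filter ffam_seq_complete F. Qed.

HB.instance Definition _ := Uniform_isComplete.Build (ffam S) ffam_cauchy_cvg.

End Structure.
End FunctionSpace.

(** * Calculus of convergent sequences *)

Section Convergence.
Context (R : realType).
Local Notation C := R[i].
Implicit Type V : normedModType C.

Lemma cvsP V (u : nat -> V) l (K : R) : 0 <= K ->
  (forall e, 0 < e -> exists N, forall n, (N <= n)%N -> rnorm (u n - l) <= K * e) ->
  cvs u l.
Proof.
move=> K0 h e e0; have K1 : 0 < K + 1 by lra.
have [N hN] := h _ (divr_gt0 e0 K1); exists N => n /hN /le_trans; apply.
by rewrite mulrCA ger_pMr // ler_pdivrMr // mul1r; lra.
Qed.

Lemma cvs2 V V' (u : nat -> V) l (v : nat -> V') l' (e : R) : cvs u l -> cvs v l' -> 0 < e ->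
  exists N, forall n, (N <= n)%N -> rnorm (u n - l) <= e /\ rnorm (v n - l') <= e.
Proof.
move=> hu hv e0; have [N hN] := hu _ e0; have [M hM] := hv _ e0.
by exists (maxn N M) => n; rewrite geq_max => /andP[/hN ? /hM ?].
Qed.

Lemma cvs_cst V (l : V) : cvs (fun=> l) l.
Proof. by move=> e e0; exists 0%N => n _; rewrite subrr rnorm0 ltW. Qed.

Lemma cvsD V (u v : nat -> V) l l' : cvs u l -> cvs v l' -> cvs (fun n => u n + v n) (l + l').
Proof.
move=> hu hv; apply: (@cvsP _ _ _ 2) => // e e0.
have [N hN] := cvs2 hu hv e0; exists N => n /hN [h1 h2].
by rewrite opprD addrACA (le_trans (rnormD _ _)) //; lra.
Qed.

Lemma cvsZ V (k : C) (u : nat -> V) l : cvs u l -> cvs (fun n => k *: u n) (k *: l).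
Proof.
move=> hu; apply: (@cvsP _ _ _ (cmod k)); first exact: cmod_ge0.
move=> e e0; have [N hN] := hu _ e0; exists N => n /hN h1.
by rewrite -scalerBr rnormZ ler_wpM2l ?cmod_ge0.
Qed.

Lemma eq_cvs V (u v : nat -> V) l : u =1 v -> cvs u l -> cvs v l.
Proof. by move=> /funext ->. Qed.

Lemma cvsB V (u v : nat -> V) l l' : cvs u l -> cvs v l' -> cvs (fun n => u n - v n) (l - l').
Proof.
move=> hu hv; have := cvsD hu (cvsZ (-1) hv); rewrite scaleN1r.
by apply: eq_cvs => n; rewrite scaleN1r.
Qed.

Lemma rnorm_diff V (x y : V) : `|rnorm x - rnorm y| <= rnorm (x - y).
Proof.
have h1 := rnormD (x - y) y; have h2 := rnormD (y - x) x.
rewrite subrK in h1; rewrite subrK rnormB in h2.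
by rewrite ler_norml; lra.
Qed.

Lemma cvs_bounded V (u : nat -> V) l : cvs u l ->
  exists N, forall n, (N <= n)%N -> rnorm (u n) <= rnorm l + 1.
Proof.
move=> h; have [N hN] := h _ ltr01; exists N => n /hN h1.
by have := rnormD (u n - l) l; rewrite subrK; lra.
Qed.

Lemma cvs_rnorm V (u : nat -> V) l : cvs u l ->
  cvs (fun n => (rnorm (u n))%:C : C^o) (rnorm l)%:C.
Proof.
move=> h e e0; have [N hN] := h _ e0; exists N => n /hN h1.
rewrite rnorm_cmod -rmorphB /cmod normc_def /= expr0n addr0 sqrtr_sqr.
exact: le_trans (rnorm_diff _ _) h1.
Qed.

Lemma cvsM (u v : nat -> C^o) l l' : cvs u l -> cvs v l' ->
  cvs (fun n => (u n * v n : C^o)) (l * l').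
Proof.
move=> hu hv; have [N hN] := cvs_bounded hv.
apply: (@cvsP _ _ _ (rnorm l' + 1 + rnorm l)); first by rewrite !addr_ge0 ?rnorm_ge0.
move=> e e0; have [M hM] := cvs2 hu hv e0.
exists (maxn N M) => n; rewrite geq_max => /andP[/hN h0 /hM [h1 h2]].
rewrite (_ : u n * v n - l * l' = (u n - l) * v n + l * (v n - l')); last by ring.
rewrite (le_trans (rnormD _ _)) // !rnorm_cmod !cmodM -!rnorm_cmod.
have p1 := ler_pM (rnorm_ge0 _) (rnorm_ge0 _) h1 h0.
have p2 := ler_wpM2l (rnorm_ge0 l) h2.
apply: le_trans (lerD p1 p2) _; rewrite le_eqVlt; apply/orP; left; apply/eqP; ring.
Qed.

Lemma cvs_conj (u : nat -> C^o) l : cvs u l -> cvs (fun n => Num.conj (u n) : C^o) (Num.conj l).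
Proof.
move=> h e e0; have [N hN] := h _ e0; exists N => n /hN.
have -> : Num.conj (u n) - Num.conj l = Num.conj (u n - l) :> C by rewrite rmorphB.
by rewrite !rnorm_cmod cmod_conj.
Qed.

Lemma cvs_eq V (u v : nat -> V) l l' : u =1 v -> cvs u l -> cvs v l' -> l = l'.
Proof. by move=> /funext -> hu hv; exact: cvs_unique hu hv. Qed.

End Convergence.

(** * Cauchy-Schwarz and the Hilbert completion of a semidefinite form *)

Section PreHilbert.
Context (R : realType).
Local Notation C := R[i].

(* A positive semidefinite form, only meaningful on the subspace [pD]. *)
Record prehilbert := PreHilbert {
  pV : lmodType C;
  pD : set pV;
  pip : pV -> pV -> C;
  pD0 : pD 0;
  pDlin : forall k u v, pD u -> pD v -> pD (k *: u + v);
  pip_lin : forall k u v w, pD u -> pD v -> pD w ->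
    pip (k *: u + v) w = k * pip u w + pip v w;
  pip_conj : forall u v, pD u -> pD v -> pip v u = Num.conj (pip u v);
  pip_ge0 : forall u, pD u -> 0 <= pip u u
}.

Context (P : prehilbert).

Definition snorm (u : pV P) : R := Num.sqrt (complex.Re (pip u u)).

Lemma snorm_ge0 (u : pV P) : 0 <= snorm u. Proof. exact: sqrtr_ge0. Qed.

Lemma snorm_sqr (u : pV P) : pD u -> ((snorm u) ^+ 2)%:C = pip u u.
Proof.
move=> Du; have := pip_ge0 Du; rewrite lecE /= => /andP[/eqP h1 h2].
by rewrite sqr_sqrtr // RRe_real // ger0_real // pip_ge0.
Qed.

Lemma pip_linr k (u v w : pV P) : pD u -> pD v -> pD w ->
  pip w (k *: u + v) = Num.conj k * pip w u + pip w v.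
Proof.
move=> Du Dv Dw; rewrite pip_conj //; last exact: pDlin.
by rewrite pip_lin // rmorphD rmorphM /= -!pip_conj.
Qed.

Lemma pip_CS (u v : pV P) : pD u -> pD v -> cmod (pip u v) <= snorm u * snorm v.
Proof.
move=> Du Dv; set c := pip u v.
(* The squared seminorm of [u - t c v]. *)
have h (t : R) : 0 <= snorm u ^+ 2 - 2 * t * cmod c ^+ 2 + t ^+ 2 * cmod c ^+ 2 * snorm v ^+ 2.
  have Dw : pD ((- (t%:C * c)) *: v + u) by apply: pDlin.
  have hc : Num.conj (- (t%:C * c)) = - (t%:C * Num.conj c).
    by rewrite rmorphN rmorphM /= !conj_conjc conjc_real.
  rewrite -ler0c (_ : _%:C = pip ((- (t%:C * c)) *: v + u) ((- (t%:C * c)) *: v + u)).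
    exact: pip_ge0.
  rewrite pip_lin // !pip_linr // hc (pip_conj Du Dv) -/c -!snorm_sqr //.
  have -> (a b g : R) : (a - 2 * t * g + t ^+ 2 * g * b)%:C =
      a%:C - 2 * t%:C * g%:C + t%:C ^+ 2 * g%:C * b%:C by ring.
  rewrite cmod_sqr; ring.
have [c0|c0] := eqVneq (cmod c) 0; first by rewrite c0 mulr_ge0 ?snorm_ge0.
have c1 : 0 < cmod c by rewrite lt_neqAle eq_sym c0 cmod_ge0.
have [v0|v0] := eqVneq (snorm v) 0.
  (* For a null vector [v] the quadratic is affine in [t], and this value of [t] would make it equal
     to [-1]. *)
  have := h ((snorm u ^+ 2 + 1) / (2 * cmod c ^+ 2)).
  have -> : 2 * ((snorm u ^+ 2 + 1) / (2 * cmod c ^+ 2)) * cmod c ^+ 2 = snorm u ^+ 2 + 1.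
    by field.
  by rewrite v0 expr0n mulr0 addr0; lra.
have v1 : 0 < snorm v by rewrite lt_neqAle eq_sym v0 snorm_ge0.
have := h ((snorm v ^+ 2)^-1).
have -> : ((snorm v ^+ 2)^-1) ^+ 2 * cmod c ^+ 2 * snorm v ^+ 2 = (snorm v ^+ 2)^-1 * cmod c ^+ 2.
  by field.
move=> h1; rewrite -[leLHS]ger0_norm ?cmod_ge0 // -[leRHS]ger0_norm ?mulr_ge0 ?snorm_ge0 //.
rewrite -ler_sqr ?nnegrE ?normr_ge0 // !real_normK ?num_real // exprMn.
by rewrite -ler_pdivrMr ?exprn_gt0 // mulrC; lra.
Qed.

(** The completion is realised inside the antidual: [v] becomes the function [w |-> <v, w>], whose
    best bound against the weight [snorm w] is [snorm v] by Cauchy-Schwarz. Null vectors become 0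
    without a quotient being formed. *)
Definition prow (v : pV P) : {w | pD w} -> C^o := fun j => pip v (sval j).

Definition prows : set ({w | @pD P w} -> C^o) := [set f | exists2 v, pD v & f = prow v].

Lemma prows0 : prows (fun=> 0).
Proof.
exists 0; first exact: pD0; apply/funext => -[w Dw]; rewrite /prow /=.
have := pip_lin (-1) (pD0 P) (pD0 P) Dw; rewrite scaler0 addr0 => ->.
by rewrite mulN1r addNr.
Qed.

Lemma prows_lin k f g : prows f -> prows g -> prows (fun j => k *: f j + g j).
Proof.
move=> [u Du ->] [v Dv ->]; exists (k *: u + v); first exact: pDlin.
by apply/funext => -[w Dw]; rewrite /prow /= pip_lin.
Qed.

Lemma prows_bd f : prows f -> exists2 M : R, 0 <= M & forall j, rnorm (f j) <= M * snorm (sval j).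
Proof.
by move=> [u Du ->]; exists (snorm u); [exact: snorm_ge0 | move=> [w Dw]; exact: pip_CS].
Qed.

Definition pspace : fspace R :=
  FSpace (@scalar_complete R) (fun j => snorm_ge0 (sval j)) prows0 prows_lin prows_bd.

Definition phil : Type := ffam pspace.
HB.instance Definition _ := CompleteNormedModule.on phil.

Lemma prow_fclose (v : pV P) : pD v -> fclose (prow v : fJ pspace -> fW pspace).
Proof. by move=> Dv; apply: fD_fclose; exists v. Qed.

Definition emb (v : pV P) : phil :=
  if pselect (pD v) is left Dv then Ffam (prow_fclose Dv) else 0.

Lemma embE v (j : {w | pD w}) : pD v -> (emb v : ffam pspace) j = pip v (sval j).
Proof. by move=> Dv; rewrite /emb; case: pselect. Qed.

Lemma emb_lin k (u v : pV P) : pD u -> pD v -> emb (k *: u + v) = k *: emb u + emb v.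
Proof.
move=> Du Dv; apply: (@ffamP _ pspace) => -[w Dw].
rewrite embE //=; last exact: pDlin.
by rewrite pip_lin // !embE.
Qed.

Lemma emb_dist (u v : pV P) : pD u -> pD v -> emb u - emb v = emb (u - v).
Proof. by move=> Du Dv; rewrite [u - v]addrC -scaleN1r emb_lin // scaleN1r addrC. Qed.

Lemma pDB (u v : pV P) : pD u -> pD v -> pD (u - v).
Proof. by move=> Du Dv; rewrite addrC -scaleN1r; apply: pDlin. Qed.

Lemma rnorm_emb (v : pV P) : pD v -> rnorm (emb v) = snorm v.
Proof.
move=> Dv; apply/eqP; rewrite eq_le; apply/andP; split.
  apply: (@ffam_norm_le _ pspace) => [|[w Dw]]; first exact: snorm_ge0.
  by rewrite embE // rnorm_cmod pip_CS.
have := @ffam_le _ pspace (emb v) (exist _ v Dv); rewrite embE //= rnorm_cmod -snorm_sqr //.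
rewrite cmodC ?sqr_ge0 // expr2.
have [->|v0] := eqVneq (snorm v) 0; first by rewrite rnorm_ge0.
by rewrite ler_pM2r // lt_neqAle eq_sym v0 snorm_ge0.
Qed.

Lemma emb_dense (x : phil) (e : R) : 0 < e -> exists2 v, pD v & rnorm (x - emb v) < e.
Proof.
move=> e0; have e2 : 0 < e / 2 by lra.
have [_ [v Dv ->] hv] := @fvP _ pspace x _ e2; exists v => //.
apply: (@le_lt_trans _ _ (e / 2)); last lra.
apply: (@ffam_norm_le _ pspace) => [|j]; first exact: ltW.
by rewrite fvB embE //; exact: hv.
Qed.

Definition approx (v : nat -> pV P) (x : phil) := (forall n, pD (v n)) /\ cvs (emb \o v) x.

Lemma approx_ex x : exists v, approx v x.
Proof.
have /choice [v hv] : forall n : nat, exists v, pD v /\ rnorm (x - emb v) < n.+1%:R^-1.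
  by move=> n; have [|v] := @emb_dense x n.+1%:R^-1; [rewrite invr_gt0 | exists v].
exists v; split=> [n|e e0]; first by case: (hv n).
have [N hN] := small_half e0; exists N => n hn /=; rewrite rnormB.
apply: le_trans (ltW (hv n).2) (le_trans _ (ltW hN)).
by rewrite lef_pV2 ?posrE ?ltr0Sn // ler_nat ltnS.
Qed.

Lemma approx_lin k u v x y : approx u x -> approx v y ->
  approx (fun n => k *: u n + v n) (k *: x + y).
Proof.
move=> [Du hu] [Dv hv]; split=> [n|]; first exact: pDlin.
by apply: eq_cvs (cvsD (cvsZ k hu) hv) => n /=; rewrite emb_lin.
Qed.

Lemma pip_sub u v u' v' : pD u -> pD v -> pD u' -> pD v' ->
  cmod (pip u v - pip u' v') <=
  rnorm (emb u - emb u') * rnorm (emb v) + rnorm (emb u') * rnorm (emb v - emb v').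
Proof.
move=> Du Dv Du' Dv'.
rewrite !emb_dist //.
have E : pip u v - pip u' v' = pip (u - u') v + pip u' (v - v').
  rewrite [u - u']addrC [v - v']addrC -(scaleN1r u') -(scaleN1r v') pip_lin // pip_linr // rmorphN1.
  by rewrite !mulN1r; ring.
rewrite E (le_trans (cmodD _ _)) // !rnorm_emb //; try exact: pDB.
by rewrite lerD // pip_CS //; exact: pDB.
Qed.

(** Extension of the form by continuity. By [approx_pip_cauchy] any two choices of approximating
    sequences give the same limit, so the selection by [xget] is harmless. *)
Definition hip (x y : phil) : C :=
  xget 0 [set z : C^o | exists u v, [/\ approx u x, approx v y & cvs (fun n => pip (u n) (v n) : C^o) z]].

Lemma approx_pip_cauchy u v x y : approx u x -> approx v y ->
  forall u' v', approx u' x -> approx v' y -> 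
  forall e, 0 < e -> exists N, forall m n, (N <= m)%N -> (N <= n)%N ->
    cmod (pip (u m) (v m) - pip (u' n) (v' n)) <= e.
Proof.
move=> [Du hu] [Dv hv] u' v' [Du' hu'] [Dv' hv'] e e0.
set K := 2 * (rnorm y + 1) + 2 * (rnorm x + 1).
have K0 : 0 < K by rewrite /K; have := rnorm_ge0 x; have := rnorm_ge0 y; lra.
have d0 : 0 < e / K by rewrite divr_gt0.
have [N1 h1] := cvs2 hu hv d0; have [N2 h2] := cvs2 hu' hv' d0.
have [N3 h3] := cvs_bounded hv; have [N4 h4] := cvs_bounded hu'.
exists (maxn (maxn N1 N2) (maxn N3 N4)) => m n; rewrite !geq_max.
move=> /andP[/andP[/h1 /= [a1 a2] _] /andP[/h3 /= a3 _]].
move=> /andP[/andP[_ /h2 /= [b1 b2]] /andP[_ /h4 /= b3]].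
apply: le_trans (pip_sub _ _ _ _) _ => //.
have c1 : rnorm (emb (u m) - emb (u' n)) <= 2 * (e / K).
  by have := rnorm_dist x (emb (u m)) (emb (u' n)); rewrite (rnormB x); lra.
have c2 : rnorm (emb (v m) - emb (v' n)) <= 2 * (e / K).
  by have := rnorm_dist y (emb (v m)) (emb (v' n)); rewrite (rnormB y); lra.
have p1 := ler_pM (rnorm_ge0 _) (rnorm_ge0 _) c1 a3.
have p2 := ler_pM (rnorm_ge0 _) (rnorm_ge0 _) b3 c2.
apply: le_trans (lerD p1 p2) _.
rewrite [leLHS](_ : _ = K * (e / K)); last by rewrite /K; ring.
by rewrite mulrCA divff ?mulr1 // gt_eqF.
Qed.

Lemma hip_cvs u v x y : approx u x -> approx v y ->
  cvs (fun n => pip (u n) (v n) : C^o) (hip x y).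
Proof.
move=> hu hv.
have [z hz] : exists z : C^o, cvs (fun n => pip (u n) (v n) : C^o) z.
  by apply: scalar_complete => e /(approx_pip_cauchy hu hv hu hv).
rewrite /hip; case: xgetP => [z' _ [u' [v' [hu' hv' hz']]]|/(_ z)]; last first.
  by case; exists u, v.
apply: (@cvsP _ _ _ _ 2) => // e e0.
have [N hN] := approx_pip_cauchy hu hv hu' hv' e0.
have [N' hN'] := hz' _ e0; exists N => n hn.
have := rnorm_dist (pip (u' (maxn N N')) (v' (maxn N N')) : C^o) (pip (u n) (v n)) z'.
have a1 := hN n (maxn N N') hn (leq_maxl _ _); have a2 := hN' (maxn N N') (leq_maxr _ _).
by rewrite !rnorm_cmod in a1 a2 *; lra.
Qed.

Lemma hip_lin k x y z : hip (k *: x + y) z = k * hip x z + hip y z.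
Proof.
have [u hu] := approx_ex x; have [v hv] := approx_ex y; have [w hw] := approx_ex z.
have h := cvsD (cvsZ k (hip_cvs hu hw)) (hip_cvs hv hw).
apply: cvs_eq (hip_cvs (approx_lin k hu hv) hw) h => n /=.
by rewrite pip_lin; [| exact: hu.1 | exact: hv.1 | exact: hw.1].
Qed.

Lemma hip_conj x y : hip x y = Num.conj (hip y x).
Proof.
have [u hu] := approx_ex x; have [v hv] := approx_ex y.
apply: cvs_eq (hip_cvs hu hv) (cvs_conj (hip_cvs hv hu)) => n /=.
by rewrite -pip_conj; [| exact: hv.1 | exact: hu.1].
Qed.

Lemma hip_norm x : hip x x = `|x| ^+ 2.
Proof.
have [u hu] := approx_ex x; have h := cvs_rnorm hu.2.
rewrite normE; apply: cvs_eq (hip_cvs hu hu) (cvsM h h) => n /=.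
by rewrite -snorm_sqr ?rnorm_emb -?rmorphM -?expr2 //; exact: hu.1.
Qed.

Lemma hip_emb u v : pD u -> pD v -> hip (emb u) (emb v) = pip u v.
Proof.
move=> Du Dv; have h w : pD w -> approx (fun=> w) (emb w) by split=> //; exact: cvs_cst.
by apply: cvs_eq (hip_cvs (h _ Du) (h _ Dv)) (@cvs_cst _ C^o _).
Qed.

Lemma hip_linr x k y z : hip x (k *: y + z) = Num.conj k * hip x y + hip x z.
Proof. by rewrite hip_conj hip_lin rmorphD rmorphM /= -!hip_conj. Qed.

Lemma hip_bilinear : bilinear_for *%R (Num.conj \; *%R) (hip : phil -> phil -> C).
Proof. by split=> x k y z; [exact: hip_lin | exact: hip_linr]. Qed.

Lemma hip_pos x : x != 0 -> 0 < hip x x.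
Proof. by move=> x0; rewrite hip_norm exprn_gt0 // normr_gt0. Qed.

Lemma hip_herm x y : hip x y = (-1) ^+ false * Num.conj (hip y x).
Proof. by rewrite expr0 mul1r -hip_conj. Qed.

HB.instance Definition _ := @bilinear_isBilinear.Build C phil phil C *%R (Num.conj \; *%R) hip hip_bilinear.
HB.instance Definition _ := @isHermitianSesquilinear.Build C phil false Num.conj hip hip_herm.
HB.instance Definition _ := @isDotProduct.Build C phil hip hip_pos.

Theorem hilbert_completion : exists (H : hilbertSpace R) (i : pV P -> H),
  [/\ forall k u v, pD u -> pD v -> i (k *: u + v) = k *: i u + i v,
      forall u v, pD u -> pD v -> inner H (i u) (i v) = pip u v
    & forall x (e : R), 0 < e -> exists2 v, pD v & rnorm (x - i v) < e].
Proof.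
exists (@HilbertSpace R phil hip hip_norm), emb; split.
- exact: emb_lin.
- exact: hip_emb.
- exact: emb_dense.
Qed.

End PreHilbert.

(** * Inner products, adjoints and operator norms *)

Section HilbertBasics.
Context (R : realType) (H : hilbertSpace R).
Local Notation C := R[i].
Implicit Types x y z : H.

Lemma ilin k x y z : inner H (k *: x + y) z = k * inner H x z + inner H y z.
Proof. by rewrite linearPl. Qed.

Lemma iconj x y : inner H x y = Num.conj (inner H y x).
Proof. by rewrite hermC expr0 mul1r. Qed.

Lemma inner_lin z : linear (fun x => inner H x z : C^o).
Proof. by move=> k x y; exact: ilin. Qed.

Lemma iDl x y z : inner H (x + y) z = inner H x z + inner H y z.
Proof. exact: (linD (inner_lin z)). Qed.
Lemma iNl x z : inner H (- x) z = - inner H x z.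
Proof. exact: (linN (inner_lin z)). Qed.
Lemma iBl x y z : inner H (x - y) z = inner H x z - inner H y z.
Proof. by rewrite iDl iNl. Qed.
Lemma iZl k x z : inner H (k *: x) z = k * inner H x z.
Proof. exact: (linZ (inner_lin z)). Qed.
Lemma i0l z : inner H 0 z = 0.
Proof. exact: (lin0 (inner_lin z)). Qed.
Lemma iDr x y z : inner H x (y + z) = inner H x y + inner H x z.
Proof. by rewrite iconj iDl rmorphD /= -!iconj. Qed.
Lemma iNr x y : inner H x (- y) = - inner H x y.
Proof. by rewrite iconj iNl rmorphN /= -iconj. Qed.
Lemma iBr x y z : inner H x (y - z) = inner H x y - inner H x z.
Proof. by rewrite iDr iNr. Qed.
Lemma iZr k x y : inner H x (k *: y) = Num.conj k * inner H x y.
Proof. by rewrite iconj iZl rmorphM /= -iconj. Qed.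
Lemma i0r x : inner H x 0 = 0.
Proof. by rewrite iconj i0l rmorph0. Qed.

Lemma inner_sqr x : inner H x x = ((rnorm x) ^+ 2)%:C.
Proof. by rewrite inner_norm normE rmorphXn. Qed.

Definition prehilbert_of : prehilbert R.
Proof.
apply: (@PreHilbert R H setT (inner H)) => //.
- by move=> *; exact: ilin.
- by move=> *; exact: iconj.
Defined.

Lemma snorm_rnorm x : snorm (P := prehilbert_of) x = rnorm x.
Proof. by rewrite /snorm /= inner_sqr /= sqrtr_sqr ger0_norm ?rnorm_ge0. Qed.

Lemma inner_CS x y : cmod (inner H x y) <= rnorm x * rnorm y.
Proof. by rewrite -!snorm_rnorm; exact: (@pip_CS R prehilbert_of). Qed.

Lemma inner_ext x y : (forall z, inner H z x = inner H z y) -> x = y.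
Proof.
move=> h; apply/eqP; rewrite -subr_eq0; apply/eqP/rnorm_eq0/eqP.
by rewrite -sqrf_eq0 -(inj_eq (@complexI R)) -inner_sqr iBr h subrr.
Qed.

Lemma cvs_inner (u v : nat -> H) x y : cvs u x -> cvs v y ->
  cvs (fun n => inner H (u n) (v n) : C^o) (inner H x y).
Proof.
move=> hu hv; have [N hN] := cvs_bounded hu.
apply: (@cvsP _ _ _ _ (rnorm x + 1 + rnorm y)); first by rewrite !addr_ge0 ?rnorm_ge0.
move=> e e0; have [M hM] := cvs2 hu hv e0.
exists (maxn N M) => n; rewrite geq_max => /andP[/hN h0 /hM [h1 h2]].
have -> : inner H (u n) (v n) - inner H x y = inner H (u n) (v n - y) + inner H (u n - x) y.
  by rewrite iBr iBl; ring.
apply: le_trans (rnormD _ _) _; rewrite !rnorm_cmod.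
have p1 := ler_pM (rnorm_ge0 _) (rnorm_ge0 _) h0 h2.
have p2 := ler_wpM2r (rnorm_ge0 y) h1.
have := lerD (le_trans (inner_CS _ _) p1) (le_trans (inner_CS _ _) p2).
by move=> /le_trans; apply; rewrite le_eqVlt; apply/orP; left; apply/eqP; ring.
Qed.

Lemma cvs_op (V W : normedModType C) (T : V -> W) (M : R) (u : nat -> V) (l : V) : linear T -> 0 <= M ->
  (forall v, rnorm (T v) <= M * rnorm v) -> cvs u l -> cvs (T \o u) (T l).
Proof.
move=> lT M0 hM hu; apply: (@cvsP _ _ _ _ M) => // e e0.
have [N hN] := hu _ e0; exists N => n /hN h; rewrite /= -(linB lT).
by rewrite (le_trans (hM _)) // ler_wpM2l.
Qed.

(** Because [|S y|^2 = <T (S y), y>]. *)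
Lemma adjoint_bound (S T : H -> H) M : 0 <= M ->
  (forall x, rnorm (T x) <= M * rnorm x) ->
  (forall x y, inner H (T x) y = inner H x (S y)) -> forall y, rnorm (S y) <= M * rnorm y.
Proof.
move=> M0 hM hS y; have := inner_CS (T (S y)) y.
rewrite hS inner_sqr cmodC ?sqr_ge0 //.
have [->|s0] := eqVneq (rnorm (S y)) 0; first by rewrite mulr_ge0 ?rnorm_ge0.
have s1 : 0 < rnorm (S y) by rewrite lt_neqAle eq_sym s0 rnorm_ge0.
move=> h; have := le_trans h (ler_wpM2r (rnorm_ge0 y) (hM _)).
by rewrite expr2 mulrAC -mulrA mulrA ler_pM2r.
Qed.

Lemma opnorm_le (T : H -> H) M : 0 <= M -> (forall x, rnorm (T x) <= M * rnorm x) -> opnorm T <= M.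
Proof.
move=> M0 hM; apply: ge_sup; first by exists (rnorm (T 0)), 0 => //=; rewrite normr0.
move=> _ [x + <-]; rewrite /= (rnorm_le x 1) => x1.
by rewrite (le_trans (hM x)) // ler_piMr.
Qed.

Lemma le_opnorm (T : H -> H) M : linear T -> (forall x, rnorm (T x) <= M * rnorm x) ->
  forall x, rnorm (T x) <= opnorm T * rnorm x.
Proof.
move=> lT hM x.
have ub y : rnorm y <= 1 -> rnorm (T y) <= opnorm T.
  move=> y1; apply: ub_le_sup; last by exists y => //=; rewrite (rnorm_le y 1).
  exists `|M| => _ [z + <-]; rewrite /= (rnorm_le z 1) => z1.
  apply: le_trans (hM z) (le_trans (ler_norm _) _).
  by rewrite normrM (ger0_norm (rnorm_ge0 _)) ler_piMr.
have [->|/eqP x0] := eqVneq x 0; first by rewrite (lin0 lT) !rnorm0 mulr0.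
have xn : 0 < rnorm x.
  by rewrite lt_neqAle rnorm_ge0 andbT eq_sym; apply/eqP => /rnorm_eq0.
have := ub ((rnorm x)^-1%:C *: x).
rewrite (linZ lT) !rnormZ cmodC ?invr_ge0 ?rnorm_ge0 // mulVf ?gt_eqF // lexx => /(_ isT).
by rewrite mulrC ler_pdivrMr.
Qed.

End HilbertBasics.

(** * Extension of bounded linear maps from a dense image *)

Section Extension.
Context (R : realType).
Local Notation C := R[i].

Definition submod (U : lmodType C) (D : set U) :=
  D 0 /\ forall k u v, D u -> D v -> D (k *: u + v).

Definition lin_on (U V : lmodType C) (D : set U) (f : U -> V) :=
  forall k u v, D u -> D v -> f (k *: u + v) = k *: f u + f v.

Section Sub.
Context (U V : lmodType C) (D : set U) (f : U -> V) (sD : submod D) (lf : lin_on D f).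

Lemma submodB u v : D u -> D v -> D (u - v).
Proof. by move=> Du Dv; rewrite addrC -scaleN1r; apply: sD.2. Qed.

Lemma submodD u v : D u -> D v -> D (u + v).
Proof. by move=> Du Dv; rewrite -[u]scale1r; apply: sD.2. Qed.

Lemma submodZ k u : D u -> D (k *: u).
Proof. by move=> Du; rewrite -[_ *: _]addr0; apply: sD.2 => //; exact: sD.1. Qed.

Lemma submod_sum (I : Type) (s : seq I) (g : I -> U) :
  (forall i, D (g i)) -> D (\sum_(i <- s) g i).
Proof.
move=> h; elim: s => [|a s IH]; first by rewrite big_nil; exact: sD.1.
by rewrite big_cons; apply: submodD.
Qed.

Lemma lin_onB u v : D u -> D v -> f (u - v) = f u - f v.
Proof. by move=> Du Dv; rewrite addrC -scaleN1r lf // scaleN1r addrC. Qed.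

Lemma lin_onD u v : D u -> D v -> f (u + v) = f u + f v.
Proof. by move=> Du Dv; have := lf 1 Du Dv; rewrite !scale1r. Qed.

Lemma lin_on0 : f 0 = 0.
Proof. by rewrite -[0 in LHS]subr0 lin_onB ?subrr //; exact: sD.1. Qed.

Lemma lin_onZ k u : D u -> f (k *: u) = k *: f u.
Proof. by move=> Du; rewrite -[_ *: _]addr0 lf ?lin_on0 ?addr0 //; exact: sD.1. Qed.

Lemma lin_on_sum (I : Type) (s : seq I) (g : I -> U) :
  (forall i, D (g i)) -> f (\sum_(i <- s) g i) = \sum_(i <- s) f (g i).
Proof.
move=> h; elim: s => [|a s IH]; first by rewrite !big_nil lin_on0.
by rewrite !big_cons lin_onD ?IH //; exact: submod_sum.
Qed.

End Sub.

Section Extend.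
Context (U : lmodType C) (D : set U) (V W : normedModType C) (hW : seq_complete W).
Context (i : U -> V) (f : U -> W) (M : R).
Hypothesis sD : submod D.
Hypothesis li : lin_on D i.
Hypothesis lf : lin_on D f.
Hypothesis M0 : 0 <= M.
Hypothesis fM : forall u, D u -> rnorm (f u) <= M * rnorm (i u).
Hypothesis iD : forall x (e : R), 0 < e -> exists2 u, D u & rnorm (x - i u) < e.

Let M1 : 0 < M + 1. Proof. by rewrite ltr_wpDl. Qed.

Let approaches (u : nat -> U) x := (forall n, D (u n)) /\ cvs (i \o u) x.

Let approaches_ex x : exists u, approaches u x.
Proof.
have /choice [v hv] : forall n : nat, exists v, D v /\ rnorm (x - i v) < n.+1%:R^-1.
  by move=> n; have [|v] := @iD x n.+1%:R^-1; [rewrite invr_gt0 | exists v].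
exists v; split=> [n|e e0]; first by case: (hv n).
have [N hN] := small_half e0; exists N => n hn /=; rewrite rnormB.
apply: le_trans (ltW (hv n).2) (le_trans _ (ltW hN)).
by rewrite lef_pV2 ?posrE ?ltr0Sn // ler_nat ltnS.
Qed.

Let F x : W := xget 0 [set y | exists2 u, approaches u x & cvs (f \o u) y].

Let F_cvs u x : approaches u x -> cvs (f \o u) (F x).
Proof.
move=> [Du hu].
have fB m n (v w : nat -> U) : D (v m) -> D (w n) ->
    rnorm (f (v m) - f (w n)) <= M * rnorm (i (v m) - i (w n)).
  by move=> Dm Dn; rewrite -(lin_onB lf) // -(lin_onB li) // fM //; exact: submodB.
have [y hy] : exists y, cvs (f \o u) y.
  apply: hW => e e0; have d0 : 0 < e / (2 * (M + 1)) by rewrite divr_gt0 ?mulr_gt0.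
  have [N hN] := hu _ d0; exists N => m n /hN h1 /hN h2 /=.
  apply: le_trans (fB m n u u (Du m) (Du n)) _.
  have h3 := rnorm_dist x (i (u m)) (i (u n)); rewrite (rnormB x) in h3.
  have h4 : rnorm (i (u m) - i (u n)) <= 2 * (e / (2 * (M + 1))) by rewrite /= in h1 h2; lra.
  apply: le_trans (ler_wpM2l M0 h4) _.
  have -> : M * (2 * (e / (2 * (M + 1)))) = e * (M / (M + 1)).
    by field; rewrite gt_eqF.
  by rewrite ler_piMr ?(ltW e0) // ler_pdivrMr // mul1r lerDl.
rewrite /F; case: xgetP => [z _ [v [Dv hv] hz]|/(_ y)]; last by case; exists u.
apply: (@cvsP _ _ _ _ (2 * M + 1)) => [|e e0].
  by rewrite addr_ge0 ?mulr_ge0.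
have [N hN] := cvs2 hu hv e0; have [N' hN'] := hz _ e0; exists (maxn N N') => n.
rewrite geq_max => /andP[/hN /= [h1 h2] /hN' /= h3].
have h4 := rnorm_dist (f (v n)) (f (u n)) z.
have h5 := fB n n u v (Du n) (Dv n).
have h6 := rnorm_dist x (i (u n)) (i (v n)); rewrite (rnormB x) in h6.
have h7 : rnorm (i (u n) - i (v n)) <= 2 * e by lra.
have := ler_wpM2l M0 h7; lra.
Qed.

(** The bound [fM] also makes [f] well defined on the image of [i], which need not be injective.
    Hence operators on a completion can be given by formulas on the functions that represent its
    vectors. *)
Theorem extension : exists F : V -> W, [/\ linear F, forall u, D u -> F (i u) = f u
  & forall x, rnorm (F x) <= M * rnorm x].
Proof.
have hlin k u v x y : approaches u x -> approaches v y ->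
    approaches (fun n => k *: u n + v n) (k *: x + y).
  move=> [Du hu] [Dv hv]; split=> [n|]; first exact: sD.2.
  by apply: eq_cvs (cvsD (cvsZ k hu) hv) => n /=; rewrite li.
exists F; split.
- move=> k x y; have [u hu] := approaches_ex x; have [v hv] := approaches_ex y.
  apply: cvs_eq (F_cvs (hlin k _ _ _ _ hu hv)) (cvsD (cvsZ k (F_cvs hu)) (F_cvs hv)) => n /=.
  by rewrite lf //; [exact: hu.1 | exact: hv.1].
- move=> u Du; have hu : approaches (fun=> u) (i u) by split=> //; exact: cvs_cst.
  exact: cvs_unique (F_cvs hu) (cvs_cst _).
- move=> x; have [u [Du hu]] := approaches_ex x; apply/ler_addgt0Pr => e e0.
  have d0 : 0 < e / (M + 1) by rewrite divr_gt0.
  have [N hN] := cvs2 hu (F_cvs (conj Du hu)) d0; have /= [h1 h2] := hN N (leqnn N).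
  have h3 := rnormD (F x - f (u N)) (f (u N)); rewrite subrK rnormB in h3.
  have h4 := fM (Du N).
  have h5 := rnormD (i (u N) - x) x; rewrite subrK in h5.
  have h6 : rnorm (i (u N)) <= e / (M + 1) + rnorm x by lra.
  have h7 := ler_wpM2l M0 h6.
  have h8 : M * (e / (M + 1)) + e / (M + 1) = e by field; rewrite gt_eqF.
  by rewrite mulrDr in h7; lra.
Qed.

End Extend.
End Extension.

(** * The norm closure of a *-algebra of operators as a C*-algebra *)

Section OperatorAlgebra.
Context (R : realType) (H : hilbertSpace R) (D : set (H -> H)).
Local Notation C := R[i].
Hypothesis D0 : D (fun=> 0).
Hypothesis Dlin : forall k f g, D f -> D g -> D (fun x => k *: f x + g x).
Hypothesis Dl : forall f, D f -> linear f.
Hypothesis Dbd : forall f, D f -> exists2 M : R, 0 <= M & forall x, rnorm (f x) <= M * rnorm x.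
Hypothesis Dcomp : forall f g, D f -> D g -> D (f \o g).
Hypothesis Dadj : forall f, D f -> exists2 g, D g & forall x y, inner H (f x) y = inner H x (g y).

(** With the weight [rnorm x] the norm of the function space is the operator norm. *)
Definition opspace : fspace R :=
  FSpace (@complete_seq R H) (fun x : H => rnorm_ge0 x) D0 Dlin Dbd.

Definition opalg : Type := ffam opspace.
HB.instance Definition _ := CompleteNormedModule.on opalg.
Implicit Types a b c : opalg.

Definition oap a : H -> H := (a : ffam opspace).

Lemma oap_ext a b : (forall x, oap a x = oap b x) -> a = b.
Proof. exact: (@ffamP _ opspace). Qed.

Lemma oap_le a x : rnorm (oap a x) <= rnorm a * rnorm x.
Proof. exact: (@ffam_le _ opspace). Qed.

Lemma oap_norm_le a M : 0 <= M -> (forall x, rnorm (oap a x) <= M * rnorm x) -> rnorm a <= M.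
Proof. exact: (@ffam_norm_le _ opspace). Qed.

Lemma oapZD k a b x : oap (k *: a + b) x = k *: oap a x + oap b x.
Proof. by []. Qed.

Lemma oapB a b x : oap (a - b) x = oap a x - oap b x.
Proof. exact: (@fvB _ opspace). Qed.

Lemma oap_approx a (e : R) : 0 < e ->
  exists2 f, D f & forall x, rnorm (oap a x - f x) <= e * rnorm x.
Proof. exact: (@fvP _ opspace a). Qed.

Lemma fclose_op (T : H -> H) :
  (forall e : R, 0 < e -> exists2 f, D f & forall x, rnorm (T x - f x) <= e * rnorm x) ->
  exists a, oap a = T.
Proof. by move=> h; exists (@Ffam _ opspace T h). Qed.

Lemma oap_D f : D f -> exists a, oap a = f.
Proof.
move=> Df; apply: fclose_op => e e0; exists f => // x.
by rewrite subrr rnorm0 mulr_ge0 ?rnorm_ge0 ?ltW.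
Qed.

Lemma oap_lin a : linear (oap a).
Proof.
move=> k x y; apply/eqP; rewrite -subr_eq0; apply/eqP/rnorm_eq0/eqP.
rewrite eq_le rnorm_ge0 andbT; apply/ler_addgt0Pr => e e0; rewrite add0r.
set K := rnorm (k *: x + y) + cmod k * rnorm x + rnorm y + 1.
have K0 : 0 < K by rewrite ltr_wpDl // !addr_ge0 ?mulr_ge0 ?rnorm_ge0 ?cmod_ge0.
have d0 : 0 < e / K by rewrite divr_gt0.
have [f Df hf] := oap_approx a d0.
have -> : oap a (k *: x + y) - (k *: oap a x + oap a y) =
   (oap a (k *: x + y) - f (k *: x + y)) + (k *: (f x - oap a x) + (f y - oap a y)).
  by rewrite (Dl Df) scalerBr [_ - _ + (f y - _)]addrACA -opprD addrA subrK.
apply: le_trans (rnormD _ _) _; apply: le_trans (lerD (hf _) (rnormD _ _)) _.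
rewrite rnormZ !(rnormB (f _)).
apply: le_trans (lerD (lexx _) (lerD (ler_wpM2l (cmod_ge0 k) (hf _)) (hf _))) _.
rewrite -[leRHS](_ : (e / K) * K = _); last by rewrite divfK ?gt_eqF.
by rewrite mulrCA -!mulrDr ler_wpM2l ?(ltW d0) // /K !addrA lerDl.
Qed.

Lemma omul_subproof a b : exists c, oap c = oap a \o oap b.
Proof.
apply: fclose_op => e e0.
have K1 : 0 < rnorm a + 1 by rewrite ltr_wpDl ?rnorm_ge0.
have K2 : 0 < rnorm b + 1 by rewrite ltr_wpDl ?rnorm_ge0.
have d1 : 0 < e / 2 / (rnorm a + 1) by rewrite !divr_gt0.
have [g Dg hg] := oap_approx b d1; have [M M0 hM] := Dbd Dg.
have K3 : 0 < M + 1 by lra.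
have d2 : 0 < e / 2 / (M + 1) by rewrite !divr_gt0.
have [f Df hf] := oap_approx a d2.
exists (f \o g) => [|x /=]; first exact: Dcomp.
have -> : oap a (oap b x) - f (g x) = oap a (oap b x - g x) + (oap a (g x) - f (g x)).
  by rewrite (linB (oap_lin a)) addrA subrK.
apply: le_trans (rnormD _ _) _; rewrite (splitr e) mulrDl; apply: lerD.
  apply: le_trans (oap_le _ _) _; apply: le_trans (ler_wpM2l (rnorm_ge0 _) (hg _)) _.
  rewrite mulrA ler_wpM2r ?rnorm_ge0 // mulrCA ger_pMr ?divr_gt0 //.
  by rewrite ler_pdivrMr // mul1r; lra.
apply: le_trans (hf _) _; apply: le_trans (ler_wpM2l (ltW d2) (hM _)) _.
rewrite mulrA ler_wpM2r ?rnorm_ge0 // mulrAC -mulrA ger_pMr ?divr_gt0 //.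
by rewrite ler_pdivrMr // mul1r; lra.
Qed.

Definition omul a b : opalg := sval (cid (omul_subproof a b)).

Lemma omulE a b x : oap (omul a b) x = oap a (oap b x).
Proof. by rewrite /omul; case: cid => c /= ->. Qed.

(** Adjoints of approximating elements of [D] form a Cauchy sequence, since passing to the adjoint
    does not increase the norm; the limit is the adjoint of [a]. *)
Lemma oadj_subproof a : exists b, forall x y, inner H (oap a x) y = inner H x (oap b y).
Proof.
have /choice [f hf] : forall n : nat, exists f, D f /\
    forall x, rnorm (oap a x - f x) <= n.+1%:R^-1 * rnorm x.
  by move=> n; have [|f] := @oap_approx a n.+1%:R^-1; [rewrite invr_gt0 | exists f].
have /choice [b hb] : forall n : nat, exists b : opalg,
    forall x y, inner H (f n x) y = inner H x (oap b y).
  move=> n; have [g Dg hg] := Dadj (hf n).1; have [b bE] := oap_D Dg.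
  by exists b => x y; rewrite bE.
have fn n : forall e : R, n.+1%:R^-1 < e -> forall m, (n <= m)%N ->
    forall x, rnorm (oap a x - f m x) <= e * rnorm x.
  move=> e he m nm x; apply: le_trans ((hf m).2 x) _.
  rewrite ler_wpM2r ?rnorm_ge0 // (le_trans _ (ltW he)) //.
  by rewrite lef_pV2 ?posrE ?ltr0Sn // ler_nat.
have [c hc] : exists c, cvs b c.
  apply: (@complete_seq R opalg) => e e0; have e2 : 0 < e / 2 by rewrite divr_gt0.
  have [N hN] := small_half e2; exists N => m n hm hn.
  apply: oap_norm_le => [|y]; first exact: ltW.
  apply: (@adjoint_bound R H (oap (b m - b n)) (fun x => f m x - f n x) e) => //; first exact: ltW.
    move=> x; apply: le_trans (rnorm_dist (oap a x) _ _) _.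
    rewrite (splitr e) mulrDl; apply: lerD; last exact: fn hN _ hn x.
    by rewrite rnormB; exact: fn hN _ hm x.
  by move=> x z; rewrite oapB iBl iBr !hb.
exists c => x y.
have h1 : cvs (fun n => f n x) (oap a x).
  apply: (@cvsP _ _ _ _ (rnorm x)); first exact: rnorm_ge0.
  move=> e e0; have [N hN] := small_half e0; exists N => n hn.
  by rewrite rnormB mulrC; exact: fn hN _ hn x.
have h2 : cvs (fun n => oap (b n) y) (oap c y).
  apply: (@cvsP _ _ _ _ (rnorm y)); first exact: rnorm_ge0.
  move=> e e0; have [N hN] := hc _ e0; exists N => n /hN h.
  by rewrite -oapB (le_trans (oap_le _ _)) // mulrC ler_wpM2l ?rnorm_ge0.
apply: cvs_eq (cvs_inner h1 (cvs_cst y)) (cvs_inner (cvs_cst x) h2) => n /=.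
exact: hb.
Qed.

Definition oadj a : opalg := sval (cid (oadj_subproof a)).

Lemma oadjE a x y : inner H (oap a x) y = inner H x (oap (oadj a) y).
Proof. by rewrite /oadj; case: cid => b /= ->. Qed.

Lemma oadjEl a x y : inner H (oap (oadj a) x) y = inner H x (oap a y).
Proof. by rewrite iconj -oadjE -iconj. Qed.

Lemma oap_eqP a b : (forall x y, inner H x (oap a y) = inner H x (oap b y)) -> a = b.
Proof. by move=> h; apply: oap_ext => y; apply: inner_ext => x; exact: h. Qed.

Lemma omulA : associative omul.
Proof. by move=> a b c; apply: oap_ext => x; rewrite !omulE. Qed.

Lemma omul_linearr a : linear (omul a).
Proof.
by move=> k b c; apply: oap_ext => x; rewrite omulE !oapZD (oap_lin a) !omulE.
Qed.

Lemma omul_linearl a : linear (omul^~ a).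
Proof. by move=> k b c; apply: oap_ext => x; rewrite omulE !oapZD !omulE. Qed.

Lemma oadjK : involutive oadj.
Proof. by move=> a; apply: oap_eqP => x y; rewrite -oadjE oadjEl. Qed.

Lemma oadjM a b : oadj (omul a b) = omul (oadj b) (oadj a).
Proof. by apply: oap_eqP => x y; rewrite -oadjE !omulE -!oadjE. Qed.

Lemma oadj_antilinear k a b : oadj (k *: a + b) = Num.conj k *: oadj a + oadj b.
Proof.
apply: oap_eqP => x y; rewrite -oadjE !oapZD iDl iDr iZl iZr.
by rewrite !oadjE conjCK.
Qed.

Lemma rnorm_oadj a : rnorm (oadj a) <= rnorm a.
Proof.
apply: oap_norm_le => [|y]; first exact: rnorm_ge0.
exact: (adjoint_bound (rnorm_ge0 a) (oap_le a) (oadjE a)).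
Qed.

Lemma rnorm_omul a b : rnorm (omul a b) <= rnorm a * rnorm b.
Proof.
apply: oap_norm_le => [|y]; first by rewrite mulr_ge0 ?rnorm_ge0.
rewrite omulE (le_trans (oap_le _ _)) // -mulrA ler_wpM2l ?rnorm_ge0 //.
exact: oap_le.
Qed.

Lemma onormM a b : `|omul a b| <= `|a| * `|b|.
Proof. by rewrite !normE -rmorphM lecR rnorm_omul. Qed.

Lemma onorm_adjM a : `|omul (oadj a) a| = `|a| ^+ 2.
Proof.
rewrite !normE -rmorphXn; congr (_%:C); apply/eqP; rewrite eq_le; apply/andP; split.
  rewrite (le_trans (rnorm_omul _ _)) // expr2 ler_wpM2r ?rnorm_ge0 //.
  exact: rnorm_oadj.
set N := rnorm (omul _ _); have N0 : 0 <= N by exact: rnorm_ge0.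
rewrite -[leRHS](sqr_sqrtr N0) ler_sqr ?nnegrE ?rnorm_ge0 ?sqrtr_ge0 //.
apply: oap_norm_le => [|x]; first exact: sqrtr_ge0.
rewrite -ler_sqr ?nnegrE ?mulr_ge0 ?sqrtr_ge0 ?rnorm_ge0 // exprMn sqr_sqrtr //.
have := inner_CS x (oap (omul (oadj a) a) x).
rewrite omulE -oadjE inner_sqr cmodC ?sqr_ge0 // => /le_trans; apply.
rewrite mulrC expr2 mulrA ler_wpM2r ?rnorm_ge0 //.
by rewrite -omulE; exact: oap_le.
Qed.

Definition opcstar : cstarAlgebra R :=
  @CStarAlgebra R opalg omul oadj omulA omul_linearr omul_linearl oadjK oadjM
    oadj_antilinear onormM onorm_adjM.

(** The last clause is the way in which further operators enter the algebra: by norm approximation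
    alone, with no prior knowledge that [T] is linear or bounded. *)
Theorem operator_algebra : exists (A : cstarAlgebra R) (rho : A -> H -> H),
  [/\ isometric_star_rep rho,
      forall T, D T -> exists a : A, rho a = T,
      forall (a : A) (e : R), 0 < e ->
        exists2 T, D T & forall x, rnorm (rho a x - T x) <= e * rnorm x
    & forall T : H -> H, (forall e : R, 0 < e -> exists a : A, forall x,
        rnorm (T x - rho a x) <= e * rnorm x) -> exists a : A, rho a = T].
Proof.
exists opcstar, oap; split.
- split=> [a|].
    split; first exact: oap_lin.
    apply: continuous_rnorm (oap_lin a) _.
    by exists (rnorm a); [exact: rnorm_ge0 | exact: oap_le].
  split=> //.
  + by move=> a b x; exact: omulE.
  + by move=> a x y; exact: oadjEl.
  + move=> a; apply/eqP; rewrite eq_le opnorm_le ?rnorm_ge0 //=; last exact: oap_le.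
    apply: oap_norm_le => [|x].
      apply: le_trans (rnorm_ge0 (oap a 0)) _; apply: le_trans (le_opnorm (oap_lin a) (oap_le a) 0) _.
      rewrite rnorm0 mulr0; apply: ub_le_sup; last by exists 0; rewrite /= ?normr0 ?(lin0 (oap_lin a)) ?rnorm0.
      exists (rnorm a) => _ [z + <-]; rewrite /= (rnorm_le z 1) => z1.
      by rewrite (le_trans (oap_le _ _)) // ler_piMr ?rnorm_ge0.
    exact: le_opnorm (oap_lin a) (oap_le a) x.
- exact: oap_D.
- exact: oap_approx.
- move=> T hT; apply: fclose_op => e e0; have e2 : 0 < e / 2 by rewrite divr_gt0.
  have [a ha] := hT _ e2; have [f Df hf] := oap_approx a e2.
  exists f => // x; rewrite (le_trans (rnorm_dist (oap a x) _ _)) //.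
  by rewrite (splitr e) mulrDl lerD.
Qed.

End OperatorAlgebra.

(** * The Riesz representation theorem *)

Section Riesz.
Context (R : realType) (H : hilbertSpace R).
Local Notation C := R[i].
Implicit Types x y z : H.

Lemma parallelogram x y :
  rnorm (x + y) ^+ 2 + rnorm (x - y) ^+ 2 = 2 * rnorm x ^+ 2 + 2 * rnorm y ^+ 2.
Proof.
apply: complexI; rewrite !rmorphD !(rmorphM _ 2) /= !(fun z => esym (inner_sqr z)).
rewrite !(iDl, iDr, iNr, iNl); ring.
Qed.

(** The best choice [t = - conj c / |y|^2] lowers the squared norm of [x] by [|c|^2 / |y|^2], so
    minimality forces [c = 0]. *)
Lemma orthogonal_min x y : (forall t : C, rnorm x <= rnorm (x + t *: y)) -> inner H y x = 0.
Proof.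
move=> h; set c := inner H y x.
have [/eqP y0|y0] := eqVneq (rnorm y) 0.
  by rewrite /c; move/eqP/rnorm_eq0: y0 => ->; rewrite i0l.
have yp : 0 < rnorm y by rewrite lt_neqAle eq_sym y0 rnorm_ge0.
set n2 : R := rnorm y ^+ 2; have n0 : 0 < n2 by rewrite exprn_gt0.
have := h (- (Num.conj c / n2%:C)).
rewrite -ler_sqr ?nnegrE ?rnorm_ge0 // -lecR -!inner_sqr.
rewrite !(iDl, iDr, iZl, iZr) (iconj x y) -/c [inner H y y]inner_sqr -/n2.
rewrite rmorphN rmorphM /= fmorphV /= conjCK !conj_conjc conjc_real.
have nC : (n2%:C : C) != 0 by rewrite (inj_eq (@complexI _)) gt_eqF.
have -> : inner H x x + - (c / n2%:C) * conjc c + (- (conjc c / n2%:C) * c +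
   - (conjc c / n2%:C) * (- (c / n2%:C) * n2%:C)) = inner H x x - (c * conjc c) / n2%:C by field.
rewrite -conj_conjc -cmod_sqr -subr_ge0 addrAC subrr add0r oppr_ge0 => hc.
have : (cmod c ^+ 2 / n2)%:C <= 0 :> C by rewrite rmorphM fmorphV.
rewrite (lecR _ 0) => hc'; apply: cmod_eq0; apply/eqP; rewrite -sqrf_eq0 eq_le sqr_ge0 andbT.
by move: hc'; rewrite ler_pdivrMr // mul0r.
Qed.

(** [l] is the vector of least norm on the affine hyperplane [phi = 1], obtained from a minimising
    sequence by the parallelogram law. It is orthogonal to the kernel of [phi], so that [l / |l|^2]
    represents [phi]. *)
Lemma riesz (phi : H -> C^o) (M : R) : linear phi ->
  (forall x, cmod (phi x) <= M * rnorm x) -> exists w, forall x, phi x = inner H x w.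
Proof.
move=> lphi hM.
have [h0|/existsNP [a ha]] := pselect (forall x, phi x = 0).
  by exists 0 => x; rewrite h0 i0r.
have M0 : 0 < M.
  rewrite ltNge; apply/negP => M0; apply: ha; apply: cmod_eq0; apply/eqP.
  by rewrite eq_le cmod_ge0 andbT (le_trans (hM a)) // mulr_le0_ge0 ?rnorm_ge0.
pose S := [set rnorm x | x in [set x : H | phi x = 1]].
have S1 x : phi x = 1 -> inf S <= rnorm x.
  by move=> hx; apply: ge_inf; [exists 0 => _ [y _ <-]; exact: rnorm_ge0 | exists x].
have S0 : S !=set0.
  exists (rnorm ((phi a)^-1 *: a)), ((phi a)^-1 *: a) => //=.
  by rewrite (linZ lphi) [_ *: _]mulVf //; apply/eqP.
have d0 : 0 <= inf S by apply: lb_le_inf => // _ [y _ <-]; exact: rnorm_ge0.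
set d := inf S in S1 d0.
have /choice [x hx] : forall n : nat, exists x : H, phi x = 1 /\ rnorm x <= d + n.+1%:R^-1.
  have hi : has_inf S by split => //; exists 0 => _ [y _ <-]; exact: rnorm_ge0.
  move=> n; have n0 : 0 < n.+1%:R^-1 :> R by rewrite invr_gt0.
  have [_ [y hy <-] yn] := inf_adherent n0 hi.
  by exists y; split => //; exact: ltW.
have phiD m n : phi (x m + x n) = 2.
  by rewrite (linD lphi) (hx m).1 (hx n).1.
have low m n : 2 * d <= rnorm (x m + x n).
  have : phi (2^-1 *: (x m + x n)) = 1 by rewrite (linZ lphi) phiD [_ *: _]mulVf // pnatr_eq0.
  move=> /S1; rewrite rnormZ.
  have -> : cmod (2^-1 : C) = 2^-1.
    have -> : (2^-1 : C) = (2^-1)%:C by rewrite fmorphV /= rmorph_nat.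
    by rewrite cmodC.
  lra.
have [l hl] : exists l, cvs x l.
  apply: complete_seq => e e0.
  (* The parallelogram law bounds [|x m - x n|^2] by [4 (d + t)^2 - 4 d^2], which is at most
     [(8 d + 4) t] when [t <= 1]. *)
  have K0 : 0 < 8 * d + 4 by lra.
  have e2 : 0 < e ^+ 2 / (8 * d + 4) by rewrite divr_gt0 ?exprn_gt0.
  have [N hN] := small_half e2.
  exists N => m n hm hn.
  set t : R := N.+1%:R^-1 in hN; have t0 : 0 < t by rewrite invr_gt0.
  have t1 : t <= 1 by rewrite invf_le1 // ler1n.
  have hk k : (N <= k)%N -> rnorm (x k) <= d + t.
    move=> hk; apply: le_trans (hx k).2 _; rewrite lerD2l.
    by rewrite lef_pV2 ?posrE ?ltr0Sn // ler_nat.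
  have hk2 k : (N <= k)%N -> rnorm (x k) ^+ 2 <= (d + t) ^+ 2.
    by move=> /hk h; rewrite ler_sqr ?nnegrE ?rnorm_ge0 //; lra.
  have p := parallelogram (x m) (x n).
  have l2 : (2 * d) ^+ 2 <= rnorm (x m + x n) ^+ 2.
    by rewrite ler_sqr ?nnegrE ?rnorm_ge0 // mulr_ge0.
  have u1 := hk2 m hm; have u2 := hk2 n hn.
  have tt : t ^+ 2 <= t by rewrite expr2 ler_piMr // ltW.
  rewrite -ler_sqr ?nnegrE ?rnorm_ge0 ?ltW //.
  have hN' : t * (8 * d + 4) < e ^+ 2 by rewrite -ltr_pdivlMr.
  have q : (d + t) ^+ 2 = d ^+ 2 + 2 * d * t + t ^+ 2 by ring.
  have q2 : (2 * d) ^+ 2 = 4 * d ^+ 2 by ring.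
  have q3 : t * (8 * d + 4) = 8 * (d * t) + 4 * t by ring.
  have q4 : 2 * d * t = 2 * (d * t) by ring.
  lra.
have phil : phi l = 1.
  have hc : cvs (phi \o x) (phi l).
    exact: (cvs_op lphi (ltW M0) hM hl).
  by apply: cvs_eq hc (cvs_cst _) => n /=; exact: (hx n).1.
have ld y : phi y = 1 -> rnorm l <= rnorm y.
  move=> hy; apply: le_trans (S1 y hy); apply/ler_addgt0Pr => e e0.
  have e2 : 0 < e / 2 by lra.
  have [N hN] := hl _ e2; have [N' hN'] := small_half e2.
  set n := maxn N N'; have h1 := hN n (leq_maxl _ _).
  have h2 : n.+1%:R^-1 < e / 2.
    apply: le_lt_trans hN'; rewrite lef_pV2 ?posrE ?ltr0Sn // ler_nat ltnS; exact: leq_maxr.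
  have h3 := rnormD (l - x n) (x n); rewrite subrK rnormB in h3.
  have h4 := (hx n).2; have h5 := le_trans h4 (lerD (lexx d) (ltW h2)); lra.
have l0 : rnorm l ^+ 2 != 0.
  rewrite sqrf_eq0; apply/eqP => /rnorm_eq0 l0; move: phil; rewrite l0 (lin0 lphi).
  by move/eqP; rewrite eq_sym oner_eq0.
exists ((rnorm l ^+ 2)^-1%:C *: l) => y.
have : inner H (y - phi y *: l) l = 0.
  apply: orthogonal_min => t; apply: ld.
  rewrite (linD lphi) (linZ lphi) (linB lphi) (linZ lphi) phil.
  by rewrite [_ *: 1]mulr1 subrr scaler0 addr0.
rewrite iBl iZl inner_sqr => /eqP; rewrite subr_eq0 => /eqP h.
rewrite iZr conj_conjc conjc_real h mulrCA -rmorphM mulVf //.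
by rewrite mulr1.
Qed.

End Riesz.

(** * Compact operators and finite-rank approximation *)

Section Compact.
Context (R : realType).
Local Notation C := R[i].

Definition totally_bounded (V : normedModType C) (A : set V) :=
  forall e : R, 0 < e -> exists s : seq V, forall x, A x -> exists2 y, y \in s & rnorm (x - y) <= e.

(** Pigeonhole for ultrafilters: of finitely many sets covering a large set, one is large. *)
Lemma ultra_seq (I : eqType) (T : Type) (F : set_system T) (P : I -> set T) (s : seq I) :
  UltraFilter F -> F [set x | exists2 i, i \in s & P i x] -> exists2 i, i \in s & F (P i).
Proof.
move=> UF; elim: s => [|i s IH] Fs.
  by case: (filter_ex Fs) => x [k]; rewrite in_nil.
have [Fi|Fi] := in_ultra_setVsetC (P i) UF.
  by exists i; rewrite ?mem_head.
have [|j js Fj] := IH; last by exists j; rewrite // inE js orbT.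
apply: filterS (filterI Fs Fi) => x [[j]]; rewrite inE => /orP[/eqP -> //|js Pj _].
by exists j.
Qed.

(** For the converse, a finite net makes every ultrafilter on the closure Cauchy, and completeness
    provides its limit. *)
Lemma precompact_tb (V : completeNormedModType C) (A : set V) :
  precompact A <-> totally_bounded A.
Proof.
rewrite precompactE; split=> [cA e e0|tA].
  have e0C : (0 : C) < e%:C by rewrite ltcR.
  move: cA; rewrite compact_cover => /(_ V setT (fun x => ball x e%:C)) [].
  - by move=> x _; exact: ball_open.
  - move=> x _; exists x => //; exact: ballxx.
  move=> D _ hD; exists (finmap.enum_fset D) => x Ax.
  have [y /= yD] := hD x (subset_closure Ax).
  by rewrite -ball_normE /= distrC rnorm_lt => /ltW h; exists y.
rewrite compact_ultra => F UF FA.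
have cF : cauchy F.
  apply/cauchyP => e e0.
  have eE : e = (complex.Re e)%:C by rewrite RRe_real // gtr0_real.
  have e0' : 0 < complex.Re e by rewrite -ltcR -eE.
  have e2 : 0 < complex.Re e / 3 by rewrite divr_gt0.
  have [s hs] := tA _ e2.
  have [|y ys Fy] := @ultra_seq V V F (fun y => [set x | rnorm (x - y) < complex.Re e]) s UF.
    apply: filterS FA => x cx.
    have : nbhs x [set y | rnorm (y - x) < complex.Re e / 3] by apply/nbhs_rnorm; exists (complex.Re e / 3).
    move=> /cx [y [Ay /= hy]]; have [z zs hz] := hs y Ay; exists z => //=.
    have := rnorm_dist y x z; rewrite (rnormB x y); lra.
  exists y; apply: filterS Fy => x /=.
  by rewrite -ball_normE /= eE distrC rnorm_lt.
have := complete_filter (@complete_seq R V) (@ultra_proper _ F UF) cF.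
move=> /cvg_ex [l hl]; exists l; split=> //.
apply: closed_closure => B /hl FB.
by have [z [h1 h2]] := filter_ex (filterI FA FB); exists z.
Qed.

Section Operators.
Context (H : hilbertSpace R).
Implicit Types (S T : H -> H) (x y z : H).

Definition oball T : set H := [set T x | x in [set x | rnorm x <= 1]].

Lemma compactP T : compact_operator T <-> linear T /\ totally_bounded (oball T).
Proof.
have -> : oball T = T @` [set x | `|x| <= 1].
  by apply/seteqP; split=> _ [x /= hx <-]; exists x => //=; rewrite (rnorm_le x 1) in hx *.
by split=> -[lT] /precompact_tb.
Qed.

Lemma tb_bounded T : linear T -> totally_bounded (oball T) ->
  exists2 M : R, 0 <= M & forall x, rnorm (T x) <= M * rnorm x.
Proof.
move=> lT /(_ 1 ltr01) [s hs].
have [B B0 hB] : exists2 B : R, 0 <= B & forall y, y \in s -> rnorm y <= B.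
  elim: s {hs} => [|a s [B B0 IH]]; first by exists 0.
  exists (B + rnorm a) => [|y]; first by rewrite addr_ge0 ?rnorm_ge0.
  by rewrite inE => /orP[/eqP -> |/IH h]; rewrite ?lerDr // (le_trans h) ?lerDl ?rnorm_ge0.
exists (B + 1) => [|x]; first by rewrite addr_ge0.
have [->|/eqP x0] := eqVneq x 0; first by rewrite (lin0 lT) !rnorm0 mulr0.
have xn : 0 < rnorm x.
  by rewrite lt_neqAle rnorm_ge0 andbT eq_sym; apply/eqP => /rnorm_eq0.
have [|y ys hy] := hs (T ((rnorm x)^-1%:C *: x)).
  by exists ((rnorm x)^-1%:C *: x) => //=; rewrite rnormZ cmodC ?invr_ge0 ?rnorm_ge0 // mulVf ?gt_eqF.
have h := rnormD (T ((rnorm x)^-1%:C *: x) - y) y; rewrite subrK in h.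
have h2 : rnorm (T ((rnorm x)^-1%:C *: x)) <= B + 1 by have := hB _ ys; lra.
rewrite (linZ lT) rnormZ cmodC ?invr_ge0 ?rnorm_ge0 // mulrC ler_pdivrMr // in h2.
Qed.

Lemma compact_lin k S T : compact_operator S -> compact_operator T ->
  compact_operator (fun x => k *: S x + T x).
Proof.
move=> /compactP [lS tS] /compactP [lT tT]; apply/compactP; split.
  move=> a x y; rewrite lS lT !scalerDr !scalerA mulrC -!addrA; congr (_ + _).
  by rewrite addrCA.
move=> e e0; have e2 : 0 < e / 2 by rewrite divr_gt0.
have K0 : 0 < cmod k + 1 by rewrite ltr_wpDl ?cmod_ge0.
have [s hs] := tS _ (divr_gt0 e2 K0); have [t ht] := tT _ e2.
exists [seq k *: a + b | a <- s, b <- t] => _ [x x1 <-].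
have [a as_ ha] : exists2 a, a \in s & rnorm (S x - a) <= e / 2 / (cmod k + 1) by apply: hs; exists x.
have [b bt hb] : exists2 b, b \in t & rnorm (T x - b) <= e / 2 by apply: ht; exists x.
exists (k *: a + b); first by apply/allpairsP; exists (a, b).
rewrite opprD addrACA -scalerBr (le_trans (rnormD _ _)) // rnormZ (splitr e) lerD //.
apply: le_trans (ler_wpM2l (cmod_ge0 k) ha) _.
by rewrite mulrCA ger_pMr // ler_pdivrMr // mul1r lerDl.
Qed.

Lemma compact0 : compact_operator (fun=> 0 : H).
Proof.
apply/compactP; split=> [k x y|e e0]; first by rewrite scaler0 addr0.
by exists [:: 0] => _ [x _ <-]; exists 0; rewrite ?mem_head // subrr rnorm0 ltW.
Qed.

Lemma compact_comp_left S T : bounded_operator S -> compact_operator T ->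
  compact_operator (S \o T).
Proof.
move=> [lS cS] /compactP [lT tT]; have [M M0 hM] := bounded_rnorm lS cS.
apply/compactP; split=> [k x y|e e0]; first by rewrite /= lT lS.
have M1 : 0 < M + 1 by rewrite ltr_wpDl.
have [s hs] := tT _ (divr_gt0 e0 M1); exists (map S s) => _ [x x1 <-].
have [a as_ ha] : exists2 a, a \in s & rnorm (T x - a) <= e / (M + 1) by apply: hs; exists x.
exists (S a); first exact: map_f.
rewrite /= -(linB lS) (le_trans (hM _)) //; apply: le_trans (ler_wpM2l M0 ha) _.
by rewrite mulrCA ger_pMr // ler_pdivrMr // mul1r lerDl.
Qed.

Lemma compact_comp_right S T : bounded_operator S -> compact_operator T ->
  compact_operator (T \o S).
Proof.
move=> [lS cS] /compactP [lT tT]; have [M M0 hM] := bounded_rnorm lS cS.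
apply/compactP; split=> [k x y|e e0]; first by rewrite /= lS lT.
have M1 : 0 < M + 1 by rewrite ltr_wpDl.
have [s hs] := tT _ (divr_gt0 e0 M1); exists [seq (M + 1)%:C *: y | y <- s] => _ [x x1 <-].
have [|a as_ ha] := hs (T ((M + 1)^-1%:C *: S x)).
  exists ((M + 1)^-1%:C *: S x) => //=.
  rewrite rnormZ cmodC ?invr_ge0 ?(ltW M1) // mulrC ler_pdivrMr // mul1r.
  apply: le_trans (hM _) _; apply: le_trans (ler_wpM2l M0 x1) _.
  by rewrite mulr1 lerDl.
exists ((M + 1)%:C *: a); first exact: map_f.
rewrite /= -[T (S x)]scale1r.
have -> : 1 = (M + 1)%:C * (M + 1)^-1%:C :> C by rewrite -rmorphM divff // gt_eqF.
rewrite -scalerA -(linZ lT) -scalerBr rnormZ cmodC ?(ltW M1) //.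
by rewrite mulrC -ler_pdivlMr.
Qed.

Lemma compact_lim T : linear T -> (forall e : R, 0 < e -> exists2 S, compact_operator S &
  forall x, rnorm (T x - S x) <= e * rnorm x) -> compact_operator T.
Proof.
move=> lT h; apply/compactP; split=> // e e0; have e2 : 0 < e / 2 by rewrite divr_gt0.
have [S /compactP [lS tS] hS] := h _ e2; have [s hs] := tS _ e2.
exists s => _ [x x1 <-].
have [a as_ ha] : exists2 a, a \in s & rnorm (S x - a) <= e / 2 by apply: hs; exists x.
exists a => //; apply: le_trans (rnorm_dist (S x) _ _) _.
rewrite (splitr e) lerD // (le_trans (hS _)) //.
by rewrite ler_piMr // ltW.
Qed.

Lemma segment_grid (M e : R) : 0 < e -> exists s : seq R, forall x : R, `|x| <= M ->
  exists2 y, y \in s & `|x - y| <= e.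
Proof.
move=> e0; exists [seq - M + k%:R * e | k <- iota 0 (Num.trunc (2 * M / e)).+1] => x.
rewrite ler_norml => /andP[x1 x2].
have t0 : 0 <= (x + M) / e by rewrite divr_ge0 ?(ltW e0) //; lra.
exists (- M + (Num.trunc ((x + M) / e))%:R * e).
  apply/mapP; exists (Num.trunc ((x + M) / e)) => //.
  rewrite mem_iota /= add0n ltnS; apply: le_truncn.
  by rewrite ler_pM2r ?invr_gt0 //; lra.
have h1 := truncnS_gt ((x + M) / e); have := truncn_le ((x + M) / e); rewrite t0 => h2.
set k := Num.trunc _ in h1 h2 *.
rewrite ltr_pdivrMr // in h1; rewrite ler_pdivlMr // in h2.
rewrite -natr1 mulrDl mul1r in h1.
by rewrite ler_norml; apply/andP; split; lra.
Qed.

Lemma disc_grid (M e : R) : 0 < e -> exists s : seq C, forall z : C, cmod z <= M ->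
  exists2 w, w \in s & cmod (z - w) <= e.
Proof.
move=> e0; have [s hs] := segment_grid M (divr_gt0 e0 (ltr0n _ 2)).
exists [seq Complex a b | a <- s, b <- s] => z hz.
have [a as_ ha] := hs _ (le_trans (Re_le_cmod z) hz).
have [b bs hb] := hs _ (le_trans (Im_le_cmod z) hz).
exists (Complex a b); first by apply/allpairsP; exists (a, b).
rewrite (le_trans (cmod_le_ReIm _)) // ReD ImD ReN ImN /=; lra.
Qed.

Lemma compact_rank1 v w : compact_operator (fun x => inner H x w *: v).
Proof.
apply/compactP; split=> [k x y|e e0]; first by rewrite ilin scalerDl scalerA.
have K0 : 0 < rnorm v + 1 by rewrite ltr_wpDl ?rnorm_ge0.
have [s hs] := disc_grid (rnorm w) (divr_gt0 e0 K0).
exists (map (fun z : C => z *: v) s) => _ [x x1 <-].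
have [|z zs hz] := hs (inner H x w).
  by rewrite (le_trans (inner_CS _ _)) // ler_piMl ?rnorm_ge0.
exists (z *: v); first by apply/mapP; exists z.
rewrite -scalerBl rnormZ (le_trans (ler_wpM2r (rnorm_ge0 v) hz)) //.
by rewrite mulrAC ler_pdivrMr // ler_wpM2l ?(ltW e0) // lerDl.
Qed.

Definition frank (s : seq (H * H)) x : H := \sum_(p <- s) inner H x p.2 *: p.1.

Lemma frank_lin s : linear (frank s).
Proof.
move=> k x y; rewrite /frank scaler_sumr -big_split /=; apply: eq_bigr => p _.
by rewrite ilin scalerDl scalerA.
Qed.

(** Gram-Schmidt: each new vector contributes the rank-one projection onto its component orthogonal
    to the previous range, and nothing when that component vanishes. *)
Lemma finite_projection (ys : seq H) : exists s,
  [/\ forall x y, inner H (frank s x) y = inner H x (frank s y),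
      forall x, frank s (frank s x) = frank s x
    & forall y, y \in ys -> frank s y = y].
Proof.
elim: ys => [|y ys [s [sa ss hs]]].
  exists [::]; split=> [x y|x|y]; rewrite /frank ?big_nil ?i0l ?i0r //.
set z := y - frank s y.
have Pz : frank s z = 0 by rewrite /z (linB (frank_lin s)) ss subrr.
have Pxz x : inner H (frank s x) z = 0 by rewrite sa Pz i0r.
have [z0|z0] := eqVneq (rnorm z) 0.
  exists s; split=> // a; rewrite inE => /orP[/eqP ->|/hs //].
  by move/rnorm_eq0/eqP: z0; rewrite subr_eq0 => /eqP.
set n2 : R := rnorm z ^+ 2; have n0 : n2 != 0 by rewrite sqrf_eq0.
have nC : (n2%:C : C) != 0 by rewrite (inj_eq (@complexI _)).
have fE x : frank ((z, n2^-1%:C *: z) :: s) x = (inner H x z / n2%:C) *: z + frank s x.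
  by rewrite /frank big_cons /= iZr conj_conjc conjc_real fmorphV /= mulrC.
have zz : inner H z z = n2%:C by rewrite inner_sqr.
have yz : y = z + frank s y by rewrite subrK.
clearbody n2; clearbody z.
exists ((z, n2^-1%:C *: z) :: s); split.
- move=> a b; rewrite !fE iDl iDr iZl iZr sa rmorphM /= fmorphV /= -iconj.
  rewrite [Num.conj n2%:C]conj_conjc conjc_real; congr (_ + _).
  by rewrite mulrAC [RHS]mulrAC (mulrC (inner _ _ _)).
- move=> a; rewrite !fE (linD (frank_lin s)) (linZ (frank_lin s)) Pz scaler0 add0r ss.
  by rewrite iDl iZl zz Pxz addr0 divfK.
- move=> a; rewrite inE fE => /orP[/eqP ->|/hs ha].
    have -> : inner H y z = n2%:C.
      by rewrite yz iDl Pxz addr0 zz.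
    by rewrite divff // scale1r -yz.
  by rewrite ha -ha Pxz mul0r scale0r add0r.
Qed.

(** Project onto the span of a finite [e]-net of the image of the unit ball. By Riesz the
    functionals [x |-> <T x, w>] are inner products with vectors [A w], so the projection composed
    with [T] is again of the form [frank]. *)
Theorem compact_approx T (e : R) : compact_operator T -> 0 < e ->
  exists s, forall x, rnorm (T x - frank s x) <= e * rnorm x.
Proof.
move=> /compactP [lT tT] e0; have [ys hys] := tT _ e0.
have [M M0 hM] := tb_bounded lT tT.
have [s [sa ss hs]] := finite_projection ys.
have Q1 y : rnorm (y - frank s y) <= rnorm y.
  have := inner_CS (y - frank s y) y.
  have -> : inner H (y - frank s y) y = inner H (y - frank s y) (y - frank s y).
    have o : inner H (y - frank s y) (frank s y) = 0.
      by rewrite -sa (linB (frank_lin s)) ss subrr i0l.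
    by rewrite [RHS]iBr o subr0.
  rewrite inner_sqr cmodC ?sqr_ge0 // expr2.
  have [->|q0] := eqVneq (rnorm (y - frank s y)) 0; first by rewrite rnorm_ge0.
  by rewrite ler_pM2l // lt_neqAle eq_sym q0 rnorm_ge0.
have /choice [A hA] : forall w, exists w', forall x, inner H (T x) w = inner H x w'.
  move=> w; apply: (@riesz R H (fun x => inner H (T x) w) (M * rnorm w)).
    by move=> k x y; rewrite lT ilin.
  move=> x; rewrite (le_trans (inner_CS _ _)) // mulrAC ler_wpM2r ?rnorm_ge0 //.
exists [seq (p.1, A p.2) | p <- s] => x.
have -> : frank [seq (p.1, A p.2) | p <- s] x = frank s (T x).
  by rewrite /frank big_map; apply: eq_bigr => p _ /=; rewrite hA.
have [->|/eqP x0] := eqVneq x 0.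
  by rewrite (lin0 lT) (lin0 (frank_lin s)) subrr !rnorm0 mulr0.
have xn : 0 < rnorm x.
  by rewrite lt_neqAle rnorm_ge0 andbT eq_sym; apply/eqP => /rnorm_eq0.
have [|y yys hy] := hys (T ((rnorm x)^-1%:C *: x)).
  by exists ((rnorm x)^-1%:C *: x) => //=; rewrite rnormZ cmodC ?invr_ge0 ?rnorm_ge0 // mulVf ?gt_eqF.
(* The complement of the projection is a contraction that annihilates the net point [y]. *)
have := le_trans (Q1 _) hy; rewrite (linB (frank_lin s)) (hs y yys).
rewrite opprB addrA subrK (linZ lT) (linZ (frank_lin s)) -scalerBr rnormZ cmodC ?invr_ge0 ?rnorm_ge0 //.
by rewrite mulrC ler_pdivrMr.
Qed.

End Operators.
End Compact.

(** * Shift spaces, sliding block codes and legal colourings *)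

Section Shifts.
Context (G : groupType) (e : nat -> G * G).
Hypothesis e_surj : forall p, exists n, e n = p.

(** The second coordinate is a position in [G], and only positions are shifted. The first is an
    index, so a point is a family of labellings of [G]. *)
Definition Om (A : Type) := G * G -> A.

Definition sh (A : Type) (t : G) (c : Om A) : Om A := fun p => c (p.1, (t * p.2)%g).

(** Windows are initial segments of the enumeration [e]; every finite set of coordinates lies in one
    of them. *)
Definition agr (A : Type) (k : nat) (c c' : Om A) := forall i, (i < k)%N -> c (e i) = c' (e i).

Definition local (A B : Type) (F : Om A -> B) :=
  exists k, forall c c', agr k c c' -> F c = F c'.

(* A sliding block code. *)
Definition slide (A B : Type) (Phi : Om A -> Om B) :=
  (forall t c, Phi (sh t c) = sh t (Phi c)) /\ forall p, local (fun c => Phi c p).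

Section Basics.
Context (A B D : Type).

Lemma shM t s (c : Om A) : sh t (sh s c) = sh (s * t)%g c.
Proof. by apply/funext => p; rewrite /sh /= mulgA. Qed.

Lemma sh1 (c : Om A) : sh 1%g c = c.
Proof. by apply/funext => -[a b]; rewrite /sh /= mul1g. Qed.

Lemma agr_le k k' (c c' : Om A) : (k <= k')%N -> agr k' c c' -> agr k c c'.
Proof. by move=> kk h i hi; apply: h; exact: leq_trans hi kk. Qed.

Lemma agrC k (c c' : Om A) : agr k c c' -> agr k c' c.
Proof. by move=> h i /h. Qed.

Lemma agr_trans k (b c d : Om A) : agr k b c -> agr k c d -> agr k b d.
Proof. by move=> h h' i hi; rewrite h // h'. Qed.

Lemma local_coord p : local (fun c : Om A => c p).
Proof. by have [n <-] := e_surj p; exists n.+1 => c c' h; apply: h. Qed.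

Lemma local_cst (b : B) : local (fun _ : Om A => b).
Proof. by exists 0%N. Qed.

Lemma local_comp (F : Om A -> B) (h : B -> D) : local F -> local (fun c => h (F c)).
Proof. by move=> [k hk]; exists k => c c' /hk ->. Qed.

Lemma local_comp2 (E : Type) (F : Om A -> B) (F' : Om A -> D) (h : B -> D -> E) :
  local F -> local F' -> local (fun c => h (F c) (F' c)).
Proof.
move=> [k hk] [k' hk']; exists (maxn k k') => c c' cc.
by rewrite (hk c c') ?(hk' c c') //; apply: agr_le cc; [exact: leq_maxr | exact: leq_maxl].
Qed.

Lemma slide_agr (Phi : Om A -> Om B) k : slide Phi ->
  exists k', forall c c', agr k' c c' -> agr k (Phi c) (Phi c').
Proof.
move=> [_ lP]; elim: k => [|k [k' hk]]; first by exists 0%N.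
have [m hm] := lP (e k); exists (maxn k' m) => c c' cc i.
rewrite ltnS leq_eqVlt => /orP[/eqP -> |ik].
  by apply: hm; apply: agr_le cc; exact: leq_maxr.
by apply: hk => //; apply: agr_le cc; exact: leq_maxl.
Qed.

Lemma slide_local (Phi : Om A -> Om B) (F : Om B -> D) : slide Phi -> local F -> local (F \o Phi).
Proof. by move=> /slide_agr sP [k hk]; have [k' h] := sP k; exists k' => c c' /h /hk. Qed.

Lemma sh_agr t k : exists k', forall c c' : Om A, agr k' c c' -> agr k (sh t c) (sh t c').
Proof.
elim: k => [|k [k' hk]]; first by exists 0%N.
have [m hm] := e_surj ((e k).1, (t * (e k).2)%g).
exists (maxn k' m.+1) => c c' cc i; rewrite ltnS leq_eqVlt => /orP[/eqP -> |ik].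
  by rewrite /sh -hm; apply: cc; exact: leq_maxr.
by apply: hk => //; apply: agr_le cc; exact: leq_maxl.
Qed.

End Basics.

Lemma slide_id (A : Type) : slide (@id (Om A)).
Proof. by split=> // p; exact: local_coord. Qed.

Lemma slide_comp (A B D : Type) (Phi : Om A -> Om B) (Psi : Om B -> Om D) :
  slide Phi -> slide Psi -> slide (Psi \o Phi).
Proof.
move=> sP [eq lP]; split=> [t c /=|p]; first by rewrite sP.1 eq.
exact: (slide_local sP (lP p)).
Qed.

Lemma local_map (A B : Type) (I : Type) (s : seq I) (F : I -> Om A -> B) :
  (forall i, local (F i)) -> local (fun c => [seq F i c | i <- s]).
Proof.
move=> h; elim: s => [|a s IH] /=; first exact: local_cst.
exact: (local_comp2 cons (h a) IH).
Qed.

(** The labelling of index [s] is a proper colouring of the graph with edges from [g] to [g s]. A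
    point fixed by [sh s] would satisfy [c (s, s) = c (s, 1)], so legal points have trivial
    stabilisers. *)
Definition legal (c : Om 'I_3) := forall s g, s <> 1%g -> c (s, (g * s)%g) <> c (s, g).

Definition free3 (a b : option 'I_3) : 'I_3 :=
  odflt ord0 [pick q | (Some q != a) && (Some q != b)].

Lemma free3P a b : Some (free3 a b) != a /\ Some (free3 a b) != b.
Proof.
rewrite /free3; case: pickP => [q /andP[] //|h].
have : (size [seq Some q | q <- enum 'I_3] <= size [:: a; b])%N.
  apply: uniq_leq_size; first by rewrite map_inj_uniq ?enum_uniq // => ? ? [].
  move=> _ /mapP[q _ ->]; rewrite !inE; have := h q.
  by case: eqP => //= _; case: eqP.
by rewrite size_map -cardE card_ord.
Qed.

(** * Greedy three-colouring of graphs of degree at most two *)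

Section Greedy.
Context (L : eqType) (s : G).

(* Colours class after class of [lab], never changing the colours given by
   [pre]; every vertex [g] has the two neighbours [g s] and [g s^-1]. *)
Fixpoint greedy (lab : G -> L) (pre : G -> option 'I_3) (cols : seq L) (g : G) : option 'I_3 :=
  if cols is i :: cs then
    if greedy lab pre cs g is Some q then Some q
    else if lab g == i then
      Some (free3 (greedy lab pre cs (g * s)%g) (greedy lab pre cs (g * s^-1)%g))
    else None
  else pre g.

Lemma greedy_pre lab pre cols g q : pre g = Some q -> greedy lab pre cols g = Some q.
Proof. by move=> h; elim: cols => [|i cs IH] //=; rewrite IH. Qed.

Lemma greedy_total lab pre cols g : lab g \in cols -> greedy lab pre cols g.
Proof.
elim: cols => [|i cs IH] //=; rewrite inE; case: (greedy _ _ _ g) IH => // IH.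
by case/orP => [->|/IH].
Qed.

(** The ends of the edge have different labels and are never coloured at the same stage; the one
    coloured later avoids the colour of the other. The hypothesis on labels concerns this edge
    alone, which allows labellings that fail elsewhere. *)
Lemma greedy_proper lab pre cols g a :
  (forall a, pre g = Some a -> pre (g * s)%g <> Some a) -> lab g <> lab (g * s)%g ->
  greedy lab pre cols g = Some a -> greedy lab pre cols (g * s)%g <> Some a.
Proof.
move=> hpre hlab; elim: cols a => [|i cs IH] a /=; first exact: hpre.
rewrite mulgK; have := IH.
case E1 : (greedy lab pre cs g) => [q|]; case E2 : (greedy lab pre cs (g * s)%g) => [q'|] => IH'.
- by move=> [<-]; exact: IH'.
- move=> [<-]; case: ifP => // _ [h].
  by have [_] := free3P (greedy lab pre cs (g * s * s)%g) (Some q); rewrite h eqxx.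
- case: ifP => // _ [<-] h.
  by have [] := free3P (Some q') (greedy lab pre cs (g * s^-1)%g); rewrite -h eqxx.
- by case: eqP => // h1 _; case: eqP => // h2; case: hlab; rewrite h1 h2.
Qed.

Lemma greedy_shift lab pre cols t g :
  greedy (fun h => lab (t * h)%g) (fun h => pre (t * h)%g) cols g = greedy lab pre cols (t * g)%g.
Proof. by elim: cols g => [|i cs IH] g //=; rewrite !IH !mulgA. Qed.

Lemma greedy_local (A : Type) (lab : Om A -> G -> L) (pre : Om A -> G -> option 'I_3) cols :
  (forall g, local (fun c => lab c g)) -> (forall g, local (fun c => pre c g)) ->
  forall g, local (fun c => greedy (lab c) (pre c) cols g).
Proof.
move=> hl hp; elim: cols => [|i cs IH] g //=.
have h1 := local_comp2 free3 (IH (g * s)%g) (IH (g * s^-1)%g).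
have h2 := local_comp2 (fun l q => if l == i then Some q else None) (hl g) h1.
exact: (local_comp2 (fun o o' => if o is Some q then Some q else o') (IH g) h2).
Qed.

End Greedy.

(** * Equivariant maximal independent sets *)

Section IndependentSet.
Context (K : eqType) (Ds : seq G).

(* A maximal independent subset of the Cayley graph with connection set
   [Ds], built class after class of the proper colouring [kap]. *)
Fixpoint mis (kap : G -> K) (cols : seq K) (h : G) : bool :=
  if cols is i :: cs then
    mis kap cs h || ((kap h == i) && all (fun d => ~~ mis kap cs (h * d)%g) Ds)
  else false.

Lemma mis_indep kap cols h d : (forall d, d \in Ds -> (d^-1)%g \in Ds) ->
  (forall h d, d \in Ds -> kap h <> kap (h * d)%g) ->
  d \in Ds -> mis kap cols h -> ~~ mis kap cols (h * d)%g.
Proof.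
move=> hsym hk dD; elim: cols => [|i cs IH] //= /orP[m1|/andP[/eqP k1 /allP a1]].
  rewrite negb_or IH //= negb_and; apply/orP; right.
  by apply/allPn; exists (d^-1)%g; [exact: hsym | rewrite mulgK m1].
rewrite negb_or a1 //= negb_and; apply/orP; left.
by apply/eqP => k2; apply: (hk h d dD); rewrite k1 k2.
Qed.

Lemma mis_max kap cols h : kap h \in cols ->
  mis kap cols h \/ exists2 d, d \in Ds & mis kap cols (h * d)%g.
Proof.
elim: cols => [|i cs IH] //=; rewrite inE => /orP[kh|/IH[m|[d dD m]]]; last first.
- by right; exists d; rewrite ?m.
- by left; rewrite m.
have [a|/allPn [d dD]] := boolP (all (fun d => ~~ mis kap cs (h * d)%g) Ds).
  by left; rewrite kh orbT.
by rewrite negbK => m; right; exists d; rewrite ?m.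
Qed.

Lemma mis_shift kap cols t h :
  mis (fun x => kap (t * x)%g) cols h = mis kap cols (t * h)%g.
Proof.
elim: cols h => [|i cs IH] h //=; rewrite IH; congr (_ || (_ && _)).
by apply: eq_all => d; rewrite IH mulgA.
Qed.

Lemma mis_local (A : Type) (kap : Om A -> G -> K) cols : (forall h, local (fun c => kap c h)) ->
  forall h, local (fun c => mis (kap c) cols h).
Proof.
move=> hk; elim: cols => [|i cs IH] h //=; first exact: local_cst.
have h1 : local (fun c => all (fun d => ~~ mis (kap c) cs (h * d)%g) Ds).
  elim: Ds => [|d D' IHD] /=; first exact: local_cst.
  exact: (local_comp2 (fun a b => ~~ a && b) (IH (h * d)%g) IHD).
have h2 := local_comp2 (fun k b => (k == i) && b) (hk h) h1.
exact: (local_comp2 orb (IH h) h2).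
Qed.

End IndependentSet.

(** * Inserting a legal pattern with bounded gaps *)

Section Insertion.
Context (u : Om 'I_3) (k : nat) (lu : legal u).

Let W : seq (G * G) := [seq e i | i <- iota 0 k].
(** Copies of [u] placed at markers [h] and [h'] share a position only if [h^-1 h'] lies in [D1].
    They are joined by an edge only if it lies in [D2] or in the set of inverses of [D2]. *)
Let D1 := [seq (p.2 * q.2^-1)%g | p <- W, q <- W].
Let D2 := [seq (p.2 * p.1 * q.2^-1)%g | p <- W, q <- W].
Let Ds := [seq d <- D1 ++ D2 ++ [seq (d^-1)%g | d <- D2] | d != 1%g].
Let cols : seq (seq 'I_3) := [seq val t | t <- enum {: (size Ds).-tuple 'I_3}].
(** For a legal [c] the entries at [d] of [kap c h] and [kap c (h d)] differ. So [c] itself supplies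
    a proper colouring of the Cayley graph of [Ds], from which markers are chosen locally and
    equivariantly. *)
Let kap (c : Om 'I_3) (h : G) : seq 'I_3 := [seq c (d, h) | d <- Ds].
Let N c h := mis Ds (kap c) cols h.
Let pre c s g : option 'I_3 :=
  omap u (ohead [seq p <- W | (p.1 == s) && N c (g * p.2^-1)%g]).

(** The given colouring orders the completion: its colour classes are independent and serve as the
    stages of the greedy algorithm. *)
Let GG (c : Om 'I_3) : Om 'I_3 := fun p =>
  odflt ord0 (greedy p.1 (fun g => c (p.1, g)) (pre c p.1) (enum 'I_3) p.2).

Let Ds_sym d : d \in Ds -> (d^-1)%g \in Ds.
Proof.
rewrite !mem_filter => /andP[d1]; rewrite -[in X in _ -> X](inj_eq invg_inj) invgK invg1 d1 /=.
rewrite !mem_cat => /or3P[/allpairsP[[p q] /= [pW qW ->]]|h|/mapP[x xD ->]].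
- by apply/orP; left; apply/allpairsP; exists (q, p); rewrite invgM invgK.
- by apply/orP; right; apply/orP; right; apply: map_f.
- by rewrite invgK xD orbT.
Qed.

Let kap_proper c : legal c -> forall h d, d \in Ds -> kap c h <> kap c (h * d)%g.
Proof.
move=> lc h d dD; have d1 : d <> 1%g by move: dD; rewrite mem_filter => /andP[/eqP].
by move=> /eq_in_map /(_ d dD) /esym /lc; apply.
Qed.

Let kap_cols c h : kap c h \in cols.
Proof.
apply/mapP; exists [tuple of map (fun d => c (d, h)) (in_tuple Ds)] => //.
by rewrite mem_enum.
Qed.

Let N_indep c h d : legal c -> d \in Ds -> N c h -> ~~ N c (h * d)%g.
Proof. by move=> lc; apply: mis_indep => //; exact: kap_proper. Qed.

Let pre_ex c s g a : pre c s g = Some a ->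
  exists p, [/\ p \in W, p.1 = s, N c (g * p.2^-1)%g & u p = a].
Proof.
rewrite /pre; case E : (seq.filter _ _) => [|p l] //= [<-]; exists p.
have : p \in seq.filter (fun p => (p.1 == s) && N c (g * p.2^-1)%g) W by rewrite E mem_head.
by rewrite mem_filter => /andP[/andP[/eqP -> ->] ->].
Qed.

(** A second copy covering this position would belong to a marker at a difference in [D1], so all
    copies found here prescribe the same entry of [u]. *)
Let pre_in c h p : legal c -> N c h -> p \in W -> pre c p.1 (h * p.2)%g = Some (u p).
Proof.
move=> lc Nh pW; rewrite /pre.
case E : (seq.filter _ _) => [|q l] /=.
  have : p \in seq.filter (fun q => (q.1 == p.1) && N c (h * p.2 * q.2^-1)%g) W.
    by rewrite mem_filter eqxx mulgK Nh pW.
  by rewrite E.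
have : q \in seq.filter (fun q => (q.1 == p.1) && N c (h * p.2 * q.2^-1)%g) W by rewrite E mem_head.
rewrite mem_filter => /andP[/andP[/eqP q1 Nq] qW].
congr (Some (u _)); rewrite [q]surjective_pairing [p]surjective_pairing q1; congr (_, _).
apply/eqP; apply: contraT => neq; exfalso.
have dD : (p.2 * q.2^-1)%g \in Ds.
  rewrite mem_filter mem_cat; apply/andP; split.
    apply: contra neq => /eqP h1; apply/eqP.
    by rewrite -[q.2]mul1g -h1 mulgVK.
  by apply/orP; left; apply/allpairsP; exists (p, q).
by have := N_indep lc dD Nh; rewrite mulgA Nq.
Qed.

(** By the choice of [D2] two precoloured ends of an edge come from one copy of [u], whose legality
    applies. *)
Let pre_proper c s g a : legal c -> s <> 1%g -> pre c s g = Some a -> pre c s (g * s)%g <> Some a.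
Proof.
move=> lc s1 /pre_ex [p [pW p1 Np ua]] /pre_ex [q [qW q1 Nq ub]].
have [h|h] := eqVneq (p.2 * s)%g q.2.
  apply: (lu (g := p.2) s1).
  by rewrite h -{1}q1 -p1 -!surjective_pairing ua ub.
have dD : (p.2 * p.1 * q.2^-1)%g \in Ds.
  rewrite mem_filter !mem_cat; apply/andP; split.
    rewrite p1; apply: contra h => /eqP h1; apply/eqP.
    by rewrite -[RHS]mul1g -h1 mulgVK.
  by apply/orP; right; apply/orP; left; apply/allpairsP; exists (p, q).
by have := N_indep lc dD Np; rewrite p1 !mulgA mulgVK Nq.
Qed.

Let N_local h : local (fun c => N c h).
Proof.
apply: mis_local => x; exact: (local_map Ds (fun d => local_coord _ (d, x))).
Qed.

Let pre_local s g : local (fun c => pre c s g).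
Proof.
rewrite /pre; apply: local_comp; elim: W => [|p l IH] /=; first exact: local_cst.
have h1 := N_local (g * p.2^-1)%g.
have := local_comp2 (fun b o => if (p.1 == s) && b then Some p else o) h1 IH.
by case=> m hm; exists m => c c' /hm /=; do 2 case: ifP.
Qed.

(** Maximality of the marker set puts a marker in [1%g :: Ds], whatever the legal [c]. Since [GG]
    commutes with shifts, copies of the window of [u] then occur with gaps bounded independently of
    [c]. *)
Lemma syndetic_insertion : exists GG : Om 'I_3 -> Om 'I_3,
  [/\ slide GG, forall c, legal c -> legal (GG c) &
      exists F : seq G, forall c, legal c -> exists2 t, t \in F & agr k (sh t (GG c)) u].
Proof.
have Nsh t c h : N (sh t c) h = N c (t * h)%g by rewrite /N -mis_shift.
have presh t c s g : pre (sh t c) s g = pre c s (t * g)%g.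
  by rewrite /pre; congr (omap u (ohead _)); apply: eq_filter => p; rewrite Nsh mulgA.
exists GG; split.
- split=> [t c|p].
    apply/funext => -[s g]; rewrite /GG /sh /= -greedy_shift; congr (odflt _ _).
    by congr (greedy _ _ _ _ _); apply/funext => h; rewrite presh.
  apply: local_comp; apply: greedy_local => g; first exact: local_coord.
  exact: pre_local.
- move=> c lc s g s1; rewrite /GG /=.
  have h := @greedy_proper _ s (fun g => c (s, g)) (pre c s) (enum 'I_3) g.
  have t g' := @greedy_total _ s (fun g => c (s, g)) (pre c s) (enum 'I_3) g' (mem_enum _ _).
  move: (t g) (t (g * s)%g).
  case E1 : (greedy _ _ _ _ _) => [a|] // _; case E2 : (greedy _ _ _ _ _) => [b|] //= _ ba.
  apply: (h a) => //; last by rewrite E2 ba.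
    by move=> x hx; exact: pre_proper.
  by move=> /esym; exact: lc.
- exists (1%g :: Ds) => c lc.
  have [t tF Nt] : exists2 t, t \in 1%g :: Ds & N c t.
    have [m|[d dD m]] := mis_max Ds (kap_cols c 1%g); first by exists 1%g; rewrite ?mem_head.
    by exists d; rewrite ?inE ?dD ?orbT //; rewrite mul1g in m.
  exists t => // i ik; rewrite /sh /GG /=.
  have eW : e i \in W by apply/mapP; exists i; rewrite // mem_iota add0n.
  by rewrite (@greedy_pre _ _ _ _ _ _ _ (pre_in lc Nt eW)).
Qed.

End Insertion.
End Shifts.

(** * A free minimal subshift as a limit of codes *)

Section MinimalSubshift.
Context (G : groupType) (e : nat -> G * G).
Hypothesis e_surj : forall p, exists n, e n = p.
Notation Om := (Om G).
Notation agr := (agr e).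
Notation slide := (slide e).
Notation local := (local e).

(** Compactness of the full shift over a finite alphabet. *)
Lemma ultra_limit (I : Type) (F : set_system I) (A : finType) (x : I -> Om A) :
  UltraFilter F -> exists c, forall k, F [set i | agr k c (x i)].
Proof.
move=> UF.
have /choice [c hc] : forall p, exists a, F [set i | a = x i p].
  move=> p; have [|a _ Fa] := @ultra_seq A I F (fun a => [set i | a = x i p]) (enum A) UF.
    by apply: filterS filterT => i _; exists (x i p); rewrite ?mem_enum.
  by exists a.
exists c; elim=> [|k IH]; first by apply: filterS filterT.
apply: filterS (filterI IH (hc (e k))) => i [h1 h2] j.
by rewrite ltnS leq_eqVlt => /orP[/eqP -> | /h1].
Qed.

Definition edge_free (A : Type) (c : Om A) (p : G * G) := c (p.1, (p.2 * p.1)%g) <> c p.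

Definition legal_upto (k : nat) (c : Om 'I_3) :=
  forall i, (i < k)%N -> (e i).1 <> 1%g -> edge_free c (e i).

Lemma legal_uptoP c : (forall k, legal_upto k c) <-> legal c.
Proof.
split=> [h s g s1|lc k i _ i1]; last by rewrite /edge_free [e i in X in _ <> X]surjective_pairing; exact: lc.
by have [n hn] := e_surj (s, g); have := h n.+1 n (ltnSn n); rewrite hn; apply.
Qed.

Lemma legal_upto_agr k : exists k', forall c c', agr k' c c' -> legal_upto k c -> legal_upto k c'.
Proof.
elim: k => [|k [k1 hk]]; first by exists 0%N.
have [m hm] := e_surj ((e k).1, ((e k).2 * (e k).1)%g).
exists (maxn k1 (maxn m.+1 k.+1)) => c c' cc lc i.
rewrite ltnS leq_eqVlt => /orP[/eqP -> |ik].
  rewrite /edge_free -hm -!cc ?leq_max ?ltnSn ?orbT // hm.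
  exact: (lc k (ltnSn k)).
by apply: (hk c) => // [|j jk]; [apply: agr_le cc; exact: leq_maxl | apply: lc; exact: ltnW].
Qed.

(** A single labelling drives the colourings of all indices, so every edge whose ends have distinct
    labels is coloured properly. *)
Definition greedy_code (L : finType) (l : G -> L) : Om 'I_3 := fun p =>
  odflt ord0 (greedy p.1 l (fun=> None) (enum L) p.2).

Lemma greedy_code_edge (L : finType) (l : G -> L) s g :
  l g <> l (g * s)%g -> edge_free (greedy_code l) (s, g).
Proof.
move=> lg; rewrite /edge_free /greedy_code /=.
have h := @greedy_proper G _ s l (fun=> None) (enum L) g.
have t g' := @greedy_total G _ s l (fun=> None) (enum L) g' (mem_enum _ _).
move: (t g) (t (g * s)%g).
case E1 : (greedy _ _ _ _ _) => [a|] // _; case E2 : (greedy _ _ _ _ _) => [b|] //= _ ba.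
by apply: (h a) => //; rewrite E2 ba.
Qed.

Lemma greedy_code_slide (L : finType) : slide (fun c : Om L => greedy_code (fun g => c (1%g, g))).
Proof.
split=> [t c|p].
  by apply/funext => -[s g]; rewrite /sh /greedy_code /= -greedy_shift.
apply: local_comp; apply: greedy_local => g; first exact: local_coord.
exact: local_cst.
Qed.

Lemma ultra_nat : exists U : set_system nat, UltraFilter U /\ forall N, U [set n | (N <= n)%N].
Proof.
have [U [UU hU]] := @ultraFilterLemma nat \oo _.
by exists U; split=> // N; apply: hU; exists N.
Qed.

(** The greedy algorithm takes finitely many labels, so the code of [g] is truncated at [K]. The
    truncated labels separate the ends of any given edge once [K] is large, and an ultralimit over
    [K] is legal. *)
Lemma legal_ex : exists c : Om 'I_3, legal c.
Proof.
have [U [UU hU]] := ultra_nat.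
have /choice [code hcode] : forall g : G, exists n, (e n).2 = g.
  by move=> g; have [n hn] := e_surj (1%g, g); exists n; rewrite hn.
pose x K : Om 'I_3 := greedy_code (fun g => inord (minn (code g) K) : 'I_K.+1).
have [c hc] := @ultra_limit nat U 'I_3 x UU.
exists c => s g s1.
have [n hn] := e_surj (s, g); have [m hm] := e_surj (s, (g * s)%g).
have [K [/= hK hcK]] := filter_ex (filterI (hU (maxn (code g) (code (g * s)%g))) (hc (maxn n m).+1)).
rewrite -hn -hm !hcK ?ltnS ?leq_maxl ?leq_maxr // hn hm; apply: greedy_code_edge.
move: hK; rewrite geq_max => /andP[h1 h2] /(congr1 val) /=.
rewrite !inordK ?ltnS ?geq_minr // (minn_idPl h1) (minn_idPl h2) => h.
apply: s1; have : g = (g * s)%g by rewrite -[LHS]hcode -[RHS]hcode h.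
by rewrite -{1}[g]mulg1 => /mulgI.
Qed.

(** Counterexamples that are legal on growing windows would have a legal ultralimit, which agrees
    with one of them on the first [k] coordinates. *)
Lemma legal_extension k : exists k', forall c, legal_upto k' c -> exists2 c', legal c' & agr k c c'.
Proof.
apply: contrapT => /forallNP h.
have /choice [x hx] : forall n, exists c, legal_upto n c /\ ~ exists2 c', legal c' & agr k c c'.
  by move=> n; have /existsNP [c /not_implyP [h1 h2]] := h n; exists c.
have [U [UU hU]] := ultra_nat.
have [c hc] := @ultra_limit nat U 'I_3 x UU.
have [n hn] := filter_ex (hc k).
have [_] := hx n; apply; exists c; last exact: agrC.
apply/legal_uptoP => m; have [m' hm'] := legal_upto_agr m.
have [i [/= hi ci]] := filter_ex (filterI (hU m) (hc m')).
apply: hm' (agrC ci) _ => j jm; apply: (hx i).1; exact: leq_trans jm hi.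
Qed.

Lemma sh_legal t (c : Om 'I_3) : legal c -> legal (sh t c).
Proof. by move=> lc s g s1; rewrite /sh /= mulgA; exact: lc. Qed.

Definition pat (A : Type) (k : nat) (c : Om A) : seq A := [seq c (e i) | i <- iota 0 k].

Lemma patP (A : Type) k (c c' : Om A) : agr k c c' <-> pat k c = pat k c'.
Proof.
split=> [h|/eq_in_map h i ik]; last by apply: h; rewrite mem_iota.
by apply/eq_in_map => i; rewrite mem_iota => /andP[_]; exact: h.
Qed.

Definition good (phi : Om 'I_3 -> Om 'I_3) := slide phi /\ forall c, legal c -> legal (phi c).

(** One step of a limit construction: images of legal points shrink, and the pattern [p], if it
    occurs at all, comes to occur with bounded gaps. *)
Definition refines (p : seq 'I_3) (phi phi' : Om 'I_3 -> Om 'I_3) :=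
  (forall c, legal c -> exists2 c', legal c' & phi' c = phi c') /\
  ((exists2 u, legal u & pat (size p) (phi u) = p) -> exists F : seq G,
     forall c, legal c -> exists2 t, t \in F & pat (size p) (sh t (phi' c)) = p).

(** Precompose [phi] with the insertion of a legal [u] whose image shows [p], on a window large
    enough to determine that pattern. *)
Lemma refinement p phi : good phi -> exists phi', good phi' /\ refines p phi phi'.
Proof.
move=> [sphi lphi].
have [[u lu hu]|h] := pselect (exists2 u, legal u & pat (size p) (phi u) = p); last first.
  by exists phi; split=> //; split=> // c lc; exists c.
have [k' hk'] := slide_agr (size p) sphi.
have [GG [sG lG [F hF]]] := syndetic_insertion e_surj k' lu.
exists (phi \o GG); split; first by split=> [|c lc]; [exact: slide_comp | apply/lphi/lG].
split=> [c lc|_]; first by exists (GG c) => //; exact: lG.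
exists F => c lc; have [t tF ht] := hF c lc; exists t => //.
by rewrite -[in RHS]hu /= -sphi.1; apply/patP/hk'.
Qed.

(** The identity is refined once for every finite pattern, at the stage given by its code. A pattern
    seen in [X] occurs in the image at that stage, hence with bounded gaps in every later image:
    this is minimality. Some [phi N] already sends all legal points into a given neighbourhood of
    [X], and with [legal_extension] it becomes the code of the last clause. *)
Theorem minimal_subshift : exists X : set (Om 'I_3),
  [/\ X !=set0, forall x, X x -> legal x, forall t x, X x -> X (sh t x)
    & forall x, (forall k, exists2 y, X y & agr k x y) -> X x] /\
  (forall y k, X y -> exists F : seq G, forall x, X x -> exists2 t, t \in F & agr k (sh t x) y) /\
  (forall j, exists (Phi : Om 'I_3 -> Om 'I_3) (k : nat), slide Phi /\
     forall c, legal_upto k c -> exists2 x, X x & agr j x (Phi c)).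
Proof.
pose upk : nat -> option (seq 'I_3) := unpickle.
have upkK p : upk (pickle p) = Some p by exact: pickleK.
clearbody upk.
have step : forall np : nat * {phi | good phi}, exists q : {phi | good phi},
    if upk np.1 is Some p then refines p (sval np.2) (sval q) else sval q = sval np.2.
  move=> [n [phi gphi]] /=; case: (upk n) => [p|]; last by exists (exist _ phi gphi).
  by have [phi' [g' r']] := refinement p gphi; exists (exist _ phi' g').
have [next hnext] := choice step.
have gid : good id by split=> //; exact: slide_id.
pose ph := fix ph n : {phi | good phi} :=
  if n is m.+1 then next (m, ph m) else exist _ (id : Om 'I_3 -> Om 'I_3) gid.
pose phi n := sval (ph n).
have gphi n : good (phi n) by exact: svalP (ph n).
have phiS n c : legal c -> exists2 c', legal c' & phi n.+1 c = phi n c'.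
  move=> lc; have := hnext (n, ph n); rewrite /phi /=.
  by case: (upk n) => [p [h _]|->]; [exact: h | exists c].
have phi_le m n c : (m <= n)%N -> legal c -> exists2 c', legal c' & phi n c = phi m c'.
  move=> /subnK <-; elim: (n - m)%N c => [|d IH] c lc; first by exists c.
  by rewrite addSn; have [c' lc' ->] := phiS (d + m)%N c lc; exact: IH.
have phi_pat p : (exists2 u, legal u & pat (size p) (phi (pickle p) u) = p) ->
    exists F : seq G, forall c, legal c ->
      exists2 t, t \in F & pat (size p) (sh t (phi (pickle p).+1 c)) = p.
  by have := hnext (pickle p, ph (pickle p)); rewrite /= upkK => -[].
(* The intersection of the closures of the decreasing images of the legal points. *)
pose X : set (Om 'I_3) := [set x | forall n k, exists2 u, legal u & agr k x (phi n u)].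
(* Otherwise points of ever later images that stay away from [X] would have an ultralimit lying in
   all the closures, hence in [X]. *)
have win j : exists N, forall n u, (N <= n)%N -> legal u -> exists2 x, X x & agr j x (phi n u).
  apply: contrapT => /forallNP h.
  have /choice [z hz] : forall N, exists nu : nat * Om 'I_3, [/\ (N <= nu.1)%N, legal nu.2
      & ~ exists2 x, X x & agr j x (phi nu.1 nu.2)].
    move=> N; have /existsNP [n /existsNP [u /not_implyP [h1 /not_implyP [h2 h3]]]] := h N.
    by exists (n, u).
  have [U [UU hU]] := ultra_nat.
  have [c hc] := @ultra_limit nat U 'I_3 (fun N => phi (z N).1 (z N).2) UU.
  have [N hN] := filter_ex (hc j).
  have [_ _] := hz N; apply; exists c => // n k.
  have [i [/= hi ci]] := filter_ex (filterI (hU n) (hc k)).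
  have [h1 h2 _] := hz i; have [c' lc' E] := phi_le n _ _ (leq_trans hi h1) h2.
  by exists c'; rewrite // -E.
exists X; split; [split|split].
- have [c lc] := legal_ex; have [N hN] := win 0%N.
  by have [x Xx _] := hN N c (leqnn N) lc; exists x.
- move=> x Xx; apply/legal_uptoP => k; have [k' hk'] := legal_upto_agr k.
  have [u lu xu] := Xx 0%N k'; apply: hk' (agrC xu) _.
  by apply: (proj2 (legal_uptoP _)); exact: (gphi 0%N).2.
- move=> t x Xx n k; have [k' hk'] := sh_agr e_surj 'I_3 t k.
  have [u lu xu] := Xx n k'; exists (sh t u); first exact: sh_legal.
  by rewrite (gphi n).1.1; exact: hk'.
- move=> x h n k; have [y Xy xy] := h k; have [u lu yu] := Xy n k.
  by exists u => //; exact: agr_trans xy yu.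
- move=> y k Xy; have sp : size (pat k y) = k by rewrite size_map size_iota.
  have := phi_pat (pat k y); rewrite sp => -[|F hF].
    have [u lu yu] := Xy (pickle (pat k y)) k; exists u => //.
    by apply/patP/agrC.
  exists F => x Xx.
  have [k' hk'] : exists k', forall c c' : Om 'I_3, agr k' c c' -> forall t, t \in F -> agr k (sh t c) (sh t c').
    elim: F {hF} => [|t F [k' IH]]; first by exists 0%N.
    have [m hm] := sh_agr e_surj 'I_3 t k; exists (maxn k' m) => c c' cc s.
    rewrite inE => /orP[/eqP -> |sF].
      by apply: hm; apply: agr_le cc; exact: leq_maxr.
    by apply: IH sF; apply: agr_le cc; exact: leq_maxl.
  have [u lu xu] := Xx (pickle (pat k y)).+1 k'.
  have [t tF ht] := hF u lu; exists t => //.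
  by apply: agr_trans (hk' _ _ xu t tF) _; apply/patP.
- move=> j; have [N hN] := win j; have [k hk] := slide_agr j (gphi N).1.
  have [k' hk'] := legal_extension k; exists (phi N), k'; split; first exact: (gphi N).1.
  move=> c /hk' [c' lc' cc']; have [x Xx xc] := hN N c' (leqnn N) lc'.
  by exists x => //; apply: agr_trans xc (agrC (hk _ _ cc')).
Qed.

End MinimalSubshift.

(** * Maps determined on a dense image *)

Section Density.
Context (R : realType).
Local Notation C := R[i].
Context (U : lmodType C) (D : set U) (V : normedModType C) (i : U -> V).
Hypothesis iD : forall x (e : R), 0 < e -> exists2 u, D u & rnorm (x - i u) < e.

Lemma dense_seq x : exists u : nat -> U, (forall n, D (u n)) /\ cvs (i \o u) x.
Proof.
have /choice [v hv] : forall n : nat, exists v, D v /\ rnorm (x - i v) < n.+1%:R^-1.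
  by move=> n; have [|v] := @iD x n.+1%:R^-1; [rewrite invr_gt0 | exists v].
exists v; split=> [n|e e0]; first by case: (hv n).
have [N hN] := small_half e0; exists N => n hn /=; rewrite rnormB.
apply: le_trans (ltW (hv n).2) (le_trans _ (ltW hN)).
by rewrite lef_pV2 ?posrE ?ltr0Sn // ler_nat ltnS.
Qed.

Lemma dense_eq (W : normedModType C) (F F' : V -> W) (M M' : R) : linear F -> linear F' ->
  0 <= M -> 0 <= M' -> (forall x, rnorm (F x) <= M * rnorm x) ->
  (forall x, rnorm (F' x) <= M' * rnorm x) -> (forall u, D u -> F (i u) = F' (i u)) -> F =1 F'.
Proof.
move=> lF lF' M0 M0' hM hM' h x; have [u [Du hu]] := dense_seq x.
apply: cvs_eq (cvs_op lF M0 hM hu) (cvs_op lF' M0' hM' hu) => n /=; exact: h.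
Qed.

End Density.

(** * Bernoulli means of functions of finitely many coordinates *)

Section Bernoulli.
Context (R : realType) (G : groupType) (e : nat -> G * G).
Hypothesis e_surj : forall p, exists n, e n = p.
Local Notation C := R[i].
Notation Om := (Om G).

Section Mean.
Context (A : finType) (a0 : A).
Implicit Types (f g : Om A -> C^o) (c : Om A).

Definition upd c p a : Om A := fun q => if q == p then a else c q.

Definition avg p f : Om A -> C^o := fun c => #|A|%:R^-1 * \sum_a f (upd c p a).

Definition avgs (s : seq (G * G)) f := foldr avg f s.

Definition dep (s : seq (G * G)) f := forall c c', (forall p, p \in s -> c p = c' p) -> f c = f c'.

Let A0 : (#|A|%:R : C) != 0.
Proof. by rewrite pnatr_eq0 -lt0n; apply/card_gt0P; exists a0. Qed.

Lemma avg_lin p k f g : avg p (k *: f + g) = k *: avg p f + avg p g.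
Proof.
apply/funext => c; rewrite /avg !fctE big_split /= mulrDr; congr (_ + _).
by rewrite -scaler_sumr [RHS]mulrCA.
Qed.

Lemma avgs_lin s k f g : avgs s (k *: f + g) = k *: avgs s f + avgs s g.
Proof. by elim: s => [|p s IH] //=; rewrite IH avg_lin. Qed.

Lemma avg_comm p q f : avg p (avg q f) = avg q (avg p f).
Proof.
have [->//|pq] := eqVneq p q; apply/funext => c; rewrite /avg -!mulr_sumr; congr (_ * (_ * _)).
rewrite exchange_big; apply: eq_bigr => a _; apply: eq_bigr => b _; congr f.
apply/funext => x; rewrite /upd; have [->|//] := eqVneq x q.
by rewrite eq_sym (negbTE pq).
Qed.

Lemma avgs_avg s p f : avgs s (avg p f) = avg p (avgs s f).
Proof. by elim: s => [|q s IH] //=; rewrite IH avg_comm. Qed.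

Lemma avgs_comm s t f : avgs s (avgs t f) = avgs t (avgs s f).
Proof. by elim: t => [|q t IH] //=; rewrite avgs_avg IH. Qed.

Lemma avg_indep p f : (forall c a, f (upd c p a) = f c) -> avg p f = f.
Proof.
move=> h; apply/funext => c; rewrite /avg (eq_bigr (fun=> f c)) //.
by rewrite sumr_const mulrnAr -mulr_natl mulrA divff // mul1r.
Qed.

Lemma avgs_indep s f : (forall p, p \in s -> forall c a, f (upd c p a) = f c) -> avgs s f = f.
Proof.
elim: s => [|p s IH] //= h; rewrite IH ?avg_indep // => [|q qs]; first exact: h (mem_head _ _).
by apply: h; rewrite inE qs orbT.
Qed.

Lemma dep_upd s f p c a : dep s f -> p \notin s -> f (upd c p a) = f c.
Proof.
move=> ds ps; apply: ds => q qs; rewrite /upd; case: eqP => // h.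
by move: ps; rewrite -h qs.
Qed.

Lemma avg_dep p s f : dep (p :: s) f -> dep s (avg p f).
Proof.
move=> ds c c' cc; rewrite /avg; congr (_ * _); apply: eq_bigr => a _.
apply: ds => q; rewrite inE /upd; case: eqP => //= _; exact: cc.
Qed.

Lemma avgs_cst s f : dep s f -> exists z, forall c, avgs s f c = z.
Proof.
elim: s f => [|p s IH] f ds /=; first by exists (f (fun=> a0)) => c; exact: ds.
by rewrite -avgs_avg; apply/IH/avg_dep.
Qed.

Lemma avgs_uniq s t f z w : (forall c, avgs s f c = z) -> (forall c, avgs t f c = w) -> z = w.
Proof.
move=> hz hw; have := avgs_comm s t f.
have -> : avgs t f = fun=> w by apply/funext.
have -> : avgs s f = fun=> z by apply/funext.
by rewrite !avgs_indep // => /(congr1 (fun h => h (fun=> a0))).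
Qed.

(** The Bernoulli integral without a measure: averaging over any list of coordinates that determines
    [f] yields a constant, and two such lists yield the same one because the averages commute. *)
Definition bmean f : C := xget 0 [set z : C^o | exists s, dep s f /\ forall c, avgs s f c = z].

Lemma bmeanE s f c : dep s f -> avgs s f c = bmean f.
Proof.
move=> ds; have [z hz] := avgs_cst ds; rewrite /bmean.
case: xgetP => [w _ [t [dt hw]]|/(_ z)]; last by case; exists s.
by rewrite hz; exact: avgs_uniq hz hw.
Qed.

Definition ldep f := exists s, dep s f.

Lemma local_ldep f : local e f -> ldep f.
Proof.
move=> [k hk]; exists [seq e i | i <- iota 0 k] => c c' cc; apply: hk => i ik.
by apply: cc; apply: map_f; rewrite mem_iota.
Qed.

Lemma dep_cat s t f : dep s f -> dep (s ++ t) f.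
Proof. by move=> h c c' cc; apply: h => p ps; apply: cc; rewrite mem_cat ps. Qed.

Lemma dep_cat2 s t f : dep t f -> dep (s ++ t) f.
Proof. by move=> h c c' cc; apply: h => p ps; apply: cc; rewrite mem_cat ps orbT. Qed.

Lemma ldep_comp f (h : C -> C) : ldep f -> ldep (fun c => h (f c)).
Proof. by move=> [s ds]; exists s => c c' /ds ->. Qed.

Lemma ldep_comp2 f g (h : C -> C -> C) : ldep f -> ldep g -> ldep (fun c => h (f c) (g c)).
Proof.
move=> [s ds] [t dt]; exists (s ++ t) => c c' cc.
by rewrite (@dep_cat s t _ ds _ _ cc) (@dep_cat2 s t _ dt _ _ cc).
Qed.

Lemma ldep_cst (z : C) : ldep (fun=> z). Proof. by exists [::]. Qed.

Lemma ldep_lin k f g : ldep f -> ldep g -> ldep (k *: f + g).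
Proof. exact: ldep_comp2 (fun x y => k * x + y). Qed.

Lemma ldep_sh t f : ldep f -> ldep (f \o sh t).
Proof.
move=> [s ds]; exists [seq (p.1, (t * p.2)%g) | p <- s] => c c' cc; apply: ds => p ps.
by apply: cc; apply/mapP; exists p.
Qed.

Lemma bmean_lin k f g : ldep f -> ldep g -> bmean (k *: f + g) = k * bmean f + bmean g.
Proof.
move=> [s ds] [t dt]; set c : Om A := fun=> a0.
have d1 : dep (s ++ t) (k *: f + g).
  by move=> x x' xx; rewrite !fctE (@dep_cat s t _ ds _ _ xx) (@dep_cat2 s t _ dt _ _ xx).
rewrite -(bmeanE c d1) -(bmeanE c (@dep_cat s t _ ds)) -(bmeanE c (@dep_cat2 s t _ dt)).
by rewrite avgs_lin.
Qed.

Lemma bmean_cst (z : C) : bmean (fun=> z) = z.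
Proof. by rewrite -(@bmeanE [::] _ (fun=> a0)). Qed.

Lemma bmeanB f g : ldep f -> ldep g -> bmean (f - g) = bmean f - bmean g.
Proof. by move=> lf lg; rewrite addrC -scaleN1r bmean_lin // mulN1r addrC. Qed.

Lemma bmeanZ k f : ldep f -> bmean (k *: f) = k * bmean f.
Proof.
move=> lf; have := bmean_lin k lf (ldep_cst 0).
have -> : k *: f + (fun=> 0) = k *: f by apply/funext => c; rewrite !fctE addr0.
by rewrite bmean_cst addr0.
Qed.

Lemma bmeanD f g : ldep f -> ldep g -> bmean (f + g) = bmean f + bmean g.
Proof. by move=> lf lg; have := bmean_lin 1 lf lg; rewrite scale1r mul1r. Qed.

Lemma avgs_ge0 s f : (forall c, 0 <= f c) -> forall c, 0 <= avgs s f c.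
Proof.
move=> h; elim: s => [|p s IH] c //=; rewrite /avg mulr_ge0 ?invr_ge0 ?ler0n //.
by apply: sumr_ge0 => a _.
Qed.

Lemma bmean_ge0 f : ldep f -> (forall c, 0 <= f c) -> 0 <= bmean f.
Proof. by move=> [s ds] h; rewrite -(bmeanE (fun=> a0) ds); exact: avgs_ge0. Qed.

Lemma bmean_le f g : ldep f -> ldep g -> (forall c, f c <= g c) -> bmean f <= bmean g.
Proof.
move=> lf lg h; rewrite -subr_ge0 -bmeanB //; apply: bmean_ge0 => [|c]; last first.
  by rewrite !fctE subr_ge0.
exact: (ldep_comp2 (fun x y => x - y)).
Qed.

Lemma avgs_norm s f c : `|avgs s f c| <= avgs s (fun c => `|f c| : C^o) c.
Proof.
elim: s c => [|p s IH] c //=; rewrite /avg normrM ger0_norm ?invr_ge0 ?ler0n //.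
rewrite ler_wpM2l ?invr_ge0 ?ler0n // (le_trans (ler_norm_sum _ _ _)) //.
by apply: ler_sum => a _.
Qed.

Lemma bmean_norm f : ldep f -> `|bmean f| <= bmean (fun c => `|f c|).
Proof.
move=> [s ds]; set c : Om A := fun=> a0.
rewrite -(bmeanE c ds) -(@bmeanE s (fun c => `|f c| : C^o) c) ?avgs_norm //.
by move=> x x' /ds ->.
Qed.

Lemma avgs_conj s f : avgs s (fun c => Num.conj (f c) : C^o) = fun c => Num.conj (avgs s f c).
Proof.
elim: s => [|p s IH] //=; apply/funext => c; rewrite IH /avg rmorphM fmorphV rmorph_nat.
by rewrite rmorph_sum.
Qed.

Lemma bmean_conj f : ldep f -> bmean (fun c => Num.conj (f c)) = Num.conj (bmean f).
Proof.
move=> [s ds]; set c : Om A := fun=> a0.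
rewrite -(bmeanE c ds) -(@bmeanE s (fun c => Num.conj (f c) : C^o) c) ?avgs_conj //.
by move=> x x' /ds ->.
Qed.

Lemma avgs_sh t s f : avgs s (f \o sh t) = avgs [seq (p.1, (t^-1 * p.2)%g) | p <- s] f \o sh t.
Proof.
elim: s => [|p s IH] //=; rewrite IH; apply/funext => c; rewrite /avg /=; congr (_ * _).
apply: eq_bigr => a _; congr (avgs _ f _); apply/funext => q; rewrite /sh /upd.
congr (if _ then _ else _); case: p q => [p1 p2] [q1 q2] /=; rewrite !xpair_eqE.
by congr (_ && _); apply/eqP/eqP => [<-|->]; rewrite ?mulKg ?mulVKg.
Qed.

Lemma bmean_sh t f : ldep f -> bmean (f \o sh t) = bmean f.
Proof.
move=> [s ds]; pose s' := [seq (p.1, (t * p.2)%g) | p <- s].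
have ds' : dep s' (f \o sh t).
  by move=> c c' cc; apply: ds => p ps; apply: cc; apply/mapP; exists p.
rewrite -(bmeanE (fun=> a0) ds') avgs_sh -(bmeanE (sh t (fun=> a0)) ds) /= -map_comp.
by rewrite (@eq_map _ _ _ id) ?map_id // => -[x y] /=; rewrite mulKg.
Qed.

Lemma avgs_mul s f g : (forall p, p \in s -> forall c a, f (upd c p a) = f c) ->
  avgs s (fun c => f c * g c) = fun c => f c * avgs s g c.
Proof.
elim: s => [|p s IH] //= h; rewrite IH => [|q qs]; last by apply: h; rewrite inE qs orbT.
apply/funext => c; rewrite /avg [RHS]mulrCA [X in _ = _ * X]mulr_sumr; congr (_ * _).
by apply: eq_bigr => a _; rewrite h ?mem_head.
Qed.

Lemma bmean_indep s t f g : dep s f -> dep t g -> (forall p, p \in s -> p \notin t) ->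
  bmean (fun c => f c * g c) = bmean f * bmean g.
Proof.
move=> ds dt st; set c : Om A := fun=> a0.
have d : dep (s ++ t) (fun c => f c * g c).
  by move=> x x' xx; rewrite (@dep_cat s t _ ds _ _ xx) (@dep_cat2 s t _ dt _ _ xx).
rewrite -(bmeanE c d) /avgs foldr_cat -!/(avgs _ _).
rewrite avgs_mul => [|p pt c' a]; last first.
  by apply: dep_upd ds _; apply: contraL pt => /st.
have -> : (fun c => f c * avgs t g c) = bmean g *: f.
  by apply/funext => x; rewrite (bmeanE x dt) !fctE mulrC.
have := avgs_lin s (bmean g) f 0; rewrite addr0 => ->.
rewrite !fctE (bmeanE c ds) [_ *: _]mulrC.
by rewrite (@avgs_indep s (0 : Om A -> C^o)) // addr0.
Qed.

Lemma bmean_coincide p q : p != q -> bmean (fun c => (c p == c q)%:R) = #|A|%:R^-1.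
Proof.
move=> pq; set f := fun c : Om A => (c p == c q)%:R : C^o.
have d : dep [:: p; q] f by move=> c c' cc; rewrite /f !cc ?inE ?eqxx ?orbT.
rewrite -(bmeanE (fun=> a0) d) /=.
have -> : avg q f = fun=> #|A|%:R^-1.
  apply/funext => c; rewrite /avg (bigD1 (c p)) //= big1 => [|a ap].
    by rewrite /f /upd eqxx (negbTE pq) eqxx addr0 mulr1.
  by rewrite /f /upd eqxx (negbTE pq) eq_sym (negbTE ap).
by rewrite avg_indep.
Qed.

End Mean.

(** * A uniform spectral gap for Bernoulli shifts *)

Section SpectralGap.
Context (A : finType) (a0 : A).
Implicit Types f g : Om A -> C^o.

Definition bdom : set (Om A -> C^o) := [set f | ldep f /\ bmean f = 0].
Definition bip f g : C := bmean (fun c => f c * Num.conj (g c)).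

Lemma bdom_submod : submod bdom.
Proof.
split=> [|k f g [lf f0] [lg g0]]; first by split; [exact: ldep_cst | rewrite (bmean_cst a0)].
by split; [exact: ldep_lin | rewrite (bmean_lin a0) // f0 g0 mulr0 addr0].
Qed.

Lemma ldep_ip f g : ldep f -> ldep g -> ldep (fun c => f c * Num.conj (g c)).
Proof. by move=> lf lg; exact: (ldep_comp2 (fun x y => x * Num.conj y) lf lg). Qed.

Definition bern_prehilbert : prehilbert R.
Proof.
apply: (@PreHilbert R _ bdom bip).
- exact: bdom_submod.1.
- exact: bdom_submod.2.
- move=> k f g h [lf _] [lg _] [lh _]; rewrite /bip -(bmean_lin a0); try exact: ldep_ip.
  by congr bmean; apply/funext => c; rewrite !fctE mulrDl -scalerAl.
- move=> f g [lf _] [lg _]; rewrite /bip -(bmean_conj a0); last exact: ldep_ip.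
  by congr bmean; apply/funext => c; rewrite rmorphM /= conjCK mulrC.
- move=> f [lf _]; apply: (bmean_ge0 a0) => [|c]; first exact: ldep_ip.
  by rewrite mul_conjC_ge0.
Defined.

Hypothesis Ginf : infinite_set [set: G].

Lemma infinite_avoid (s : seq G) : exists t, t \notin s.
Proof.
apply: contrapT => /forallNP h; apply: Ginf; apply: (sub_finite_set _ (finite_seq s)).
by move=> t _ /=; have /negP := h t; rewrite negbK.
Qed.

(** As [G] is infinite, some [t] moves the finite set of coordinates of [f] off itself; the inner
    product then factors into means, which vanish. *)
Lemma bern_mixing f : bdom f -> exists t, bip (f \o sh t) f = 0.
Proof.
move=> [[s ds] f0]; have [t ht] := infinite_avoid [seq (q.2 * p.2^-1)%g | p <- s, q <- s].
exists t; pose s' := [seq (p.1, (t * p.2)%g) | p <- s].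
have ds' : dep s' (f \o sh t).
  by move=> c c' cc; apply: ds => p ps; apply: cc; apply/mapP; exists p.
have ds2 : dep s (fun c => Num.conj (f c) : C^o) by move=> c c' /ds ->.
rewrite /bip (bmean_indep a0 ds' ds2) => [|_ /mapP[p ps ->]].
  by rewrite (bmean_sh a0) ?f0 ?mul0r //; exists s.
apply: contra ht => qs; apply/allpairsP; exists (p, (p.1, (t * p.2)%g)); split => //=.
by rewrite mulgK.
Qed.

End SpectralGap.

(** Mixing excludes nonzero invariant vectors among mean-zero functions, so some element of the
    Kazhdan set moves each nonzero vector by a definite amount. The order of quantifiers is
    essential: [Q] and [eps] do not depend on the alphabet, which varies along the later
    ultralimit. *)
Theorem bernoulli_poincare : infinite_set [set: G] -> property_T R G ->
  exists (Q : seq G) (eps : R), 0 < eps /\ forall (A : finType) (a0 : A) (f : Om A -> C^o), ldep f ->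
    (eps ^+ 2)%:C * (bmean (fun c => `|f c| ^+ 2) - `|bmean f| ^+ 2) <=
      \sum_(s <- Q) bmean (fun c => `|f (sh s c) - f c| ^+ 2).
Proof.
move=> Ginf [Q0 [eps [/finite_seqP [Q ->] eps0 hT]]]; exists Q, eps; split=> // A a0 f lf.
have [H [i [ilin iinn idense]]] := hilbert_completion (bern_prehilbert a0).
have sD : submod (@bdom A) := bdom_submod a0.
have inorm (g : Om A -> C^o) : bdom g -> ((rnorm (i g)) ^+ 2)%:C = bip g g.
  by move=> Dg; rewrite -inner_sqr iinn.
have Dsh t (g : Om A -> C^o) : bdom g -> bdom (g \o sh t).
  by move=> [lg g0]; split; [exact: ldep_sh | rewrite (bmean_sh a0)].
have bipsh t (g h : Om A -> C^o) : bdom g -> bdom h -> bip (g \o sh t) (h \o sh t) = bip g h.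
  by move=> [lg _] [lh _]; exact: (bmean_sh a0 t (ldep_ip lg lh)).
have nsh t (g : Om A -> C^o) : bdom g -> rnorm (i (g \o sh t)) <= 1 * rnorm (i g).
  move=> Dg; rewrite mul1r -ler_sqr ?nnegrE ?rnorm_ge0 // -lecR !inorm ?bipsh //; exact: Dsh.
have /choice [pi hpi] : forall t, exists F : H -> H, [/\ linear F,
    forall g, bdom g -> F (i g) = i (g \o sh t) & forall x, rnorm (F x) <= 1 * rnorm x].
  move=> t; apply: (@extension R _ (@bdom A) H H (@complete_seq R H) i (fun g => i (g \o sh t)) 1) => //.
  - by move=> k g h Dg Dh; rewrite -ilin //; exact: Dsh.
  - exact: nsh.
have pil t : linear (pi t) by case: (hpi t).
have pii t g : bdom g -> pi t (i g) = i (g \o sh t) by case: (hpi t) => _ + _; exact.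
have pin t x : rnorm (pi t x) <= 1 * rnorm x by case: (hpi t) => _ _; exact.
have urep : unitary_rep pi.
  split=> //.
  - apply: (@dense_eq R _ (@bdom A) H i idense H (pi 1%g) id 1 1) => //.
      by move=> x; rewrite mul1r.
    by move=> g Dg; rewrite pii //; congr i; apply/funext => c /=; rewrite sh1.
  - move=> s t; apply: (@dense_eq R _ (@bdom A) H i idense H (pi (s * t)%g) (pi s \o pi t) 1 1) => //.
    + by move=> k x y /=; rewrite !pil.
    + by move=> x /=; have := pin t x; have := pin s (pi t x); rewrite !mul1r; exact: le_trans.
    + move=> g Dg /=; rewrite !pii //; last exact: Dsh.
      by congr i; apply/funext => c /=; rewrite shM.
  - move=> s x y; have [u [Du hu]] := dense_seq idense x; have [v [Dv hv]] := dense_seq idense y.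
    have h := cvs_inner (cvs_op (pil s) ler01 (pin s) hu) (cvs_op (pil s) ler01 (pin s) hv).
    apply: cvs_eq h (cvs_inner hu hv) => n /=.
    rewrite (pii s _ (Du n)) (pii s _ (Dv n)) (iinn _ _ (Dsh s _ (Du n)) (Dsh s _ (Dv n))).
    rewrite (iinn _ _ (Du n) (Dv n)); exact: (bipsh s _ _ (Du n) (Dv n)).
(* For a local [g] near [x] and [t] with [<t g, g> = 0], invariance gives
   [|x|^2 = <t (x - g), x> + <t g, x - g>], and both terms are small. *)
have noinv x : (forall s, pi s x = x) -> x = 0.
  move=> hx; apply: rnorm_eq0; apply/eqP; rewrite -sqrf_eq0 eq_le sqr_ge0 andbT.
  apply/ler_addgt0Pr => d d0; rewrite add0r.
  have K0 : 0 < 2 * rnorm x + 1 by rewrite ltr_wpDl // mulr_ge0 ?rnorm_ge0.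
  (* With [e' <= 1] the two terms add up to at most [e' |x| + (|x| + e') e'], hence to at most
     [e' (2 |x| + 1)]. *)
  set e' := Num.min 1 (d / (2 * rnorm x + 1)).
  have e0 : 0 < e' by rewrite lt_min ltr01 divr_gt0.
  have e1 : e' <= 1 by rewrite ge_min lexx.
  have e2 : e' * (2 * rnorm x + 1) <= d by rewrite -ler_pdivlMr // ge_min lexx orbT.
  have [g Dg hg] := idense x _ e0; have [t ht] := bern_mixing a0 Ginf Dg.
  have E : ((rnorm x) ^+ 2)%:C = inner H (pi t (x - i g)) x + inner H (pi t (i g)) (x - i g).
    have I0 : inner H (pi t (i g)) (i g) = 0.
      by rewrite (pii t _ Dg) (iinn _ _ (Dsh t _ Dg) Dg).
    by rewrite (linB (pil t)) iBl iBr I0 subr0 subrK hx inner_sqr.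
  rewrite -(cmodC (sqr_ge0 (rnorm x))) E.
  have n1 := inner_CS (pi t (x - i g)) x; have n2 := inner_CS (pi t (i g)) (x - i g).
  have n3 := pin t (x - i g); have n4 := pin t (i g).
  have n5 : rnorm (i g) <= rnorm x + e'.
    by have := rnormD (i g - x) x; rewrite subrK rnormB; lra.
  have n6 : rnorm (pi t (x - i g)) * rnorm x <= e' * rnorm x by rewrite ler_wpM2r ?rnorm_ge0 //; lra.
  have n7 : rnorm (pi t (i g)) * rnorm (x - i g) <= (rnorm x + e') * e'.
    by apply: ler_pM; rewrite ?rnorm_ge0 //; lra.
  have n8 := cmodD (inner H (pi t (x - i g)) x) (inner H (pi t (i g)) (x - i g)).
  have n9 : e' * e' <= e' * 1 by rewrite ler_wpM2l // ltW.
  nra.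
have ipn (g : Om A -> C^o) : bip g g = bmean (fun c => `|g c| ^+ 2).
  by congr bmean; apply/funext => c; rewrite normCK.
have gap (g : Om A -> C^o) : bdom g ->
    (eps ^+ 2)%:C * bip g g <= \sum_(s <- Q) bip (g \o sh s - g) (g \o sh s - g).
  move=> Dg; have Ds s : bdom (g \o sh s - g) by apply: (submodB sD) => //; exact: Dsh.
  have S0 : 0 <= \sum_(s <- Q) bip (g \o sh s - g) (g \o sh s - g).
    by apply: sumr_ge0 => s _; rewrite -inorm // ler0c sqr_ge0.
  have [x0|x0] := pselect (i g = 0).
    by rewrite -inorm // x0 rnorm0 expr0n /= mulr0.
  have [s sQ hs] : exists2 s, s \in Q & eps * rnorm (i g) <= rnorm (pi s (i g) - i g).
    apply: contrapT => h; have [|y [y0 hy]] := hT H pi urep.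
      exists (i g); split=> // s sQ; rewrite ltNge; apply/negP => h'; apply: h; by exists s.
    by apply: y0; exact: noinv.
  rewrite (big_rem s) //= -inorm // -rmorphM.
  apply: le_trans (_ : bip (g \o sh s - g) (g \o sh s - g) <= _); last first.
    by rewrite lerDl; apply: sumr_ge0 => s' _; rewrite -inorm // ler0c sqr_ge0.
  rewrite -inorm // lecR -exprMn ler_sqr ?nnegrE ?mulr_ge0 ?rnorm_ge0 ?(ltW eps0) //.
  have -> : i (g \o sh s - g) = pi s (i g) - i g by rewrite pii // -(lin_onB ilin) //; exact: Dsh.
  exact: hs.
set z := bmean f; pose f0 : Om A -> C^o := f - (fun=> z).
have l0 : ldep f0 by apply: (ldep_comp2 (fun x y => x - y)) => //; exact: ldep_cst.
have D0 : bdom f0 by split=> //; rewrite (bmeanB a0) // ?(bmean_cst a0) ?subrr //; exact: ldep_cst.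
have := gap _ D0; rewrite (eq_bigr (fun s => bmean (fun c => `|f (sh s c) - f c| ^+ 2))).
  move=> /le_trans h; apply: le_trans (h _ (lexx _)); rewrite le_eqVlt; apply/orP; left; apply/eqP.
  congr (_ * _); rewrite /bip.
  have -> : (fun c => f0 c * Num.conj (f0 c)) = (fun c => `|f c| ^+ 2) -
     (Num.conj z *: f + z *: ((fun c => Num.conj (f c)) - (fun=> Num.conj z))).
    apply/funext => c; rewrite /f0 !fctE normCK rmorphB /=.
    rewrite -[_ *: f c]/(_ * _) -[z *: _]/(_ * _); ring.
  have lc : ldep (fun c => Num.conj (f c) : C^o) by exact: ldep_comp.
  have l2 : ldep (fun c => `|f c| ^+ 2 : C^o) by exact: (ldep_comp (fun x => `|x| ^+ 2)).
  have l3 : ldep ((fun c => Num.conj (f c)) - (fun=> Num.conj z) : Om A -> C^o).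
    by apply: (ldep_comp2 (fun x y => x - y)) => //; exact: ldep_cst.
  have l4 : ldep (z *: ((fun c => Num.conj (f c)) - (fun=> Num.conj z)) : Om A -> C^o).
    exact: (ldep_comp (fun x => z * x)).
  rewrite (bmeanB a0) ?(bmean_lin a0) ?(bmeanZ a0) ?(bmeanB a0) ?(bmean_conj a0) ?(bmean_cst a0) //.
  - by rewrite -/z subrr mulr0 addr0 mulrC normCK.
  - exact: ldep_cst.
  - exact: ldep_cst.
  - exact: ldep_lin.
move=> s _; rewrite ipn; congr bmean; apply/funext => c.
by rewrite /f0 !fctE /= opprB addrA subrK.
Qed.

End Bernoulli.

(** * Continuous complex functions *)

Section ContinuousFunctions.
Context (R : realType) (T : topologicalType).
Local Notation C := (R[i]^o).
Implicit Types f g : T -> C.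

Lemma contP f : continuous f <->
  forall x (d : R), 0 < d -> nbhs x [set y | cmod (f y - f x) < d].
Proof.
split=> [cf x d d0|h x A /nbhs_rnorm [d d0 hA]].
  by apply: (cf x [set z : C | rnorm (z - f x) < d]); apply/nbhs_rnorm; exists d.
by apply: filterS (h x d d0) => y; exact: hA.
Qed.

Lemma cont_cst (z : C) : continuous (fun _ : T => z).
Proof. exact: cst_continuous. Qed.

Lemma contD f g : continuous f -> continuous g -> continuous (fun x => f x + g x : C).
Proof. by move=> cf cg x; apply: cvgD; [exact: cf | exact: cg]. Qed.

Lemma contM f g : continuous f -> continuous g -> continuous (fun x => f x * g x : C).
Proof. by move=> cf cg x; apply: cvgM; [exact: cf | exact: cg]. Qed.

Lemma contZ (k : R[i]) f : continuous f -> continuous (k *: f).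
Proof. by move=> cf; exact: (contM (@cont_cst k) cf). Qed.

Lemma contB f g : continuous f -> continuous g -> continuous (fun x => f x - g x : C).
Proof. by move=> cf cg x; apply: cvgB; [exact: cf | exact: cg]. Qed.

Lemma contJ f : continuous f -> continuous (fun x => Num.conj (f x) : C).
Proof.
move=> /contP cf; apply/contP => x d d0; apply: filterS (cf x d d0) => y /=.
by rewrite -[in X in _ -> X](rmorphB Num.conj) /= cmod_conj.
Qed.

Lemma cont_sum (I : Type) (s : seq I) (F : I -> T -> C) :
  (forall i, continuous (F i)) -> continuous (fun x => \sum_(i <- s) F i x : C).
Proof.
move=> h; elim: s => [|a s IH].
  have -> : (fun x => \sum_(i <- [::]) F i x : C) = (fun=> 0) by apply/funext => x; rewrite big_nil.
  exact: cont_cst.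
have -> : (fun x => \sum_(i <- a :: s) F i x : C) = (fun x => F a x + \sum_(i <- s) F i x : C).
  by apply/funext => x; rewrite big_cons.
exact: (contD (h a) IH).
Qed.

End ContinuousFunctions.

(** * The minimal subshift as a compact space with a free action *)

Section MinimalSpace.
Context (G : groupType).

Record mshift := MShift {
  me : nat -> G * G;
  mX : set (Om G 'I_3);
  me_surj : forall p, exists n, me n = p;
  mX_ex : mX !=set0;
  mX_legal : forall x, mX x -> legal x;
  mX_sh : forall t x, mX x -> mX (sh t x);
  mX_closed : forall x, (forall k, exists2 y, mX y & agr me k x y) -> mX x;
  mX_min : forall y k, mX y -> exists F : seq G,
    forall x, mX x -> exists2 t, t \in F & agr me k (sh t x) y;
  mX_approx : forall j, exists (Phi : Om G 'I_3 -> Om G 'I_3) (k : nat), slide me Phi /\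
    forall c, legal_upto me k c -> exists2 x, mX x & agr me j x (Phi c)
}.

Definition xsp (M : mshift) : Type := {x | mX M x}.

HB.instance Definition _ M := gen_eqMixin (xsp M).
HB.instance Definition _ M := gen_choiceMixin (xsp M).

Section Space.
Context (M : mshift).
Local Notation X := (xsp M).
Local Notation agr := (agr (me M)).

Definition xagr k (x y : X) := agr k (sval x) (sval y).

Definition xopen : set_system X := [set U | forall x, U x -> exists k, forall y, xagr k x y -> U y].

Lemma xopenT : xopen setT. Proof. by move=> x _; exists 0%N. Qed.

Lemma xopenI : setI_closed xopen.
Proof.
move=> A B oA oB x [/oA [k hk] /oB [k' hk']]; exists (maxn k k') => y xy.
by split; [apply: hk | apply: hk']; apply: agr_le xy; [exact: leq_maxl | exact: leq_maxr].
Qed.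

Lemma xopen_bigU (I : Type) (f : I -> set X) : (forall i, xopen (f i)) -> xopen (\bigcup_i f i).
Proof. by move=> h x [i _ /h [k hk]]; exists k => y /hk; exists i. Qed.

HB.instance Definition _ := isOpenTopological.Build X xopenT xopenI xopen_bigU.

Lemma xnbhsP (x : X) (A : set X) : nbhs x A <-> exists k, forall y, xagr k x y -> A y.
Proof.
split=> [[B [oB Bx BA]]|[k hk]].
  by have [k hk] := oB x Bx; exists k => y /hk /BA.
exists [set y | xagr k x y]; split=> // y xy; exists k => z.
exact: agr_trans xy.
Qed.

Lemma xsp_inj (x y : X) : sval x = sval y -> x = y.
Proof.
case: x y => [x hx] [y hy] /= E; move: hx hy; rewrite E => hx hy.
by rewrite (Prop_irrelevance hx hy).
Qed.

Lemma xsp_limit (I : Type) (F : set_system I) (x : I -> X) : UltraFilter F ->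
  exists c : X, forall k, F [set i | xagr k c (x i)].
Proof.
move=> UF; have [c hc] := @ultra_limit G (me M) I F 'I_3 (fun i => sval (x i)) UF.
have cX : mX M c.
  by apply: mX_closed => k; have [i hi] := filter_ex (hc k); exists (sval (x i)) => //; exact: svalP.
by exists (exist _ c cX).
Qed.

Lemma xsp_compact : compact [set: X].
Proof.
rewrite compact_ultra => F UF _.
have [c hc] := @xsp_limit X F id UF; exists c; split=> // A /xnbhsP [k hk].
by apply: filterS (hc k) => y; exact: hk.
Qed.

Lemma xagr_sep (x y : X) : x <> y -> exists k, forall z, xagr k x z -> ~ xagr k y z.
Proof.
move=> xy; have [p hp] : exists p, sval x p <> sval y p.
  apply: contrapT => /forallNP h; apply/xy/xsp_inj/funext => p.
  by have := h p; case: eqP (sval x p =P sval y p) => // _ [].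
have [n hn] := me_surj M p; exists n.+1 => z h1 h2.
by apply: hp; rewrite -hn (h1 n) // (h2 n).
Qed.

Lemma xsp_hausdorff : hausdorff_space X.
Proof.
move=> x y h; apply: contrapT => /xagr_sep [k hk].
have [z [h1 h2]] := h [set z | xagr k x z] [set z | xagr k y z]
  (proj2 (xnbhsP _ _) (ex_intro _ k (fun z => id))) (proj2 (xnbhsP _ _) (ex_intro _ k (fun z => id))).
exact: hk h1 h2.
Qed.

(** The inverse turns the right action [sh] into a left action. *)
Definition xact (t : G) (x : X) : X := exist _ (sh t^-1%g (sval x)) (mX_sh t^-1%g (svalP x)).

Lemma xact_continuous : continuous_action xact.
Proof.
split=> [x|s t x|s x A /xnbhsP [k hk]].
- by apply: xsp_inj; rewrite /= invg1 sh1.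
- by apply: xsp_inj; rewrite /= shM invgM.
have [k' hk'] := sh_agr (me_surj M) 'I_3 s^-1%g k.
by apply/xnbhsP; exists k' => y xy; apply: hk; exact: hk'.
Qed.

Lemma xact_free : free_action xact.
Proof.
move=> x s s1 /(congr1 sval) /= E.
have s1' : s^-1%g <> 1%g by move=> /eqP; rewrite invg_eq1 => /eqP.
apply: (mX_legal (svalP x) (g := 1%g) s1').
by rewrite -[in RHS]E /sh /= mulg1 mul1g.
Qed.

Section Functions.
Context (R : realType).
Local Notation C := (R[i]^o).
Implicit Types f g : X -> C.

Lemma xcontP f : continuous f <->
  forall x (d : R), 0 < d -> exists k, forall y, xagr k x y -> cmod (f y - f x) < d.
Proof.
split=> [cf x d d0|h x A /nbhs_rnorm [d d0 hA]].
  have : nbhs (f x) [set z : C | rnorm (z - f x) < d] by apply/nbhs_rnorm; exists d.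
  by move=> /(cf x) /xnbhsP.
have [k hk] := h x d d0; apply/xnbhsP; exists k => y /hk; exact: hA.
Qed.

(** Pairs violating uniform continuity on growing windows would have a common ultralimit, at which
    [f] is continuous. *)
Lemma xcont_unif f : continuous f -> forall d : R, 0 < d ->
  exists k, forall x y, xagr k x y -> cmod (f x - f y) <= d.
Proof.
move=> /xcontP cf d d0; apply: contrapT => /forallNP h.
have /choice [z hz] : forall k, exists xy : X * X, xagr k xy.1 xy.2 /\ d < cmod (f xy.1 - f xy.2).
  move=> k; have /existsNP [x /existsNP [y /not_implyP [h1 /negP h2]]] := h k.
  by exists (x, y); rewrite ltNge.
have [U [UU hU]] := ultra_nat.
have [c hc] := @xsp_limit nat U (fun k => (z k).1) UU.
have d2 : 0 < d / 2 by rewrite divr_gt0.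
have [k hk] := cf c _ d2.
have [n [/= kn cn]] := filter_ex (filterI (hU k) (hc k)).
have [zn dn] := hz n.
have h1 := hk _ cn.
have h2 : cmod (f (z n).2 - f c) < d / 2.
  by apply: hk; apply: agr_trans cn (agr_le kn zn).
have := rnorm_dist (f c) (f (z n).1) (f (z n).2); rewrite (rnormB (f c)) !rnorm_cmod => h3.
by move: dn; apply/negP; rewrite -leNgt; lra.
Qed.

Lemma xcont_bounded f : continuous f -> exists2 B : R, 0 <= B & forall x, cmod (f x) <= B.
Proof.
move=> /xcontP cf; apply: contrapT => h.
have /choice [z hz] : forall k : nat, exists x, k%:R < cmod (f x).
  move=> k; apply: contrapT => /forallNP h'; apply: h; exists k%:R => // x.
  by rewrite leNgt; apply/negP/h'.
have [U [UU hU]] := ultra_nat; have [c hc] := @xsp_limit nat U z UU.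
have [k hk] := cf c _ ltr01.
have [n [/= kn cn]] := filter_ex (filterI (hU (Num.trunc (cmod (f c) + 1)).+1) (hc k)).
have h1 := hk _ cn; have h2 := hz n.
have h3 := rnormD (f (z n) - f c) (f c); rewrite subrK !rnorm_cmod in h3.
have h4 := truncnS_gt (cmod (f c) + 1).
have h5 : (Num.trunc (cmod (f c) + 1)).+1%:R <= n%:R :> R by rewrite ler_nat.
by move: (lt_le_trans h4 h5); apply/negP; rewrite -leNgt; lra.
Qed.

End Functions.
End Space.
End MinimalSpace.

Lemma cmodR (R : realType) (x : R) : cmod x%:C = `|x|.
Proof. by rewrite /cmod normc_def /= expr0n addr0 sqrtr_sqr. Qed.

(** * Ultralimits of bounded complex sequences *)

Section UltraLimits.
Context (R : realType) (U : set_system nat) (UU : UltraFilter U).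
Local Notation C := R[i].
Implicit Types (z w : nat -> C) (l : C).

Definition ulim z l := forall d : R, 0 < d -> U [set j | cmod (z j - l) <= d].

Lemma ulim_ex z (B : R) : (forall j, cmod (z j) <= B) -> exists l, ulim z l.
Proof.
move=> hB.
have cF : cauchy (fmap (z : nat -> C^o) U).
  apply/cauchyP => e e0.
  have eE : e = (complex.Re e)%:C by rewrite RRe_real // gtr0_real.
  have e0' : 0 < complex.Re e / 2 by rewrite divr_gt0 // -ltcR -eE.
  have [s hs] := disc_grid B e0'.
  have [|v _ Fv] := @ultra_seq C nat U (fun v => [set j | cmod (z j - v) <= complex.Re e / 2]) s UU.
    by apply: filterS filterT => j _; have [w ws hw] := hs _ (hB j); exists w.
  exists v; suff : U ((z : nat -> C^o) @^-1` ball (v : C^o) e) by [].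
  apply: filterS Fv => j /= hj.
  by rewrite -ball_normE /= eE distrC (rnorm_lt (z j - v : C^o)) rnorm_cmod; lra.
have := complete_filter (@scalar_complete R) (fmap_proper_filter _ (@ultra_proper _ _ UU)) cF.
move=> /cvg_ex [l hl]; exists l => d d0.
have Nl : nbhs (l : C^o) [set y : C^o | rnorm (y - l) < d] by apply/nbhs_rnorm; exists d.
have Ul : U ((z : nat -> C^o) @^-1` [set y : C^o | rnorm (y - l) < d]) := hl _ Nl.
by apply: filterS Ul => j /= /ltW.
Qed.

Lemma eq_ulim z w l : z =1 w -> ulim z l -> ulim w l.
Proof. by move=> /funext ->. Qed.

Lemma ulim_uniq z l l' : ulim z l -> ulim z l' -> l = l'.
Proof.
move=> h h'; apply/eqP; rewrite -subr_eq0; apply/eqP/cmod_eq0/eqP.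
rewrite eq_le cmod_ge0 andbT; apply/ler_addgt0Pr => d d0; rewrite add0r.
have d2 : 0 < d / 2 by rewrite divr_gt0.
have [j [/= h1 h2]] := filter_ex (filterI (h _ d2) (h' _ d2)).
have h3 := cmodD (- (z j - l)) (z j - l').
have E : - (z j - l) + (z j - l') = l - l' by ring.
by rewrite cmodN E in h3; lra.
Qed.

Lemma ulim_lip2 (h : C -> C -> C) (K : R) z w l l' : 0 <= K ->
  (forall j, cmod (h (z j) (w j) - h l l') <= K * (cmod (z j - l) + cmod (w j - l'))) ->
  ulim z l -> ulim w l' -> ulim (fun j => h (z j) (w j)) (h l l').
Proof.
move=> K0 hh hz hw d d0; have K1 : 0 < 2 * K + 1 by rewrite ltr_wpDl // mulr_ge0.
have d1 : 0 < d / (2 * K + 1) by rewrite divr_gt0.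
apply: filterS (filterI (hz _ d1) (hw _ d1)) => j [/= h1 h2].
apply: le_trans (hh j) _.
apply: le_trans (ler_wpM2l K0 (lerD h1 h2)) _.
rewrite -mulr2n -mulrnAl -mulr_natl mulrA mulrA ler_pdivrMr // mulrC ler_wpM2l ?(ltW d0) //.
by rewrite mulrC; lra.
Qed.

Lemma ulim_lin k z w l l' : ulim z l -> ulim w l' -> ulim (fun j => k * z j + w j) (k * l + l').
Proof.
apply: (@ulim_lip2 (fun a b => k * a + b) (cmod k + 1)); first by rewrite addr_ge0 ?cmod_ge0.
move=> j; have -> : k * z j + w j - (k * l + l') = k * (z j - l) + (w j - l') by ring.
rewrite (le_trans (cmodD _ _)) // cmodM mulrDr !mulrDl !mul1r.
have := mulr_ge0 (cmod_ge0 k) (cmod_ge0 (w j - l')); have := cmod_ge0 (z j - l); lra.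
Qed.

Lemma ulim_cst l : ulim (fun=> l) l.
Proof. by move=> d d0; apply: filterS filterT => j _ /=; rewrite subrr cmod0 ltW. Qed.

Lemma ulim_sqr z l (B : R) : (forall j, cmod (z j) <= B) -> ulim z l ->
  ulim (fun j => `|z j| ^+ 2) (`|l| ^+ 2).
Proof.
move=> hB hz; have B0 : 0 <= B := le_trans (cmod_ge0 _) (hB 0%N).
have := @ulim_lip2 (fun a b => `|a| ^+ 2) (B + cmod l) z z l l; apply => //.
  by rewrite addr_ge0 ?cmod_ge0.
move=> j; have -> : `|z j| ^+ 2 - `|l| ^+ 2 = (`|z j| - `|l|) * (`|z j| + `|l|) by ring.
rewrite cmodM mulrC; apply: ler_pM; rewrite ?cmod_ge0 //.
  by rewrite (le_trans (cmodD _ _)) // !cmodE !cmodC ?cmod_ge0 // lerD2r.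
have := @rnorm_diff R C^o (z j) l; rewrite !rnorm_cmod !cmodE -rmorphB /=.
rewrite cmodR => h; have := cmod_ge0 (z j - l); lra.
Qed.

Lemma ulim_ge0 z l : (forall j, 0 <= z j) -> ulim z l -> 0 <= l.
Proof.
move=> z0 hz; have zE j : z j = (complex.Re (z j))%:C by rewrite RRe_real // ger0_real.
rewrite lecE /=; apply/andP; split.
  rewrite -normr_eq0 eq_le normr_ge0 andbT; apply/ler_addgt0Pr => d d0; rewrite add0r.
  have [j /= hj] := filter_ex (hz d d0); have := Im_le_cmod (z j - l).
  by rewrite ImD ImN {1}zE /= add0r normrN; move=> /le_trans; apply.
apply/ler_addgt0Pl => d d0.
have [j /= hj] := filter_ex (hz d d0); have := Re_le_cmod (z j - l).
rewrite ReD ReN ler_norml => /andP[_ h].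
have : 0 <= complex.Re (z j) by rewrite -ler0c -zE.
lra.
Qed.

Hypothesis hU : forall N, U [set n | (N <= n)%N].

Lemma ulim_close z w l : (forall d : R, 0 < d -> exists N, forall j, (N <= j)%N -> cmod (z j - w j) <= d) ->
  ulim z l -> ulim w l.
Proof.
move=> h hz d d0; have d2 : 0 < d / 2 by rewrite divr_gt0.
have [N hN] := h _ d2; apply: filterS (filterI (hU N) (hz _ d2)) => j [/= /hN h1 h2].
have h3 := cmodD (- (z j - w j)) (z j - l).
have E : - (z j - w j) + (z j - l) = w j - l by ring.
by rewrite cmodN E in h3; lra.
Qed.

End UltraLimits.

(** * The invariant mean and its Poincare inequality *)

Section InvariantMean.
Context (R : realType) (G : groupType) (M : mshift G).
Local Notation C := R[i].
Local Notation X := (xsp M).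
Local Notation Om := (Om G).
Local Notation agr := (agr (me M)).
Local Notation slide := (slide (me M)).
Notation near_X j c := (exists2 x, mX M x & agr j x c).

Lemma bmean_sum (A : finType) (a0 : A) (I : Type) (s : seq I) (F : I -> Om A -> C^o) :
  (forall i, ldep (F i)) -> bmean (fun c => \sum_(i <- s) F i c) = \sum_(i <- s) bmean (F i) /\
  ldep (fun c => \sum_(i <- s) F i c : C^o).
Proof.
move=> h; elim: s => [|a s [IH1 IH2]].
  have -> : (fun c => \sum_(i <- [::]) F i c : C^o) = (fun=> 0) by apply/funext => c; rewrite big_nil.
  by rewrite big_nil; split; [rewrite (bmean_cst G a0) | exact: ldep_cst].
have -> : (fun c => \sum_(i <- a :: s) F i c : C^o) = F a + (fun c => \sum_(i <- s) F i c : C^o).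
  by apply/funext => c; rewrite big_cons.
split; first by rewrite (bmeanD a0) // big_cons IH1.
exact: (ldep_comp2 (fun x y => x + y)).
Qed.

Definition bad j c : C^o := (~~ `[<near_X j c>])%:R.

Lemma bad_local j : local (me M) (bad j).
Proof.
exists j => c c' cc; rewrite /bad; congr (~~ _)%:R; apply/asboolP/asboolP => -[x Xx xc]; exists x => //.
  exact: agr_trans xc cc.
exact: agr_trans xc (agrC cc).
Qed.

(** Greedily colour independent uniform labels with [K.+1] values and apply [Phi]. The outcome is
    bad only if one of [k] edges has equal labels at its ends, which has probability [1 / K.+1] for
    each edge of nontrivial index. The alphabet depends on [j] and is part of the witness. *)
Lemma theta_ex j : exists Kt : {K : nat & Om 'I_K.+1 -> Om 'I_3},
  slide (projT2 Kt) /\ bmean (bad j \o projT2 Kt) <= (j.+1%:R^-1).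
Proof.
have [Phi [k [sPhi hPhi]]] := mX_approx M j.
(* Chosen so that [k / K.+1 <= 1 / j.+1]. *)
pose K := (k * j.+1)%N; pose be := fun c : Om 'I_K.+1 => greedy_code (fun g => c (1%g, g)).
have sbe : slide be := greedy_code_slide (me_surj M) _.
exists (existT _ K (Phi \o be)) => /=; split; first exact: slide_comp.
pose P i := (1%g, (me M i).2) : G * G; pose Q i := (1%g, ((me M i).2 * (me M i).1)%g) : G * G.
pose E i := fun c : Om 'I_K.+1 => if (me M i).1 == 1%g then 0 else (c (P i) == c (Q i))%:R : C^o.
have lE i : ldep (E i).
  by exists [:: P i; Q i] => c c' cc; rewrite /E !cc ?inE ?eqxx ?orbT.
have [S1 S2] := bmean_sum (ord0 : 'I_K.+1) (iota 0 k) lE.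
apply: le_trans (_ : bmean (fun c => \sum_(i <- iota 0 k) E i c) <= _).
  apply: (bmean_le (ord0 : 'I_K.+1)) => //.
    by apply: local_ldep; apply: slide_local (bad_local j); exact: slide_comp.
  have E0 i c : 0 <= E i c by rewrite /E; case: ifP => // _; exact: ler0n.
  move=> c; rewrite /bad /=; have [h|h] := boolP `[<near_X j (Phi (be c))>].
    by apply: sumr_ge0 => i _.
  have [i ik Ei] : exists2 i, i \in iota 0 k & E i c = 1.
    apply: contrapT => hE; move/asboolP: h; apply; apply: hPhi => i ik i1.
    rewrite [me M i]surjective_pairing; apply: greedy_code_edge => hc; apply: hE.
    exists i; first by rewrite mem_iota.
    by rewrite /E /P /Q hc eqxx; case: eqP => // h1; case: i1.
  by rewrite (big_rem i) //= Ei lerDl sumr_ge0.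
rewrite S1; have Ebound i : bmean (E i) <= K.+1%:R^-1.
  rewrite /E; case: eqP => [_|i1]; first by rewrite (bmean_cst G (ord0 : 'I_K.+1)) invr_ge0 ler0n.
  rewrite (bmean_coincide R (ord0 : 'I_K.+1)) ?card_ord //.
  apply/eqP => -[]; rewrite -{1}[(me M i).2]mulg1 => /mulgI h; exact: i1.
apply: le_trans (ler_sum _ (fun i _ => Ebound i)) _.
rewrite big_const_seq count_predT size_iota iter_addr addr0 -[X in X <= _]mulr_natl.
have K1 : (0 : C) < K.+1%:R by rewrite ltr0n.
rewrite ler_pdivrMr // ler_pdivlMl ?ltr0n // -natrM ler_nat mulnC.
by rewrite -/K.
Qed.

Definition Kt j := sval (cid (theta_ex j)).
Definition theta j : Om 'I_(projT1 (Kt j)).+1 -> Om 'I_3 := projT2 (Kt j).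

Lemma theta_slide j : slide (@theta j).
Proof. by rewrite /theta /Kt; case: cid => Kt [] /=. Qed.

Lemma theta_bad j : bmean (bad j \o @theta j) <= (j.+1%:R^-1).
Proof. by rewrite /theta /Kt; case: cid => Kt [] /=. Qed.

Lemma xsp_ex : exists x : X, True.
Proof. by have [x Xx] := mX_ex M; exists (exist _ x Xx). Qed.

Definition x0 : X := sval (cid xsp_ex).

(** Only the first [j] coordinates of the chosen point are controlled, and the choice is not
    equivariant. Away from [X] the default [x0] is arbitrary; this happens on the bad set, whose
    mean tends to 0 along [theta]. *)
Definition rho j (c : Om 'I_3) : X := xget x0 [set x : X | agr j (sval x) c].

Lemma rho_near j c : near_X j c -> agr j (sval (rho j c)) c.
Proof.
move=> [x Xx xc]; rewrite /rho; case: xgetP => [y _ //|/(_ (exist _ x Xx))].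
by case.
Qed.

Lemma rho_agr j c c' : agr j c c' -> rho j c = rho j c'.
Proof.
move=> cc; rewrite /rho; congr (xget _ _); apply/seteqP; split=> x /= h.
  exact: agr_trans h cc.
exact: agr_trans h (agrC cc).
Qed.

Definition lift j (f : X -> C^o) : Om 'I_(projT1 (Kt j)).+1 -> C^o := f \o rho j \o @theta j.

Lemma lift_ldep j f : ldep (@lift j f).
Proof.
apply: local_ldep; apply: slide_local (theta_slide j) _.
by exists j => c c' cc; rewrite /= (rho_agr cc).
Qed.

Definition jmean j f : C := bmean (@lift j f).

Let z0 j : 'I_(projT1 (Kt j)).+1 := ord0.

Lemma jmean_bound j f (B : R) : (forall x, cmod (f x) <= B) -> cmod (jmean j f) <= B.
Proof.
move=> hB; have B0 : 0 <= B := le_trans (cmod_ge0 _) (hB x0).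
rewrite -lecR -cmodE; apply: le_trans (bmean_norm (z0 j) (lift_ldep j f)) _.
rewrite -[B%:C](bmean_cst G (z0 j)); apply: (bmean_le (z0 j)).
- exact: (ldep_comp (fun x => `|x|) (lift_ldep j f)).
- exact: ldep_cst.
- by move=> c; rewrite cmodE lecR; exact: hB.
Qed.

(** The lift is equivariant only asymptotically, in mean. When neither [c] nor its shift is bad, the
    two points of [X] agree on a large window and uniform continuity applies; otherwise the
    difference is at most [2 B], on a set of small mean. *)
Lemma lift_shift f t (d : R) : continuous f -> 0 < d -> exists N, forall j, (N <= j)%N ->
  bmean (fun c => `|@lift j f (sh t c) - @lift j (f \o xact t^-1%g) c|) <= d%:C.
Proof.
move=> cf d0; have [B B0 hB] := xcont_bounded cf.
have d2 : 0 < d / 2 by rewrite divr_gt0.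
have [k hk] := xcont_unif cf d2; have [k' hk'] := sh_agr (me_surj M) 'I_3 t k.
(* Two bad events, each of mean at most [1 / j.+1], cost [4 B / j.+1]; the added 1 keeps the
   denominator positive. *)
have d3 : 0 < d / 2 / (4 * B + 1) by rewrite divr_gt0 // ltr_wpDl // mulr_ge0.
have [N hN] := small_half d3; exists (maxn N (maxn k k')) => j.
rewrite !geq_max => /and3P[Nj kj kj'].
pose b c : C^o := bad j (@theta j c).
have lb : ldep b by apply: local_ldep; exact: slide_local (theta_slide j) (bad_local j).
pose bound : Om 'I_(projT1 (Kt j)).+1 -> C^o := (2 * B)%:C *: (b + (b \o sh t)) + (fun=> (d / 2)%:C).
have lbs : ldep (b + (b \o sh t)).
  exact: (ldep_comp2 (fun x y => x + y) lb (ldep_sh t lb)).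
apply: le_trans (_ : bmean bound <= _).
  apply: (bmean_le (z0 j)).
  - exact: (ldep_comp2 (fun x y => `|x - y|) (ldep_sh t (lift_ldep j f)) (lift_ldep j (f \o xact t^-1))).
  - by apply: ldep_lin => //; exact: ldep_cst.
  move=> c; rewrite /bound !fctE /b /bad cmodE.
  have triv : cmod (lift f (sh t c) - lift (f \o xact t^-1) c) <= 2 * B.
    rewrite (le_trans (cmodD _ _)) // cmodN.
    have h1 := hB (rho j (theta (sh t c))); have h2 := hB (xact t^-1 (rho j (theta c))).
    by rewrite /lift /=; lra.
  have bad1 (p q : bool) : (~~ p) || (~~ q) ->
      cmod (lift f (sh t c) - lift (f \o xact t^-1) c) <= 2 * B * ((~~ p)%:R + (~~ q)%:R) + d / 2.
    move=> pq; apply: le_trans triv _.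
    have : 1 <= (~~ p)%:R + (~~ q)%:R :> R by move: pq; case: p; case: q => //= _; lra.
    by have B2 : 0 <= 2 * B by [rewrite mulr_ge0 |]; move=> /(ler_wpM2l B2); lra.
  have cast (p q : bool) : (2 * B)%:C *: ((~~ p)%:R + (~~ q)%:R : C^o) + (d / 2)%:C =
      (2 * B * ((~~ p)%:R + (~~ q)%:R) + d / 2)%:C :> C.
    by rewrite -[_ *: _]/(_ * _) [RHS]rmorphD [X in _ = X + _]rmorphM rmorphD !rmorph_nat.
  rewrite /= cast lecR.
  have [g1|] := boolP `[<near_X j (theta c)>]; last by move=> h; apply: (bad1 false); rewrite ?h.
  have [g2|] := boolP `[<near_X j (theta (sh t c))>]; last by move=> h; apply: (bad1 true false).
  rewrite /= addr0 mulr0 add0r /lift /=; apply: hk.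
  move/asboolP/rho_near: g1 => g1; move/asboolP/rho_near: g2 => g2.
  rewrite /xagr /= invgK; apply: agr_trans (agr_le kj g2) _.
  rewrite (theta_slide j).1; apply/agrC/hk'; exact: agr_le kj' g1.
rewrite /bound (bmean_lin (z0 j)) ?(bmeanD (z0 j)) ?(bmean_cst G (z0 j)) //; try exact: ldep_cst; try exact: ldep_sh.
rewrite (bmean_sh (z0 j)) //.
have hb : bmean b <= ((j.+1%:R^-1 : R)%:C).
  by rewrite fmorphV /= rmorph_nat; exact: theta_bad.
apply: le_trans (_ : (2 * B)%:C * ((j.+1%:R^-1 : R)%:C + (j.+1%:R^-1 : R)%:C) + (d / 2)%:C <= _).
  by rewrite lerD2r ler_wpM2l ?lerD // lecR mulr_ge0.
rewrite -rmorphD -rmorphM -rmorphD lecR.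
have h1 : (j.+1%:R^-1 : R) <= N.+1%:R^-1 by rewrite lef_pV2 ?posrE ?ltr0Sn // ler_nat ltnS.
have h2 : (j.+1%:R^-1 : R) * (4 * B + 1) <= d / 2.
  rewrite -ler_pdivlMr; first exact: le_trans h1 (ltW hN).
  by rewrite ltr_wpDl ?mulr_ge0.
have h3 : 0 <= (j.+1%:R^-1 : R) by rewrite invr_ge0.
by move: h2 h3; move: (j.+1%:R^-1 : R) => q; nra.
Qed.

Definition U0 : set_system nat := sval (cid ultra_nat).
Lemma U0_ultra : UltraFilter U0. Proof. by rewrite /U0; case: cid => U [] /=. Qed.
Lemma U0_inf N : U0 [set n | (N <= n)%N]. Proof. by rewrite /U0; case: cid => U [] /=. Qed.

Definition mean (f : X -> C^o) : C := xget 0 [set l : C^o | ulim U0 (fun j => jmean j f) l].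

Lemma meanP f : continuous f -> ulim U0 (fun j => jmean j f) (mean f).
Proof.
move=> /xcont_bounded [B _ hB].
have [l hl] := ulim_ex U0_ultra (fun j => jmean_bound j hB).
by rewrite /mean; case: xgetP => [z _ //|/(_ l)]; case.
Qed.

Let uniq := @ulim_uniq R U0 U0_ultra.

Lemma mean_lin k (f g : X -> C^o) : continuous f -> continuous g -> mean (k *: f + g) = k * mean f + mean g.
Proof.
move=> cf cg; have cfg : continuous (k *: f + g) := contD (@contZ R X k f cf) cg.
apply: uniq (meanP cfg) _; have := ulim_lin U0_ultra k (meanP cf) (meanP cg).
have E j : k * jmean j f + jmean j g = jmean j (k *: f + g).
  by rewrite /jmean -(bmean_lin (z0 j)) //; exact: lift_ldep.
by under eq_fun do rewrite E.
Qed.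

Lemma mean_cst (z : C) : mean (fun=> z) = z.
Proof.
apply: uniq (meanP (@cont_cst R X z)) _; have := ulim_cst U0_ultra z.
have E j : z = jmean j (fun=> z) := esym (bmean_cst G (z0 j) z).
by apply: eq_ulim => j; exact: E.
Qed.

Lemma mean_ge0 (f : X -> C^o) : continuous f -> (forall x, 0 <= f x) -> 0 <= mean f.
Proof.
move=> cf f0; apply: (ulim_ge0 U0_ultra) (meanP cf) => j.
by apply: (bmean_ge0 (z0 j)) => [|c]; [exact: lift_ldep | exact: f0].
Qed.

Lemma xact_cont (f : X -> C^o) t : continuous f -> continuous (f \o xact t).
Proof. by move=> cf x; have [_ _ ca] := xact_continuous M; apply: continuous_comp; [exact: ca | exact: cf]. Qed.

Lemma mean_inv (f : X -> C^o) t : continuous f -> mean (f \o xact t) = mean f.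
Proof.
move=> cf; apply: (uniq (meanP (@xact_cont f t cf))).
apply: (ulim_close U0_ultra U0_inf) (meanP cf) => d d0.
have [N hN] := lift_shift t^-1%g cf d0; exists N => j /hN h.
rewrite -lecR -cmodE; apply: le_trans h.
have lf := lift_ldep j f; have lt := lift_ldep j (f \o xact t).
have -> : jmean j f = bmean (lift f \o sh t^-1%g) := esym (bmean_sh (z0 j) t^-1%g lf).
have ls := ldep_sh t^-1%g lf.
rewrite invgK /jmean -(bmeanB (z0 j)) //; apply: (bmean_norm (z0 j)).
exact: (ldep_comp2 (fun x y => x - y) ls lt).
Qed.

(** The ultralimit of the Bernoulli inequalities for the lifts of [f]. By [lift_shift], shifting a
    lift may be replaced in the limit by lifting the translate. *)
Theorem mean_poincare : infinite_set [set: G] -> property_T R G ->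
  exists (Q : seq G) (eps : R), 0 < eps /\ forall f : X -> C^o, continuous f ->
    (eps ^+ 2)%:C * (mean (fun x => `|f x| ^+ 2) - `|mean f| ^+ 2) <=
      \sum_(s <- Q) mean (fun x => `|f (xact s^-1%g x) - f x| ^+ 2).
Proof.
move=> Ginf GT; have [Q [eps [eps0 hQ]]] := bernoulli_poincare Ginf GT.
exists Q, eps; split=> // f cf; have [B B0 hB] := xcont_bounded cf.
have cn (g : X -> C^o) : continuous g -> continuous (fun x => `|g x| ^+ 2 : C^o).
  by move=> cg; under eq_fun do rewrite normCK; exact: contM cg (contJ cg).
have cs s : continuous (fun x => f (xact s^-1%g x) - f x : C^o).
  exact: (contB (@xact_cont f s^-1%g cf) cf).
pose D s j := bmean (fun c => `|@lift j f (sh s c) - lift f c| ^+ 2).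
have uD s : ulim U0 (D s) (mean (fun x => `|f (xact s^-1%g x) - f x| ^+ 2)).
  apply: (ulim_close U0_ultra U0_inf) (meanP (cn _ (cs s))) => d d0.
  (* From [| |a - w|^2 - |b - w|^2 | <= 4 B |a - b|] for numbers of modulus at most [B]. *)
  have B1 : 0 < 4 * B + 1 by rewrite ltr_wpDl // mulr_ge0.
  have [N hN] := lift_shift s cf (divr_gt0 d0 B1); exists N => j /hN h.
  have lf := lift_ldep j f; have lf' := lift_ldep j (f \o xact s^-1); have ls := ldep_sh s lf.
  have l1 : ldep (fun c => `|@lift j f (sh s c) - lift f c| ^+ 2 : C^o).
    exact: (ldep_comp2 (fun x y => `|x - y| ^+ 2) ls lf).
  have l2 := lift_ldep j (fun x => `|f (xact s^-1%g x) - f x| ^+ 2).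
  have l3 : ldep (fun c => `|@lift j f (sh s c) - @lift j (f \o xact s^-1) c| : C^o).
    exact: (ldep_comp2 (fun x y => `|x - y|) ls lf').
  have := ler_wpM2l (_ : 0 <= (4 * B + 1)%:C) h; rewrite ler0c (ltW B1) => /(_ isT).
  rewrite -rmorphM mulrCA divff ?gt_eqF // mulr1 -lecR -cmodE => /(le_trans _); apply.
  rewrite /D /jmean -(bmeanB (z0 j)) //; apply: le_trans (bmean_norm (z0 j) _) _.
    exact: (ldep_comp2 (fun x y => x - y) l2 l1).
  rewrite -(bmeanZ (z0 j)) //; apply: (bmean_le (z0 j)).
  - exact: (ldep_comp (fun x => `|x|) (ldep_comp2 (fun x y => x - y) l2 l1)).
  - exact: (ldep_comp (fun x => (4 * B + 1)%:C * x) l3).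
  move=> c; rewrite !fctE /lift /=.
  set a := f (xact s^-1 _); set b := f (rho j (theta (sh s c))); set w := f (rho j (theta c)).
  have ha : cmod a <= B by exact: hB.
  have hb : cmod b <= B by exact: hB.
  have hw : cmod w <= B by exact: hB.
  rewrite -[_ *: _]/(_ * _) (distrC b a).
  rewrite !(cmodE (a - w)) (cmodE (b - w)) (cmodE (a - b)) -!rmorphXn -rmorphB -rmorphM cmodE lecR.
  rewrite cmodR subr_sqr normrM mulrC.
  have r1 := @rnorm_diff R C^o (a - w) (b - w).
  rewrite opprB addrA subrK !rnorm_cmod in r1.
  apply: ler_pM; rewrite ?normr_ge0 //.
  have n1 := cmodD a (- w); have n2 := cmodD b (- w); rewrite cmodN in n1 n2.
  by rewrite ger0_norm ?addr_ge0 ?cmod_ge0 //; lra.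
have uS : ulim U0 (fun j => \sum_(s <- Q) D s j) (\sum_(s <- Q) mean (fun x => `|f (xact s^-1%g x) - f x| ^+ 2)).
  elim: Q {hQ} => [|s Q IH].
    by rewrite big_nil; under [X in ulim _ X _]eq_fun do rewrite big_nil; exact: (ulim_cst U0_ultra).
  rewrite big_cons; under [X in ulim _ X _]eq_fun do rewrite big_cons.
  have := ulim_lin U0_ultra 1 (uD s) IH; rewrite mul1r.
  by under [X in ulim _ X _ -> _]eq_fun do rewrite mul1r.
have u2 := meanP (cn f cf).
have u3 := ulim_sqr U0_ultra (fun j => jmean_bound j hB) (meanP cf).
have u4 := ulim_lin U0_ultra (-1) u3 u2.
have u5 := ulim_lin U0_ultra (- (eps ^+ 2)%:C) u4 uS.
rewrite -subr_ge0; have := ulim_ge0 U0_ultra _ u5.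
rewrite [X in _ -> 0 <= X](_ : _ = - (eps ^+ 2)%:C * (-1 * `|mean f| ^+ 2 + mean (fun x => `|f x| ^+ 2)) +
  \sum_(s <- Q) mean (fun x => `|f (xact s^-1 x) - f x| ^+ 2)); last by ring.
apply=> j; have := hQ _ (z0 j) _ (lift_ldep j f); rewrite -subr_ge0 /D /jmean.
move=> h; apply: le_trans h _; rewrite le_eqVlt; apply/orP; left; apply/eqP.
by rewrite -[bmean (lift (fun x => `|f x| ^+ 2))]/(bmean (fun c => `|lift f c| ^+ 2)); ring.
Qed.

End InvariantMean.

Local Notation conv := Defs.conv.

Lemma fsumE (T : choiceType) (V : nmodType) (s : seq T) (F : T -> V) :
  uniq s -> (forall t, t \notin s -> F t = 0) -> \sum_(t \in [set: T]) F t = \sum_(t <- s) F t.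
Proof.
move=> us h; rewrite (@fsbigE _ _ _ _ _ s) // => [|t _]; last exact: h.
by apply: eq_bigl => t; rewrite in_setT.
Qed.

(** * The convolution algebra and its monomials *)

Section CcAlgebra.
Context (R : realType) (G : groupType) (X : topologicalType) (act : G -> X -> X).
Hypothesis hact : continuous_action act.
Local Notation C := (R[i]^o).
Local Notation Cc := (@Cc R G X).
Implicit Types (a b : G -> X -> C) (f g : X -> C).

Lemma act_cont s f : continuous f -> continuous (f \o act s).
Proof. by move=> cf x; case: hact => _ _ ca; apply: continuous_comp; [exact: ca | exact: cf]. Qed.

Lemma Cc_supp a : Cc a -> exists s, uniq s /\ forall t, t \notin s -> a t = 0.
Proof.
move=> [_ /finite_seqP [s hs]]; exists (undup s); split=> [|t]; first exact: undup_uniq.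
rewrite mem_undup => ts; apply: contrapT => h.
have : [set` s] t by rewrite -hs.
by move=> /= ts'; rewrite ts' in ts.
Qed.

Lemma Cc_intro a (s : seq G) : (forall t, continuous (a t)) -> (forall t, t \notin s -> a t = 0) -> Cc a.
Proof.
move=> ca h; split=> //; apply: (sub_finite_set _ (finite_seq s)) => t /= at0.
by apply: contraT => /h /at0.
Qed.

Lemma Cc_submod : submod Cc.
Proof.
split=> [|k a b Ca Cb].
  by apply: (@Cc_intro _ [::]) => // t; exact: (@cont_cst R X 0).
have [s [_ hs]] := Cc_supp Ca; have [r [_ hr]] := Cc_supp Cb.
apply: (@Cc_intro _ (s ++ r)) => t.
  exact: (@contD R X (k *: a t) (b t) (@contZ R X k (a t) (Ca.1 t)) (Cb.1 t)).
rewrite mem_cat negb_or => /andP[/hs h1 /hr h2].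
by rewrite -[LHS]/(k *: a t + b t) h1 h2 scaler0 addr0.
Qed.

Lemma convE a b (s : seq G) t x : uniq s -> (forall t, t \notin s -> a t = 0) ->
  conv act a b t x = \sum_(r <- s) a r x * b (r^-1 * t)%g (act r^-1%g x).
Proof. by move=> us hs; apply: fsumE => // r /hs ->; rewrite mul0r. Qed.

Lemma Cc_conv a b : Cc a -> Cc b -> Cc (conv act a b).
Proof.
move=> Ca Cb; have [s [us hs]] := Cc_supp Ca; have [r [_ hr]] := Cc_supp Cb.
apply: (@Cc_intro _ [seq (x * y)%g | x <- s, y <- r]) => t.
  have -> : conv act a b t = fun x => \sum_(p <- s) a p x * b (p^-1 * t)%g (act p^-1%g x).
    by apply/funext => x; exact: convE.
  apply: cont_sum => p.
  exact: (@contM R X (a p) _ (Ca.1 p) (@act_cont p^-1%g (b (p^-1 * t)%g) (Cb.1 _))).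
move=> ht; apply/funext => x; rewrite (convE _ _ _ us hs) big_seq big1 // => p ps.
rewrite (hr (p^-1 * t)%g) ?mulr0 //; apply: contra ht => h.
by apply/allpairsP; exists (p, (p^-1 * t)%g); rewrite /= mulVKg.
Qed.

Lemma Cc_adj a : Cc a -> Cc (ccadj act a).
Proof.
move=> Ca; have [s [_ hs]] := Cc_supp Ca; apply: (@Cc_intro _ [seq t^-1%g | t <- s]) => t.
  by apply: (@contJ R X (fun x => a t^-1%g (act t^-1%g x))); exact: (@act_cont t^-1%g (a t^-1%g) (Ca.1 _)).
move=> ht; apply/funext => x; rewrite /ccadj hs ?rmorph0 //.
by apply: contra ht => h; rewrite -[t]invgK; exact: map_f.
Qed.

Definition mon s f : G -> X -> C := fun t => if t == s then f else 0.

Lemma Cc_mon s f : continuous f -> Cc (mon s f).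
Proof.
move=> cf; apply: (@Cc_intro _ [:: s]) => t; rewrite /mon.
  by case: eqP => [_ //|_]; exact: (@cont_cst R X 0).
by rewrite inE => /negbTE ->.
Qed.

Lemma conv_mon s f b : conv act (mon s f) b = fun t x => f x * b (s^-1 * t)%g (act s^-1%g x).
Proof.
apply/funext => t; apply/funext => x; rewrite (@convE _ _ [:: s]) //.
  by rewrite big_seq1 /mon eqxx.
by move=> r; rewrite inE /mon => /negbTE ->.
Qed.

Lemma conv_mon_mon s t f g : conv act (mon s f) (mon t g) = mon (s * t)%g (fun x => f x * g (act s^-1%g x)).
Proof.
rewrite conv_mon; apply/funext => r; apply/funext => x; rewrite /mon.
have -> : (s^-1 * r == t)%g = (r == (s * t)%g) by apply/eqP/eqP => [<-|->]; rewrite ?mulVKg ?mulKg.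
by case: eqP => // _; rewrite mulr0.
Qed.

Lemma ccadj_mon s f : ccadj act (mon s f) = mon s^-1%g (fun x => Num.conj (f (act s x))).
Proof.
apply/funext => t; apply/funext => x; rewrite /ccadj /mon.
have -> : (t^-1 == s)%g = (t == s^-1)%g by apply/eqP/eqP => [<-|->]; rewrite ?invgK.
by case: eqP => [->|_]; rewrite ?invgK ?rmorph0.
Qed.

End CcAlgebra.

(** * Covariant representations over an equivariant map from [Y] to [X] *)

Section Covariant.
Context (R : realType) (G : groupType) (X : topologicalType) (act : G -> X -> X).
Hypothesis hact : continuous_action act.
Local Notation C := (R[i]^o).
Local Notation Cc := (@Cc R G X).
Context (Y : Type) (tau : G -> Y -> Y) (pr : Y -> X).
Hypothesis tau1 : forall y, tau 1%g y = y.
Hypothesis tauM : forall s t y, tau (s * t)%g y = tau s (tau t y).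
Hypothesis prE : forall s y, pr (tau s y) = act s (pr y).
Implicit Types (a b : G -> X -> C) (f : X -> C) (xi zeta : Y -> C).

Definition rep a xi : Y -> C := fun y => \sum_(s \in [set: G]) a s (pr y) * xi (tau s^-1%g y).

Lemma repE a xi (s : seq G) y : uniq s -> (forall t, t \notin s -> a t = 0) ->
  rep a xi y = \sum_(r <- s) a r (pr y) * xi (tau r^-1%g y).
Proof. by move=> us hs; apply: fsumE => // r /hs ->; rewrite mul0r. Qed.

Lemma rep_mon s f xi y : rep (mon s f) xi y = f (pr y) * xi (tau s^-1%g y).
Proof.
rewrite (@repE _ _ [:: s]) //; first by rewrite big_seq1 /mon eqxx.
by move=> r; rewrite inE /mon => /negbTE ->.
Qed.

Lemma rep_linl k a b xi : Cc a -> Cc b -> rep (k *: a + b) xi = k *: rep a xi + rep b xi.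
Proof.
move=> Ca Cb; have [s [_ hs]] := Cc_supp Ca; have [r [_ hr]] := Cc_supp Cb.
apply/funext => y; pose w := undup (s ++ r); have uw : uniq w := undup_uniq _.
have hw t : t \notin w -> a t = 0 /\ b t = 0.
  by rewrite mem_undup mem_cat negb_or => /andP[/hs -> /hr ->].
rewrite !fctE (repE _ _ uw (fun t h => (hw t h).1)) (repE _ _ uw (fun t h => (hw t h).2)).
rewrite (@repE _ _ w) // => [|t /hw [h1 h2]]; last by rewrite -[LHS]/(k *: a t + b t) h1 h2 scaler0 addr0.
rewrite scaler_sumr -big_split; apply: eq_bigr => t _.
by rewrite !fctE mulrDl -scalerAl.
Qed.

Lemma rep_linr k a xi zeta : Cc a -> rep a (k *: xi + zeta) = k *: rep a xi + rep a zeta.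
Proof.
move=> Ca; have [s [us hs]] := Cc_supp Ca; apply/funext => y.
rewrite !fctE !(repE _ _ us hs) scaler_sumr -big_split; apply: eq_bigr => t _.
by rewrite mulrDr -scalerAr.
Qed.

Lemma rep_conv a b xi : Cc a -> Cc b -> rep (conv act a b) xi = rep a (rep b xi).
Proof.
move=> Ca Cb; have [s [us hs]] := Cc_supp Ca; have [r [ur hr]] := Cc_supp Cb.
apply/funext => y; pose w := undup [seq (p * q)%g | p <- s, q <- r].
rewrite (@repE _ _ w) ?undup_uniq // => [|t]; last first.
  rewrite mem_undup => ht; apply/funext => x; rewrite (convE _ _ _ _ us hs) big_seq big1 // => p ps.
  rewrite (hr (p^-1 * t)%g) ?mulr0 //; apply: contra ht => h.
  by apply/allpairsP; exists (p, (p^-1 * t)%g); rewrite /= mulVKg.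
rewrite (repE _ _ us hs).
under eq_bigr do rewrite (convE _ _ _ _ us hs) mulr_suml.
rewrite exchange_big; apply: eq_big_seq => p ps.
have -> : rep b xi (tau p^-1%g y) = \sum_(t <- w) b (p^-1 * t)%g (act p^-1%g (pr y)) * xi (tau t^-1%g y).
  rewrite -fsumE ?undup_uniq // => [|t]; last first.
    rewrite mem_undup => ht; rewrite (hr (p^-1 * t)%g) ?mul0r //; apply: contra ht => h.
    by apply/allpairsP; exists (p, (p^-1 * t)%g); rewrite /= mulVKg.
  rewrite (reindex_fsbigT (fun t => (p * t)%g)); last first.
    by exists (fun t => (p^-1 * t)%g) => t; rewrite ?mulKg ?mulVKg.
  by apply: eq_fsbigr => t _; rewrite /rep /= prE mulKg invgM tauM.
by rewrite mulr_sumr; apply: eq_bigr => t _; rewrite mulrA.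
Qed.

Context (D : set (Y -> C)) (ip : (Y -> C) -> (Y -> C) -> R[i]).
Hypothesis D_submod : submod D.
Hypothesis D_tau : forall s xi, D xi -> D (xi \o tau s).
Hypothesis D_mul : forall f xi, continuous f -> D xi -> D (fun y => f (pr y) * xi y).
Hypothesis ip_lin : forall k u v w, D u -> D v -> D w -> ip (k *: u + v) w = k * ip u w + ip v w.
Hypothesis ip_conj : forall u v, D u -> D v -> ip v u = Num.conj (ip u v).
Hypothesis ip_ge0 : forall u, D u -> 0 <= ip u u.
Hypothesis ip_tau : forall s u v, D u -> D v -> ip (u \o tau s) (v \o tau s) = ip u v.
Hypothesis ip_mul : forall f u v, continuous f -> D u -> D v ->
  ip (fun y => f (pr y) * u y) v = ip u (fun y => Num.conj (f (pr y)) * v y).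
Hypothesis ip_bound : forall f u (B : R), continuous f -> D u -> (forall x, cmod (f x) <= B) ->
  ip (fun y => f (pr y) * u y) (fun y => f (pr y) * u y) <= (B ^+ 2)%:C * ip u u.
Hypothesis f_bound : forall f, continuous f -> exists2 B : R, 0 <= B & forall x, cmod (f x) <= B.

(** One construction serves two representations: the Koopman one, with [Y = X] and the mean, and the
    regular one, with [Y = G * X] and finite sums. The field [crho_closed] makes norm limits of
    represented operators available, which is how the compact operators are found. *)
Record covalg := CovAlg {
  ch : hilbertSpace R;
  ci : (Y -> C) -> ch;
  ca : cstarAlgebra R;
  crho : ca -> ch -> ch;
  ciota : (G -> X -> C) -> ca;
  ci_lin : lin_on D ci;
  ci_inner : forall u v, D u -> D v -> inner ch (ci u) (ci v) = ip u v;
  ci_dense : forall x (d : R), 0 < d -> exists2 v, D v & rnorm (x - ci v) < d;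
  crho_iso : isometric_star_rep crho;
  crho_closed : forall T : ch -> ch, (forall d : R, 0 < d -> exists p : ca, forall x,
    rnorm (T x - crho p x) <= d * rnorm x) -> exists p : ca, crho p = T;
  crep_D : forall a u, Cc a -> D u -> D (rep a u);
  crho_iota : forall a u, Cc a -> D u -> crho (ciota a) (ci u) = ci (rep a u);
  ciota_lin : lin_on Cc ciota;
  ciota_conv : forall a b, Cc a -> Cc b -> ciota (conv act a b) = cmul (ciota a) (ciota b);
  ciota_adj : forall a, Cc a -> ciota (ccadj act a) = cadj (ciota a);
  ciota_dense : forall x (d : R), 0 < d -> exists2 a, Cc a & rnorm (x - ciota a) < d
}.

Lemma rep_sum a xi (s : seq G) : uniq s -> (forall t, t \notin s -> a t = 0) ->
  rep a xi = \sum_(r <- s) (fun y => a r (pr y) * xi (tau r^-1%g y)).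
Proof. by move=> us hs; apply/funext => y; rewrite fct_sumE (repE _ _ us hs). Qed.

Lemma term_D a r xi : Cc a -> D xi -> D (fun y => a r (pr y) * xi (tau r^-1%g y)).
Proof. by move=> Ca Dx; apply: (@D_mul (a r) (xi \o tau r^-1%g)) (Ca.1 r) (D_tau _ Dx). Qed.

Lemma rep_D a xi : Cc a -> D xi -> D (rep a xi).
Proof.
move=> Ca Dx; have [s [us hs]] := Cc_supp Ca; rewrite (rep_sum _ us hs).
by apply: (submod_sum D_submod) => r; exact: term_D.
Qed.

Definition cov_prehilbert : prehilbert R :=
  PreHilbert D_submod.1 D_submod.2 ip_lin ip_conj ip_ge0.

Lemma rep_adj a u v : Cc a -> D u -> D v -> ip (rep a u) v = ip u (rep (ccadj act a) v).
Proof.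
move=> Ca Du Dv; have [s [us hs]] := Cc_supp Ca.
have uv : uniq [seq t^-1%g | t <- s] by rewrite map_inj_uniq //; exact: invg_inj.
have hv t : t \notin [seq t^-1%g | t <- s] -> ccadj act a t = 0.
  move=> ht; apply/funext => x; rewrite /ccadj hs ?rmorph0 //.
  by apply: contra ht => h; rewrite -[t]invgK; exact: map_f.
rewrite (rep_sum _ us hs) (rep_sum _ uv hv) big_map.
have sumr (I : Type) (q : seq I) (F : I -> Y -> C) : (forall i, D (F i)) ->
    ip u (\sum_(i <- q) F i) = \sum_(i <- q) ip u (F i).
  move=> DF; elim: q => [|i q IH].
    rewrite !big_nil; have := ip_lin (-1) D_submod.1 D_submod.1 Du.
    rewrite scaler0 addr0 mulN1r addNr => h; by rewrite (ip_conj D_submod.1 Du) h rmorph0.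
  rewrite !big_cons -IH (ip_conj (submodD D_submod (DF i) (submod_sum D_submod q DF)) Du).
  rewrite -[F i]scale1r ip_lin ?mul1r ?rmorphD //; last exact: submod_sum.
  have Ds := submod_sum D_submod q DF.
  by congr (_ + _); rewrite ?scale1r; apply/esym/ip_conj.
have suml (I : Type) (q : seq I) (F : I -> Y -> C) : (forall i, D (F i)) ->
    ip (\sum_(i <- q) F i) v = \sum_(i <- q) ip (F i) v.
  move=> DF; elim: q => [|i q IH].
    by rewrite !big_nil; have := ip_lin (-1) D_submod.1 D_submod.1 Dv; rewrite scaler0 addr0 mulN1r addNr.
  by rewrite !big_cons -IH -[F i]scale1r ip_lin ?mul1r ?scale1r //; exact: submod_sum.
rewrite suml => [|r]; last exact: term_D.
rewrite sumr => [|r]; last by apply: term_D => //; exact: Cc_adj.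
apply: eq_bigr => r _.
rewrite (@ip_mul (a r) (u \o tau r^-1%g)) //; [|exact: Ca.1|exact: D_tau].
have Dw : D (fun y => Num.conj (a r (pr y)) * v y).
  exact: (@D_mul (fun x => Num.conj (a r x)) v (contJ (Ca.1 r)) Dv).
rewrite -(ip_tau r (D_tau _ Du) Dw); congr ip.
  by apply/funext => y /=; rewrite -tauM mulVg tau1.
by apply/funext => y /=; rewrite /ccadj !invgK prE.
Qed.

Lemma snorm_mul f u (B : R) : 0 <= B -> continuous f -> D u -> (forall x, cmod (f x) <= B) ->
  snorm (P := cov_prehilbert) (fun y => f (pr y) * u y) <= B * snorm (P := cov_prehilbert) u.
Proof.
move=> B0 cf Du hB; rewrite -ler_sqr ?nnegrE ?mulr_ge0 ?snorm_ge0 // exprMn.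
rewrite -lecR -[X in _ <= X]/((real_complex R) _) [X in _ <= X]rmorphM /=.
rewrite !(@snorm_sqr R cov_prehilbert) //; last exact: D_mul.
exact: ip_bound.
Qed.

Theorem covariant_algebra : inhabited covalg.
Proof.
have [H [i [ilin iinn idense]]] := hilbert_completion cov_prehilbert.
have isn u : D u -> rnorm (i u) = snorm (P := cov_prehilbert) u.
  move=> Du; apply/eqP; rewrite -(eqrXn2 (n := 2)) ?rnorm_ge0 ?snorm_ge0 //; apply/eqP/complexI.
  by rewrite -inner_sqr iinn // (@snorm_sqr R cov_prehilbert).
have bounded a : Cc a -> exists2 M : R, 0 <= M & forall u, D u -> rnorm (i (rep a u)) <= M * rnorm (i u).
  move=> Ca; have [s [us hs]] := Cc_supp Ca.
  have /choice [B hB] : forall r, exists B : R, 0 <= B /\ forall x, cmod (a r x) <= B.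
    by move=> r; have [B B0 hB] := f_bound (Ca.1 r); exists B.
  exists (\sum_(r <- s) B r) => [|u Du]; first by apply: sumr_ge0 => r _; case: (hB r).
  rewrite (rep_sum _ us hs) (lin_on_sum D_submod ilin) => [|r]; last exact: term_D.
  rewrite (le_trans (rnorm_sum _ _)) // mulr_suml; apply: ler_sum => r _.
  rewrite !isn //; last exact: term_D.
  apply: le_trans (@snorm_mul (a r) (u \o tau r^-1%g) (B r) (hB r).1 (Ca.1 r) (D_tau _ Du) (hB r).2) _.
  rewrite ler_wpM2l ?(hB r).1 // /snorm /=.
  by rewrite (ip_tau r^-1%g Du Du).
have /choice [op hop] : forall a, exists F : H -> H, Cc a -> [/\ linear F,
    forall u, D u -> F (i u) = i (rep a u) & exists2 M : R, 0 <= M & forall x, rnorm (F x) <= M * rnorm x].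
  move=> a; have [Ca|nC] := pselect (Cc a); last by exists id.
  have [M M0 hM] := bounded a Ca.
  have [|F [F1 F2 F3]] := @extension R _ D H H (@complete_seq R H) i (fun u => i (rep a u)) M D_submod ilin _ M0 hM idense.
    by move=> k u v Du Dv; rewrite rep_linr // -ilin //; exact: rep_D.
  by exists F => _; split=> //; exists M.
have opl a : Cc a -> linear (op a) by move=> /hop [].
have opi a u : Cc a -> D u -> op a (i u) = i (rep a u) by move=> /hop [_ + _]; exact.
have opb a : Cc a -> exists2 M : R, 0 <= M & forall x, rnorm (op a x) <= M * rnorm x by move=> /hop [].
have opext a (F : H -> H) (M : R) : Cc a -> linear F -> 0 <= M -> (forall x, rnorm (F x) <= M * rnorm x) ->
    (forall u, D u -> F (i u) = i (rep a u)) -> op a = F.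
  move=> Ca lF M0 hM h; have [M' M0' hM'] := opb a Ca; apply/funext.
  apply: (@dense_eq R _ D H i idense H (op a) F M' M) => //; first exact: opl.
  by move=> u Du; rewrite opi ?h.
have oplin k a b : Cc a -> Cc b -> op (k *: a + b) = fun x => k *: op a x + op b x.
  move=> Ca Cb; have [M M0 hM] := opb a Ca; have [N N0 hN] := opb b Cb.
  apply: (opext _ _ (cmod k * M + N)) => [|l x y||x|u Du].
  - exact: (Cc_submod _ _ _).2.
  - rewrite !opl // !scalerDr !scalerA mulrC -!addrA; congr (_ + _).
    by rewrite addrCA.
  - by rewrite addr_ge0 ?mulr_ge0 ?cmod_ge0.
  - rewrite (le_trans (rnormD _ _)) // rnormZ mulrDl -mulrA lerD // ler_wpM2l ?cmod_ge0 //.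
  - by rewrite !opi // rep_linl // ilin //; exact: rep_D.
have opconv a b : Cc a -> Cc b -> op (conv act a b) = op a \o op b.
  move=> Ca Cb; have [M M0 hM] := opb a Ca; have [N N0 hN] := opb b Cb.
  apply: (opext _ _ (M * N)) => [|l x y||x|u Du].
  - exact: Cc_conv.
  - by rewrite /= !opl.
  - by rewrite mulr_ge0.
  - by rewrite /= (le_trans (hM _)) // -mulrA ler_wpM2l.
  - by rewrite /= !opi ?rep_conv //; exact: rep_D.
have opadj a x y : Cc a -> inner H (op a x) y = inner H x (op (ccadj act a) y).
  move=> Ca; have Ca' := Cc_adj hact Ca.
  have [M M0 hM] := opb a Ca; have [N N0 hN] := opb _ Ca'.
  have [u [Du hu]] := dense_seq idense x; have [v [Dv hv]] := dense_seq idense y.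
  apply: cvs_eq (cvs_inner (cvs_op (opl a Ca) M0 hM hu) hv) (cvs_inner hu (cvs_op (opl _ Ca') N0 hN hv)) => n /=.
  rewrite (opi _ _ Ca (Du n)) (opi _ _ Ca' (Dv n)) !iinn //; last 2 first.
  exact: (rep_D Ca' (Dv n)).
  exact: (rep_D Ca (Du n)).
  exact: (rep_adj Ca (Du n) (Dv n)).
pose Dop : set (H -> H) := [set T | exists2 a, Cc a & T = op a].
have [||||||A [rho [riso rD rapp rcl]]] := @operator_algebra R H Dop.
- exists 0; first exact: (Cc_submod _ _ _).1.
  apply/esym/(opext _ _ 0) => //; first exact: (Cc_submod _ _ _).1.
  + by move=> k x y; rewrite scaler0 addr0.
  + by move=> x; rewrite rnorm0 mul0r.
  + move=> u Du; have -> : rep 0 u = 0.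
      by apply/funext => y; rewrite (@repE _ _ [::]) ?big_nil.
    by rewrite (lin_on0 D_submod ilin).
- move=> k _ _ [a Ca ->] [b Cb ->]; exists (k *: a + b); last by rewrite oplin.
  exact: (Cc_submod _ _ _).2.
- by move=> _ [a Ca ->]; exact: opl.
- by move=> _ [a Ca ->]; exact: opb.
- by move=> _ _ [a Ca ->] [b Cb ->]; exists (conv act a b); [exact: Cc_conv | rewrite opconv].
- by move=> _ [a Ca ->]; exists (op (ccadj act a)); [exists (ccadj act a) => //; exact: Cc_adj | move=> x y; exact: opadj].
have [rb [rlin rmul radj rnrm]] := riso.
have rinj (p q : A) : rho p = rho q -> p = q.
  move=> pq; apply/eqP; rewrite -subr_eq0; apply/eqP/rnorm_eq0/eqP.
  rewrite eq_le rnorm_ge0 andbT -rnrm; apply: opnorm_le => // x.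
  rewrite addrC -scaleN1r rlin pq scaleN1r addNr rnorm0 mul0r //.
have /choice [iota hiota] : forall a, exists p : A, Cc a -> rho p = op a.
  move=> a; have [Ca|nC] := pselect (Cc a); last by exists 0.
  by have [|p hp] := rD (op a); [exists a | exists p].
split; apply: (@CovAlg H i A rho iota) => //.
- exact: rep_D.
- by move=> a u Ca Du; rewrite hiota // opi.
- move=> k a b Ca Cb; apply: rinj; apply/funext => x; rewrite rlin !hiota //; last exact: (Cc_submod _ _ _).2.
  by rewrite oplin.
- move=> a b Ca Cb; apply: rinj; apply/funext => x; rewrite rmul !hiota //; last exact: Cc_conv.
  by rewrite opconv.
- move=> a Ca; apply: rinj; apply/funext => x; apply: inner_ext => z.
  rewrite hiota; last exact: Cc_adj.
  by rewrite -opadj // iconj [in RHS]iconj radj hiota.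
- move=> p d d0; have d2 : 0 < d / 2 by rewrite divr_gt0.
  have [_ [a Ca ->] h] := rapp p _ d2; exists a => //.
  apply: (@le_lt_trans _ _ (d / 2)); last lra.
  rewrite -rnrm; apply: opnorm_le; first exact: ltW.
  move=> x; have -> : p - iota a = -1 *: iota a + p by rewrite scaleN1r addrC.
  by rewrite rlin (hiota _ Ca) scaleN1r (addrC (- _)); exact: h.
Qed.

End Covariant.

(* What the rest of the proof uses of the minimal shift: the colours of [scol]
   separate [x] from [s x], which is a strong form of freeness. *)
Record system (R : realType) (G : groupType) := System {
  sX :> topologicalType;
  sact : G -> sX -> sX;
  smean : (sX -> R[i]^o) -> R[i]^o;
  scol : G -> sX -> 'I_3;
  s_compact : compact [set: sX];
  s_hausdorff : hausdorff_space sX;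
  s_action : continuous_action sact;
  scol_cont : forall s (h : 'I_3 -> R[i]^o), continuous (fun x => h (scol s x) : R[i]^o);
  scol_sep : forall s x, s <> 1%g -> scol s (sact s x) <> scol s x;
  s_bounded : forall f : sX -> R[i]^o, continuous f ->
    exists2 B : R, 0 <= B & forall x, cmod (f x) <= B;
  s_point : sX;
  s_minimal : forall f : sX -> R[i]^o, continuous f -> f <> 0 -> exists (F : seq G) (d : R),
    0 < d /\ forall x, d%:C <= \sum_(s <- F) `|f (sact s x)| ^+ 2;
  s_disjoint : forall n, exists f : nat -> sX -> R[i]^o,
    [/\ forall i, continuous (f i), forall i, f i <> 0
      & forall i j x, (i < n)%N -> (j < n)%N -> i <> j -> f i x * f j x = 0];
  smean_lin : forall k (f g : sX -> R[i]^o), continuous f -> continuous g ->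
    smean (k *: f + g) = k * smean f + smean g;
  smean_cst : forall z, smean (fun=> z) = z;
  smean_ge0 : forall f : sX -> R[i]^o, continuous f -> (forall x, 0 <= f x) -> 0 <= smean f;
  smean_inv : forall (f : sX -> R[i]^o) t, continuous f -> smean (f \o sact t) = smean f;
  smean_poincare : exists (Q : seq G) (eps : R), 0 < eps /\ forall f : sX -> R[i]^o, continuous f ->
    (eps ^+ 2)%:C * (smean (fun x => `|f x| ^+ 2) - `|smean f| ^+ 2) <=
      \sum_(s <- Q) smean (fun x => `|f (sact s^-1%g x) - f x| ^+ 2)
}.

(** * Existence of the dynamical system *)

Section Existence.
Context (R : realType) (G : groupType).

Lemma infinite_seq_ex (T : choiceType) : infinite_set [set: T] -> forall n,
  exists s : seq T, uniq s /\ size s = n.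
Proof.
move=> Tinf; elim=> [|n [s [us ss]]]; first by exists [::].
have [t ts] : exists t, t \notin s.
  apply: contrapT => /forallNP h; apply: Tinf; apply: (sub_finite_set _ (finite_seq s)) => t _ /=.
  by apply: contrapT => /negP; exact: h.
by exists (t :: s); rewrite /= ts us ss.
Qed.

Lemma mshift_ex : countable [set: G] -> inhabited (mshift G).
Proof.
move=> Gc.
have [e he] : exists e : nat -> G * G, forall p, exists n, e n = p.
  have /countable_injP [f finj] : countable [set: G * G] by rewrite -setXTT; exact: countableX.
  exists (fun n => xget (1%g, 1%g) [set p | f p = n]) => p; exists (f p).
  by case: xgetP => [q _ /= h|/(_ p)]; [apply: finj; rewrite ?inE | case].
have [X [[X0 Xl Xs Xc] [Xm Xa]]] := minimal_subshift he.
exact: (inhabits (@MShift G e X he X0 Xl Xs Xc Xm Xa)).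
Qed.

Context (M : mshift G).
Local Notation X := (xsp M).
Local Notation C := (R[i]^o).

Lemma xsep (s : seq X) : exists k, forall x y, x \in s -> y \in s -> x <> y -> ~ xagr k x y.
Proof.
have /choice [k hk] : forall p : X * X, exists k, p.1 <> p.2 -> ~ xagr k p.1 p.2.
  move=> [x y]; have [xy|nxy] := pselect (x = y); first by exists 0%N => /(_ xy).
  have [k hk] := xagr_sep nxy; exists k => _ /= h; exact: (hk y h).
exists (\max_(p <- [seq (x, y) | x <- s, y <- s]) k p)%N => x y xs ys xy h.
apply: (hk (x, y) xy); apply: agr_le h.
by apply: (@leq_bigmax_seq _ _ _ k (x, y)) => //; apply/allpairsP; exists (x, y).
Qed.

Lemma xlocal_cont k (A : Type) (h : X -> A) (g : A -> C) :
  (forall x y, xagr k x y -> h x = h y) -> continuous (g \o h : X -> C).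
Proof.
move=> hk; apply/xcontP => x d d0; exists k => y xy.
by rewrite /= (hk _ _ xy) subrr cmod0.
Qed.

(** [|f|] is at least half of [|f x|] on a cylinder around a point [x] with [f x <> 0], and by
    minimality a fixed finite set of translations brings every point into this cylinder. *)
Lemma xminimal (f : X -> C) : continuous f -> f <> 0 -> exists (F : seq G) (d : R),
  0 < d /\ forall x, d%:C <= \sum_(s <- F) `|f (xact s x)| ^+ 2.
Proof.
move=> /xcontP cf f0.
have [x fx] : exists x, f x <> 0 by apply: contrapT => /forallNP h; apply/f0/funext => x; apply: contrapT; exact: h.
have dx : 0 < cmod (f x) by rewrite lt_neqAle cmod_ge0 andbT eq_sym; apply/eqP => /cmod_eq0.
have d0 : 0 < cmod (f x) / 2 by rewrite divr_gt0.
have [k hk] := cf x _ d0; have [F hF] := mX_min k (svalP x).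
exists [seq t^-1%g | t <- F], ((cmod (f x) / 2) ^+ 2); split=> [|y]; first by rewrite exprn_gt0.
have [t tF ht] := hF _ (svalP y).
rewrite big_map (big_rem t) //= -[leLHS]addr0 lerD //; last first.
  by apply: sumr_ge0 => s _; rewrite exprn_ge0.
rewrite (cmodE (f _)) -rmorphXn lecR ler_sqr ?nnegrE ?cmod_ge0 ?ltW //.
have h : cmod (f (xact t^-1 y) - f x) < cmod (f x) / 2 by apply: hk; apply: agrC; rewrite /= invgK.
have := rnorm_diff (f x) (f (xact t^-1 y)); rewrite (rnormB (f x)) !rnorm_cmod.
rewrite ler_norml => /andP[_]; lra.
Qed.

Theorem minimal_system : infinite_set [set: G] -> property_T R G -> inhabited (system R G).
Proof.
move=> Ginf GT; have x0 := x0 M.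
have [a1 aM _] := xact_continuous M.
(* With the colour [x (s^-1, 1)], the point [s x] gets the colour [x (s^-1, s^-1)]; these are the
   ends of an edge of index [s^-1]. *)
split; apply: (@System R G X (@xact G M) (@mean R G M)
  (fun s x => sval x (s^-1%g, 1%g))) => //.
- exact: xsp_compact.
- exact: xsp_hausdorff.
- exact: xact_continuous.
- move=> s h; have [n hn] := me_surj M (s^-1%g, 1%g).
  by apply: (@xlocal_cont n.+1 _ (fun x => sval x (s^-1%g, 1%g)) h) => x y xy; rewrite -hn; exact: xy.
- move=> s x s1 E; have s1' : s^-1%g <> 1%g by move=> /eqP; rewrite invg_eq1 => /eqP.
  apply: (mX_legal (svalP x) (g := 1%g) s1').
  by rewrite -[in RHS]E /= /sh /= mulg1 mul1g.
- exact: xcont_bounded.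
- exact: xminimal.
(* By freeness the orbit of [x0] is infinite; the functions are indicators of small cylinders around
   [n] of its points. *)
- move=> n; have [s [us ss]] := infinite_seq_ex Ginf n.
  pose z i := xact (nth 1%g s i) x0.
  have zinj i j : (i < n)%N -> (j < n)%N -> i <> j -> z i <> z j.
    move=> hi hj ij /(congr1 (@xact G M (nth 1%g s i)^-1%g)).
    rewrite -!aM mulVg a1 => /esym; apply: xact_free => h.
    have /eqP : nth 1%g s i = nth 1%g s j by apply: (mulgI (nth 1%g s i)^-1%g); rewrite h mulVg.
    by rewrite nth_uniq ?ss // => /eqP.
  have [k hk] := xsep [seq z i | i <- iota 0 n].
  have mz i : (i < n)%N -> z i \in [seq z i | i <- iota 0 n] by move=> hi; apply: map_f; rewrite mem_iota.
  exists (fun i x => if `[< xagr k (z i) x >] then 1 else 0); split=> [i|i|i j x hi hj ij].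
  + apply: (@xlocal_cont k _ (fun x => `[< xagr k (z i) x >]) (fun b : bool => if b then 1 else 0)) => x y xy.
    apply/asboolP/asboolP => h; first exact: agr_trans h xy.
    exact: agr_trans h (agrC xy).
  + move=> /(congr1 (fun f => f (z i))); case: asboolP => [_ /eqP|[]//].
    by rewrite oner_eq0.
  + case: asboolP => [h1|_]; last by rewrite mul0r.
    case: asboolP => [h2|_]; last by rewrite mulr0.
    exfalso; apply: (hk _ _ (mz _ hi) (mz _ hj) (zinj _ _ hi hj ij)).
    exact: agr_trans h1 (agrC h2).
- exact: mean_lin.
- exact: mean_cst.
- exact: mean_ge0.
- exact: mean_inv.
- exact: mean_poincare.
Qed.

End Existence.

(** * Conjugates and real parts *)

Section Conjugation.
Context (R : realType).
Implicit Types z w : R[i].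

Lemma conjM z w : Num.conj (z * w) = Num.conj z * Num.conj w. Proof. exact: rmorphM. Qed.

Lemma conjD z w : Num.conj (z + w) = Num.conj z + Num.conj w. Proof. exact: rmorphD. Qed.

Lemma conjB z w : Num.conj (z - w) = Num.conj z - Num.conj w. Proof. exact: rmorphB. Qed.

Lemma conj_sum (I : Type) (s : seq I) (F : I -> R[i]) :
  Num.conj (\sum_(i <- s) F i) = \sum_(i <- s) Num.conj (F i).
Proof. exact: rmorph_sum. Qed.

End Conjugation.

Section RealParts.
Context (R : realType) (T : topologicalType).
Implicit Type f : T -> R[i]^o.

Lemma Re_half (z : R[i]) : (complex.Re z)%:C = 2^-1 * (z + Num.conj z).
Proof. by case: z => u v; apply/eqP; rewrite eq_complex /=; apply/andP; split; apply/eqP; field. Qed.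

Lemma contRe f : continuous f -> continuous (fun x => (complex.Re (f x))%:C : R[i]^o).
Proof.
move=> cf; under eq_fun do rewrite Re_half.
exact: (@contM R T _ _ (@cont_cst R T 2^-1) (contD cf (contJ cf))).
Qed.

Lemma cont_norm f : continuous f -> continuous (fun x => `|f x| : R[i]^o).
Proof.
move=> cf; apply/contP => x d d0; have /contP := cf; move=> /(_ x d d0); apply: filterS => y /= hy.
apply: le_lt_trans hy; rewrite !(cmodE (f _)) -rmorphB /= cmodR -!rnorm_cmod.
exact: rnorm_diff.
Qed.

End RealParts.

(** * The Koopman representation on the space of square-integrable functions *)

Section Koopman.
Context (R : realType) (G : groupType) (S : system R G).
Local Notation X := (sX S).
Local Notation C := (R[i]^o).
Implicit Types f g : X -> C.

Definition kip f g : R[i] := smean (fun x => f x * Num.conj (g x) : C).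

Let cM f g (cf : continuous f) (cg : continuous g) : continuous (fun x => f x * Num.conj (g x) : C).
Proof. exact: (@contM R X f _ cf (contJ cg)). Qed.

Lemma smean0 : @smean R G S (fun=> 0) = 0. Proof. exact: smean_cst. Qed.

Lemma smeanZ k f : continuous f -> smean (k *: f) = k * smean f.
Proof.
move=> cf; have := @smean_lin R G S k f (fun=> 0) cf (@cont_cst R X 0).
by rewrite smean0 addr0 => ->; rewrite addr0.
Qed.

Lemma smean_le f g : continuous f -> continuous g -> (forall x, f x <= g x) -> smean f <= smean g.
Proof.
move=> cf cg h; rewrite -subr_ge0.
have -> : smean g - smean f = smean (-1 *: f + g) by rewrite smean_lin // mulN1r addrC.
apply: smean_ge0 => [|x]; first exact: (@contD R X _ _ (@contZ R X (-1) f cf) cg).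
by rewrite -[X in 0 <= X]/(-1 *: f x + g x) scaleN1r addrC subr_ge0.
Qed.

Lemma cont_abs2 f : continuous f -> continuous (fun x => `|f x| ^+ 2 : C).
Proof. by move=> cf; under eq_fun do rewrite normCK; exact: cM. Qed.

Lemma kip_sqr f : kip f f = smean (fun x => `|f x| ^+ 2 : C).
Proof. by congr smean; apply/funext => x; rewrite normCK. Qed.

(** A positive functional is real on real functions, because [h = |h| - (|h| - h)] is a difference
    of nonnegative continuous functions. *)
Lemma smean_conj f : continuous f -> smean (fun x => Num.conj (f x) : C) = Num.conj (smean f).
Proof.
move=> cf; pose re : X -> C := fun x => (complex.Re (f x))%:C.
pose im : X -> C := fun x => (complex.Im (f x))%:C.
have cj := contJ cf.
have cre : continuous re := contRe cf.
have E2 x : f x = re x + 'i%C * im x.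
  by rewrite /re /im; case: (f x) => u v; apply/eqP; rewrite eq_complex /=; apply/andP; split; apply/eqP; ring.
have cim : continuous im.
  have -> : im = fun x => - 'i%C * (f x - re x).
    apply/funext => x; rewrite E2 addrAC subrr add0r mulrA mulNr -expr2 sqr_i opprK mul1r //.
  exact: (@contM R X _ _ (@cont_cst R X _) (contB cf cre)).
have real (h : X -> R) : continuous (fun x => (h x)%:C : C) -> Num.conj (smean (fun x => (h x)%:C : C)) = smean (fun x => (h x)%:C : C).
  move=> ch; have chh := cont_norm ch.
  have -> : smean (fun x => (h x)%:C : C) =
      smean (fun x => `|(h x)%:C| : C) - smean (fun x => `|(h x)%:C| - (h x)%:C : C).
    rewrite addrC -[- smean _]mulN1r -(@smean_lin R G S (-1) (fun x => `|(h x)%:C| - (h x)%:C) _ (contB chh ch) chh).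
    congr smean; apply/funext => x.
    by rewrite -[RHS]/(-1 *: (`|(h x)%:C| - (h x)%:C) + `|(h x)%:C|) scaleN1r opprB subrK.
  have p1 : 0 <= smean (fun x => `|(h x)%:C| : C) by apply: smean_ge0 => // x.
  have p2 : 0 <= smean (fun x => `|(h x)%:C| - (h x)%:C : C).
    by apply: smean_ge0 => [|x]; [exact: (contB chh ch) | rewrite subr_ge0 real_ler_norm // complex_real].
  by rewrite conjB !conj_Creal ?ger0_real.
have -> : f = 'i%C *: im + re by apply/funext => x; rewrite E2 addrC.
have -> : (fun x => Num.conj (('i%C *: im + re : X -> C) x) : C) = - 'i%C *: im + re.
  apply/funext => x; rewrite -[X in Num.conj X]/('i%C * im x + re x) -[RHS]/(- 'i%C * im x + re x).
  by apply/eqP; rewrite /im /re eq_complex /=; apply/andP; split; apply/eqP; ring.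
rewrite (smean_lin _ cim cre) (smean_lin _ cim cre) conjD conjM (real _ cim) (real _ cre).
by congr (_ * _ + _); apply/eqP; rewrite eq_complex /=; apply/andP; split; apply/eqP; ring.
Qed.

Let csub : submod [set f : X -> C | continuous f].
Proof.
split=> [|k f g cf cg]; first exact: (@cont_cst R X 0).
exact: (@contD R X _ _ (@contZ R X k f cf) cg).
Qed.

Theorem koopman_algebra : inhabited (@covalg R G X (@sact R G S) X (@sact R G S) id
  [set f : X -> C | continuous f] kip).
Proof.
have [a1 aM ca] := s_action S.
apply: (@covariant_algebra R G X (@sact R G S) (s_action S) X (@sact R G S) id a1 aM (fun _ _ => erefl)
  [set f : X -> C | continuous f] kip csub).
- by move=> s xi; exact: (act_cont (s_action S)).
- move=> f xi cf cx; exact: (@contM R X f xi cf cx).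
- move=> k u v w cu cv cw; rewrite /kip -(@smean_lin R G S k _ _ (cM cu cw) (cM cv cw)).
  by congr smean; apply/funext => x; rewrite -[RHS]/(k *: (u x * _) + v x * _) scalerAl -mulrDl.
- move=> u v cu cv; rewrite /kip -(smean_conj (cM cu cv)).
  by congr smean; apply/funext => x; rewrite conjM conjCK mulrC.
- move=> u cu; rewrite kip_sqr; apply: smean_ge0 => [|x]; first exact: cont_abs2.
  by rewrite exprn_ge0.
- move=> s u v cu cv; exact: (smean_inv s (cM cu cv)).
- move=> f u v cf cu cv; congr smean; apply/funext => x.
  by rewrite conjM conjCK mulrCA mulrA.
- move=> f u B cf cu hB; rewrite !kip_sqr -smeanZ; last exact: cont_abs2.
  apply: smean_le => [||x].
  + apply: (@cont_abs2 (fun y => f y * u y)); exact: (@contM R X f u cf cu).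
  + exact: (@contZ R X _ _ (cont_abs2 cu)).
  rewrite -[X in _ <= X]/(_ * `|u x| ^+ 2) normrM exprMn ler_wpM2r ?exprn_ge0 //.
  rewrite cmodE -rmorphXn lecR ler_sqr ?nnegrE ?cmod_ge0 //.
  exact: le_trans (cmod_ge0 _) (hB x).
- exact: s_bounded.
Qed.

End Koopman.

(** * The regular representation on finitely supported functions *)

Section Regular.
Context (R : realType) (G : groupType) (X : topologicalType) (act : G -> X -> X).
Hypothesis hact : continuous_action act.
Hypothesis f_bound : forall f : X -> R[i]^o, continuous f ->
  exists2 B : R, 0 <= B & forall x, cmod (f x) <= B.
Local Notation C := (R[i]^o).
Local Notation Y := (G * X)%type.
Implicit Types u v w : Y -> C.

Definition finsupp : set (Y -> C) := [set u | finite_set [set p | u p <> 0]].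

Definition fip u v : R[i] := \sum_(p \in [set: Y]) u p * Num.conj (v p).

Definition rtau (s : G) (p : Y) : Y := ((s * p.1)%g, p.2).

Definition rpr (p : Y) : X := act p.1 p.2.

Lemma finsuppP u : finsupp u -> exists s : seq Y, uniq s /\ forall p, p \notin s -> u p = 0.
Proof.
move=> /finite_seqP [s hs]; exists (undup s); split=> [|p]; first exact: undup_uniq.
rewrite mem_undup => ps; apply: contrapT => h.
have : [set` s] p by rewrite -hs.
by move=> /= ps'; rewrite ps' in ps.
Qed.

Lemma finsupp_intro u (s : seq Y) : (forall p, p \notin s -> u p = 0) -> finsupp u.
Proof.
move=> h; apply: (sub_finite_set _ (finite_seq s)) => p /= up.
by apply: contraT => /h /up.
Qed.

Lemma fipE u v (s : seq Y) : uniq s -> (forall p, p \notin s -> u p = 0) ->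
  fip u v = \sum_(p <- s) u p * Num.conj (v p).
Proof. by move=> us h; apply: fsumE => // p /h ->; rewrite mul0r. Qed.

Lemma finsupp_submod : submod finsupp.
Proof.
split=> [|k u v fu fv]; first by apply: (@finsupp_intro _ [::]).
have [s [_ hs]] := finsuppP fu; have [r [_ hr]] := finsuppP fv.
apply: (@finsupp_intro _ (s ++ r)) => p; rewrite mem_cat negb_or => /andP[/hs h1 /hr h2].
by rewrite -[LHS]/(k *: u p + v p) h1 h2 scaler0 addr0.
Qed.

Theorem regular_algebra : inhabited (@covalg R G X act Y rtau rpr finsupp fip).
Proof.
have [a1 aM ca] := hact.
apply: covariant_algebra => //.
- by move=> [t x]; rewrite /rtau mul1g.
- by move=> s t [r x]; rewrite /rtau /= mulgA.
- by move=> s [t x]; rewrite /rpr /= aM.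
- exact: finsupp_submod.
- move=> s u fu; have [r [_ hr]] := finsuppP fu.
  apply: (@finsupp_intro _ [seq rtau s^-1%g p | p <- r]) => p hp; apply: hr; apply: contra hp => h.
  by apply/mapP; exists (rtau s p) => //; case: p h => t x _; rewrite /rtau /= mulKg.
- move=> f u cf fu; have [r [_ hr]] := finsuppP fu.
  by apply: (@finsupp_intro _ r) => p /hr ->; rewrite mulr0.
- move=> k u v w fu fv fw; have [s [_ hs]] := finsuppP fu; have [r [_ hr]] := finsuppP fv.
  pose q := undup (s ++ r).
  have hq p : p \notin q -> u p = 0 /\ v p = 0.
    by rewrite mem_undup mem_cat negb_or => /andP[/hs -> /hr ->].
  rewrite !(@fipE _ _ q) ?undup_uniq // => [|p /hq [_ ->] //|p /hq [-> _] //|p /hq [h1 h2]]; last first.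
    by rewrite -[LHS]/(k *: u p + v p) h1 h2 scaler0 addr0.
  rewrite mulr_sumr -big_split; apply: eq_bigr => p _.
  by rewrite -[X in X * _ = _]/(k *: u p + v p) mulrDl -scalerAl.
- move=> u v fu fv; have [s [_ hs]] := finsuppP fu; have [r [_ hr]] := finsuppP fv.
  pose q := undup (s ++ r).
  have hq p : p \notin q -> u p = 0 /\ v p = 0.
    by rewrite mem_undup mem_cat negb_or => /andP[/hs -> /hr ->].
  rewrite !(@fipE _ _ q) ?undup_uniq // => [|p /hq [] //|p /hq [] //].
  by rewrite conj_sum; apply: eq_bigr => p _; rewrite conjM conjCK mulrC.
- move=> u fu; have [s [us hs]] := finsuppP fu; rewrite (fipE _ us hs).
  by apply: sumr_ge0 => p _; rewrite -normCK exprn_ge0.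
- move=> s u v fu fv; rewrite /fip [RHS](reindex_fsbigT (rtau s)) //.
  by exists (rtau s^-1%g) => -[t x]; rewrite /rtau /= ?mulKg ?mulVKg.
- move=> f u v cf fu fv; apply: eq_fsbigr => p _.
  by rewrite conjM conjCK mulrCA mulrA.
- move=> f u B cf fu hB; have [s [us hs]] := finsuppP fu.
  rewrite !(@fipE _ _ s) // => [|p /hs ->]; last by rewrite mulr0.
  rewrite mulr_sumr; apply: ler_sum => p _; rewrite -!normCK normrM exprMn ler_wpM2r ?exprn_ge0 //.
  rewrite cmodE -rmorphXn lecR ler_sqr ?nnegrE ?cmod_ge0 //.
  exact: le_trans (cmod_ge0 _) (hB (rpr p)).
Qed.

End Regular.

(** * Norm estimates in C*-algebras and covariant algebras *)

Section CstarFacts.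
Context (R : realType) (A : cstarAlgebra R).
Implicit Types u v w : A.

Lemma rnorm_cmul u v : rnorm (cmul u v) <= rnorm u * rnorm v.
Proof. by have := cnormM u v; rewrite !normE -rmorphM lecR. Qed.

Lemma rnorm_cadjM u : rnorm (cmul (cadj u) u) = rnorm u ^+ 2.
Proof. by apply: complexI; rewrite -normE cnorm_adjM normE rmorphXn. Qed.

Lemma rnorm_cadj u : rnorm (cadj u) = rnorm u.
Proof.
have h v : rnorm v <= rnorm (cadj v).
  have := rnorm_cmul (cadj v) v; rewrite rnorm_cadjM expr2.
  have [->|v0] := eqVneq (rnorm v) 0; first by rewrite rnorm_ge0.
  by rewrite ler_pM2r // lt_neqAle eq_sym v0 rnorm_ge0.
by apply/eqP; rewrite eq_le -{2}[u]cadjK !h.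
Qed.

End CstarFacts.

Section CovalgFacts.
Context (R : realType) (G : groupType) (X : topologicalType) (act : G -> X -> X).
Context (Y : Type) (tau : G -> Y -> Y) (pr : Y -> X).
Local Notation C := (R[i]^o).
Local Notation Cc := (@Cc R G X).
Context (D : set (Y -> C)) (ip : (Y -> C) -> (Y -> C) -> R[i]).
Context (K : covalg act tau pr D ip).
Implicit Types (a b : G -> X -> C) (u v : Y -> C) (p q : ca K).

Lemma ci_sqr u : D u -> (rnorm (ci K u) ^+ 2)%:C = ip u u.
Proof. by move=> Du; rewrite -inner_sqr ci_inner. Qed.

Lemma crho_lin p : linear (crho p).
Proof. by case: (crho_iso K) => h _; case: (h p). Qed.

Lemma crho_linl k p q x : crho (k *: p + q) x = k *: crho p x + crho q x.
Proof. by case: (crho_iso K) => _ []. Qed.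

Lemma crho_mul p q x : crho (cmul p q) x = crho p (crho q x).
Proof. by case: (crho_iso K) => _ []. Qed.

Lemma crho_adj p x y : inner (ch K) (crho (cadj p) x) y = inner (ch K) x (crho p y).
Proof. by case: (crho_iso K) => _ []. Qed.

Lemma crho_norm p : opnorm (crho p) = rnorm p.
Proof. by case: (crho_iso K) => _ []. Qed.

Lemma crho_le p x : rnorm (crho p x) <= rnorm p * rnorm x.
Proof.
have [h _] := crho_iso K; have [lp cp] := h p.
have [M _ hM] := bounded_rnorm lp cp.
by rewrite -crho_norm; exact: (le_opnorm lp hM).
Qed.

Lemma rnorm_dense p (M : R) : 0 <= M ->
  (forall u, D u -> rnorm (crho p (ci K u)) <= M * rnorm (ci K u)) -> rnorm p <= M.
Proof.
move=> M0 hM; rewrite -crho_norm; apply: opnorm_le => // x; apply/ler_addgt0Pr => e e0.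
have c0 : 0 < rnorm p + M + 1 by rewrite ltr_wpDl // addr_ge0 ?rnorm_ge0.
have [u Du hu] := ci_dense x (divr_gt0 e0 c0).
have l1 := linB (crho_lin p) x (ci K u).
have r1 := rnormD (crho p (x - ci K u)) (crho p (ci K u)); rewrite l1 subrK in r1.
have r2 := crho_le p (x - ci K u); rewrite l1 in r2.
have r3 := hM u Du.
have r4 := @rnorm_diff _ _ (ci K u) x; rewrite rnormB in r4.
have {r4} r4 : rnorm (ci K u) <= rnorm x + rnorm (x - ci K u).
  by move: r4; rewrite ler_norml => /andP[_]; lra.
have r5 : M * rnorm (ci K u) <= M * (rnorm x + rnorm (x - ci K u)) by rewrite ler_wpM2l.
have r6 : (rnorm p + M) * rnorm (x - ci K u) <= e.
  apply: (@le_trans _ _ ((rnorm p + M + 1) * (e / (rnorm p + M + 1)))).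
    by apply: ler_pM; rewrite ?addr_ge0 ?rnorm_ge0 ?lerDl ?(ltW hu).
  by rewrite mulrC divfK ?gt_eqF.
lra.
Qed.

Lemma ciota_le a (M : R) : 0 <= M -> Cc a ->
  (forall u, D u -> ip (rep tau pr a u) (rep tau pr a u) <= (M ^+ 2)%:C * ip u u) -> rnorm (ciota K a) <= M.
Proof.
move=> M0 Ca h; apply: rnorm_dense => // u Du; rewrite crho_iota //.
rewrite -ler_sqr ?nnegrE ?mulr_ge0 ?rnorm_ge0 // exprMn -lecR.
rewrite -[X in _ <= X]/((real_complex R) _) [X in _ <= X]rmorphM /= !ci_sqr //; first exact: h.
exact: (crep_D K).
Qed.

Lemma crho0 x : crho (0 : ca K) x = 0.
Proof.
have := crho_linl 1 (0 : ca K) 0 x; rewrite scaler0 addr0 scale1r.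
by move=> /eqP; rewrite -[X in X == _]addr0 (inj_eq (addrI _)) => /eqP.
Qed.

Lemma crhoZ k p x : crho (k *: p) x = k *: crho p x.
Proof. by have := crho_linl k p 0 x; rewrite addr0 crho0 addr0. Qed.

Lemma crhoD p q x : crho (p + q) x = crho p x + crho q x.
Proof. by have := crho_linl 1 p q x; rewrite !scale1r. Qed.

Lemma crhoB p q x : crho (p - q) x = crho p x - crho q x.
Proof. by rewrite addrC -scaleN1r crho_linl scaleN1r addrC. Qed.

Lemma crho_inj p q : crho p = crho q -> p = q.
Proof.
move=> pq; apply/eqP; rewrite -subr_eq0; apply/eqP/rnorm_eq0/eqP.
rewrite eq_le rnorm_ge0 andbT -crho_norm; apply: opnorm_le => // x.
by rewrite crhoB pq subrr rnorm0 mul0r.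
Qed.

Lemma ciota_completion : @is_completion R G X act (fun a => rnorm (ciota K a)) (ca K) (ciota K).
Proof.
split=> //; [exact: (ciota_lin K)|exact: (ciota_conv K)|exact: (ciota_adj K)|].
apply: dense_approx => x e e0; have [a Ca h] := ciota_dense x e0.
by exists (ciota K a) => //; exists a.
Qed.

End CovalgFacts.

(** * Pinching by colour functions *)

Section Pinching.
Context (R : realType) (G : groupType) (S : system R G).
Local Notation X := (sX S).
Local Notation C := (R[i]^o).
Local Notation Cc := (@Cc R G X).
Local Notation act := (@sact R G S).
Local Notation cnv := (conv act).
Implicit Types (a b : G -> X -> C) (f g : X -> C).

Let a1 x : act 1%g x = x. Proof. by case: (s_action S). Qed.

Lemma conv_unitl f a : cnv (mon 1%g f) a = fun t x => f x * a t x.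
Proof.
by rewrite conv_mon; apply/funext => t; apply/funext => x; rewrite invg1 mul1g a1.
Qed.

Lemma conv_unitr f a : cnv a (mon 1%g f) = fun t x => a t x * f (act t^-1%g x).
Proof.
apply/funext => t; apply/funext => x; rewrite /Defs.conv.
rewrite (@fsumE _ _ [:: t]) // ?big_seq1 /mon ?mulVg ?eqxx // => r; rewrite inE => rt.
case: eqP => [h|_]; last by rewrite mulr0.
by case/eqP: rt; apply: (mulgI r^-1%g); rewrite h mulVg.
Qed.

Definition sgn (p : G * 'I_3) : X -> C := fun x => if scol p.1 x == p.2 then -1 else 1.

Lemma sgn_cont p : continuous (sgn p).
Proof. exact: (@scol_cont R G S p.1 (fun c => if c == p.2 then -1 else 1)). Qed.

(** The average of [a] and its conjugate by the symmetry [f]. For [f] with values 1 and -1 it keeps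
    the coefficient [a t x] when [f] agrees at [x] and [t^-1 x], and removes it otherwise. Unlike a
    direct truncation of coefficients, this is visibly contractive, preserves positive forms and
    preserves ideals. *)
Definition pinch f a := 2^-1 *: (a + cnv (cnv (mon 1%g f) a) (mon 1%g f)).

Lemma pinchE f a t x : pinch f a t x = 2^-1 * (1 + f x * f (act t^-1%g x)) * a t x.
Proof.
rewrite /pinch conv_unitr conv_unitl -[LHS]/(2^-1 * (a t x + f x * a t x * f (act t^-1%g x))).
by ring.
Qed.

Lemma Cc_pinch f a : continuous f -> Cc a -> Cc (pinch f a).
Proof.
move=> cf Ca; have Cf := @Cc_mon R G X 1%g f cf; have hs := s_action S.
have C1 := Cc_conv hs (Cc_conv hs Cf Ca) Cf.
exact: (submodZ (@Cc_submod R G X) _ (submodD (@Cc_submod R G X) Ca C1)).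
Qed.

Definition pinches (L : seq (G * 'I_3)) a := foldr (fun p => pinch (sgn p)) a L.

Lemma Cc_pinches L a : Cc a -> Cc (pinches L a).
Proof. by move=> Ca; elim: L => //= p L IH; apply: Cc_pinch => //; exact: sgn_cont. Qed.

Lemma pinches_unit L a : pinches L a 1%g = a 1%g.
Proof.
elim: L => //= p L IH; apply/funext => x; rewrite pinchE invg1 a1 IH /sgn.
by case: ifP => _; field.
Qed.

(** At the point [x] the factor belonging to the colour [scol t x] vanishes, since [t^-1 x] has
    another colour. *)
Lemma pinches_kill L a t : t <> 1%g -> (forall i, (t, i) \in L) -> pinches L a t = 0.
Proof.
move=> t1 hL; apply/funext => x; have := hL (scol t x); elim: L {hL} => //= p L IH.
rewrite inE pinchE => /orP[/eqP <-|/IH ->]; last by rewrite mulr0.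
rewrite /sgn /= eqxx; case: eqP => [E|_]; last by rewrite mulr1 subrr mulr0 mul0r.
case: (@scol_sep R G S t (act t^-1%g x) t1).
by rewrite E; case: (s_action S) => _ + _ => <-; rewrite mulgV a1.
Qed.

Lemma pinches_ex a : Cc a -> exists L, pinches L a = mon 1%g (a 1%g).
Proof.
move=> Ca; have [s [_ hs]] := Cc_supp Ca.
exists [seq (t, i) | t <- s, i <- enum 'I_3]; apply/funext => t; rewrite /mon.
case: eqP => [->|t1]; first exact: pinches_unit.
have [ts|ts] := boolP (t \in s); last first.
  by elim: [seq _ | _ <- _, _ <- _] => [|p L IH] /=; rewrite ?hs //; apply/funext => x; rewrite pinchE IH mulr0.
by apply: pinches_kill => // i; apply/allpairsP; exists (t, i); rewrite /= mem_enum.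
Qed.

End Pinching.

(** * Faithfulness and positivity in the Koopman algebra *)

Section KoopmanFacts.
Context (R : realType) (G : groupType) (S : system R G).
Local Notation X := (sX S).
Local Notation C := (R[i]^o).
Local Notation Cc := (@Cc R G X).
Local Notation act := (@sact R G S).
Local Notation cX := [set f : X -> C | continuous f].
Implicit Types (a b : G -> X -> C) (f g : X -> C).

Lemma smean_ge_eq0 f g (B : R) : continuous f -> continuous g -> (forall x, 0 <= g x) ->
  (forall x, g x <= B%:C * f x) -> smean f = 0 -> smean g = 0.
Proof.
move=> cf cg g0 gf f0; apply/eqP; rewrite eq_le (smean_ge0 cg g0) andbT.
have <- : smean (B%:C *: f) = 0 by rewrite (smeanZ _ cf) f0 mulr0.
exact: (@smean_le R G S g (B%:C *: f) cg (@contZ R X _ f cf) gf).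
Qed.

(** By minimality finitely many translates of [|f|^2] have a sum bounded below by some [d > 0],
    while by invariance each of them has mean 0. *)
Lemma smean_faithful f : continuous f -> smean (fun x => `|f x| ^+ 2 : C) = 0 -> f = 0.
Proof.
move=> cf f0; apply: contrapT => /(s_minimal cf) [F [d [d0 hF]]].
have cn := cont_abs2 cf.
have E : smean (fun x => \sum_(s <- F) `|f (act s x)| ^+ 2 : C) = 0.
  elim: F {hF} => [|s F IH]; first by under eq_fun do rewrite big_nil; exact: smean0.
  under eq_fun do rewrite big_cons.
  have cs : continuous (fun x => `|f (act s x)| ^+ 2 : C) := @act_cont R G X act (s_action S) s _ cn.
  have cF : continuous (fun x => \sum_(s <- F) `|f (act s x)| ^+ 2 : C).
    by apply: cont_sum => t; exact: (@act_cont R G X act (s_action S) t _ cn).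
  have := smean_lin 1 cs cF; rewrite mul1r IH addr0 -[X in _ = X -> _]/(smean ((fun x => `|f x| ^+ 2 : C) \o act s)).
  rewrite (smean_inv _ cn) f0 => E; rewrite -[RHS]E; congr smean; apply/funext => x.
  by rewrite -[RHS]/(1 *: (`|f (act s x)| ^+ 2) + _) scale1r.
have : (d%:C : C) <= smean (fun x => \sum_(s <- F) `|f (act s x)| ^+ 2 : C).
  rewrite -[X in X <= _](@smean_cst R G S); apply: smean_le hF; first exact: cont_cst.
  by apply: cont_sum => t; exact: (@act_cont R G X act (s_action S) t _ cn).
by rewrite E -[X in _ <= X]/(0%:C) lecR leNgt d0.
Qed.

Context (K : @covalg R G X act X act id cX (@kip R G S)).
Local Notation H := (ch K).
Local Notation A := (ca K).
Local Notation iota := (ciota K).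

Definition un f : A := iota (mon 1%g f).

Lemma Cun f : continuous f -> Cc (mon 1%g f). Proof. exact: Cc_mon. Qed.

Lemma kcont1 : continuous (fun _ : X => 1 : C). Proof. exact: cont_cst. Qed.

Lemma rep_unit f g : rep act id (mon 1%g f) g = fun x => f x * g x.
Proof. by apply/funext => x; rewrite rep_mon invg1; case: (s_action S) => ->. Qed.

Lemma un_op f g : continuous f -> continuous g -> crho (un f) (ci K g) = ci K (fun x => f x * g x).
Proof. by move=> cf cg; rewrite (crho_iota K (Cun cf) cg) rep_unit. Qed.

Lemma un_le f (B : R) : continuous f -> 0 <= B -> (forall x, cmod (f x) <= B) -> rnorm (un f) <= B.
Proof.
move=> cf B0 hB; rewrite /un; apply: (ciota_le K B0 (Cun cf)) => u cu.
have cfu : continuous (fun x => f x * u x : C) := @contM R X f u cf cu.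
rewrite rep_unit !kip_sqr -(smeanZ _ (cont_abs2 cu)).
apply: (smean_le (cont_abs2 cfu) (@contZ R X _ _ (cont_abs2 cu))) => x.
rewrite -[X in _ <= X]/(_ * `|u x| ^+ 2) normrM exprMn ler_wpM2r ?exprn_ge0 //.
by rewrite cmodE -rmorphXn lecR ler_sqr ?nnegrE ?cmod_ge0.
Qed.

Lemma un_inj f : continuous f -> un f = 0 -> f = 0.
Proof.
move=> cf f0; apply: (smean_faithful cf).
have cff : continuous (fun x => f x * 1 : C) := @contM R X f _ cf kcont1.
have E : (fun x => f x * 1) = f by apply/funext => x; rewrite mulr1.
have := un_op cf kcont1; rewrite f0 E.
rewrite crho0.
by move=> h; rewrite -kip_sqr -(ci_sqr K cf) -h rnorm0 expr0n.
Qed.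

Lemma un_lin k f g : continuous f -> continuous g -> un (k *: f + g) = k *: un f + un g.
Proof.
move=> cf cg; rewrite /un -(ciota_lin K _ (Cun cf) (Cun cg)).
congr iota; apply/funext => t; rewrite -[RHS]/(k *: mon 1%g f t + mon 1%g g t) /mon.
by case: eqP => // _; rewrite scaler0 addr0.
Qed.

Lemma unM f g : continuous f -> continuous g -> cmul (un f) (un g) = un (fun x => f x * g x).
Proof.
move=> cf cg; rewrite /un -(ciota_conv K (Cun cf) (Cun cg)).
rewrite (conv_mon_mon act) mulg1; congr iota; congr mon; apply/funext => x.
by rewrite invg1; case: (s_action S) => ->.
Qed.

Lemma un_adj f : continuous f -> cadj (un f) = un (fun x => Num.conj (f x)).
Proof.
move=> cf; rewrite /un -(ciota_adj K (Cun cf)).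
rewrite (ccadj_mon act) invg1; congr iota; congr mon; apply/funext => x.
by case: (s_action S) => ->.
Qed.

(** Pinching on the completion, whose elements have no coefficients. Being a contraction, it
    transfers statements from an approximating finitely supported element. *)
Definition apinch f (u : A) : A := 2^-1 *: (u + cmul (cmul (un f) u) (un f)).

Lemma apinch_iota f a : continuous f -> Cc a -> iota (pinch f a) = apinch f (iota a).
Proof.
move=> cf Ca; have Cf := @Cc_mon R G X 1%g f cf; have hs := s_action S.
have C1 := Cc_conv hs Cf Ca; have C2 := Cc_conv hs C1 Cf; have sC := @Cc_submod R G X.
rewrite /pinch (lin_onZ sC (ciota_lin K)); last exact: (submodD sC Ca C2).
by rewrite (lin_onD (ciota_lin K) Ca C2) (ciota_conv K C1 Cf) (ciota_conv K Cf Ca).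
Qed.

Lemma apinchB f u v : apinch f u - apinch f v = apinch f (u - v).
Proof.
rewrite /apinch (linB (cmul_linearr (un f))) (linB (cmul_linearl (un f))) -scalerBr.
by rewrite opprD addrACA.
Qed.

Lemma apinch_le f u : continuous f -> (forall x, cmod (f x) <= 1) -> rnorm (apinch f u) <= rnorm u.
Proof.
move=> cf hf; have uf := un_le cf ler01 hf.
rewrite rnormZ; have -> : cmod (2^-1 : R[i]) = 2^-1.
  by rewrite -(@cmodC R 2^-1) ?invr_ge0 //; congr cmod; rewrite fmorphV rmorph_nat.
have h : rnorm (cmul (cmul (un f) u) (un f)) <= rnorm u.
  apply: le_trans (rnorm_cmul _ _) _; apply: le_trans (ler_piMr (rnorm_ge0 _) uf) _.
  by apply: le_trans (rnorm_cmul _ _) _; apply: ler_piMl => //; exact: rnorm_ge0.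
have := rnormD u (cmul (cmul (un f) u) (un f)); lra.
Qed.

Definition apinches (L : seq (G * 'I_3)) (u : A) : A := foldr (fun p => apinch (sgn p)) u L.

Lemma sgn_le (p : G * 'I_3) x : cmod (@sgn R G S p x) <= 1.
Proof. by rewrite /sgn; case: ifP => _; rewrite ?cmodN (@cmodC R 1). Qed.

Lemma apinches_iota L a : Cc a -> iota (pinches L a) = apinches L (iota a).
Proof.
move=> Ca; elim: L => //= p L IH; rewrite apinch_iota ?IH //; first exact: sgn_cont.
exact: Cc_pinches.
Qed.

Lemma apinches_dist L u v : rnorm (apinches L u - apinches L v) <= rnorm (u - v).
Proof.
elim: L => //= p L IH; rewrite apinchB; apply: le_trans IH.
by apply: apinch_le => [|x]; [exact: sgn_cont | exact: sgn_le].
Qed.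

Lemma conv_monr a t : conv act a (mon t (fun=> 1)) = fun s => a (s * t^-1)%g.
Proof.
apply/funext => s; apply/funext => x; rewrite /Defs.conv.
rewrite (@fsumE _ _ [:: (s * t^-1)%g]) // ?big_seq1 /mon.
  by rewrite invgM invgK mulgVK eqxx mulr1.
move=> r; rewrite inE => rt; case: eqP => [h|_]; last by rewrite mulr0.
by case/eqP: rt; rewrite -h invgM invgK mulVKg.
Qed.

(** Right multiplication by the monomial at [t^-1] moves the coefficient at [t] to the unit.
    Pinching isolates it there as an element of C(X), which is represented faithfully. *)
Lemma eta_faithful a : Cc a -> iota a = 0 -> a = 0.
Proof.
move=> Ca a0; apply/funext => t; have hs := s_action S.
have Ct := @Cc_mon R G X t^-1%g _ kcont1; have Cb := Cc_conv hs Ca Ct.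
have [L hL] := pinches_ex Cb.
have E : conv act a (mon t^-1%g (fun=> 1)) 1%g = a t by rewrite conv_monr mul1g invgK.
rewrite E in hL; apply: un_inj; first exact: Ca.1.
rewrite /un -hL apinches_iota // (ciota_conv K) // a0 (lin0 (cmul_linearl _)).
elim: L {hL} => //= p L ->; rewrite /apinch (lin0 (cmul_linearr _)) (lin0 (cmul_linearl _)).
by rewrite addr0 scaler0.
Qed.

Theorem eta_cstar_norm : cstar_norm act (fun a => rnorm (iota a)).
Proof.
have hs := s_action S; have sC := @Cc_submod R G X.
split=> [a Ca /rnorm_eq0|a b Ca Cb|k a Ca|a b Ca Cb|a Ca].
- exact: eta_faithful.
- by rewrite (lin_onD (ciota_lin K) Ca Cb) rnormD.
- by rewrite (lin_onZ sC (ciota_lin K)) // rnormZ cmodE.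
- by rewrite (ciota_conv K) // rnorm_cmul.
- by rewrite (ciota_conv K) ?(ciota_adj K) ?rnorm_cadjM //; exact: Cc_adj.
Qed.

Lemma Re_smean f : continuous f -> (complex.Re (smean f))%:C = smean (fun x => (complex.Re (f x))%:C : C).
Proof.
move=> cf; have cj := contJ cf; rewrite Re_half -smean_conj // -[X in _ * (X + _)]mul1r -smean_lin //.
rewrite -smeanZ; last exact: (@contD R X _ _ (@contZ R X 1 f cf) cj).
congr smean; apply/funext => x; rewrite Re_half.
by rewrite -[LHS]/(2^-1 * (1 *: f x + Num.conj (f x))) scale1r.
Qed.

(* A function that is negative somewhere has negative integral against the
   square of its negative part [n]; since [n] is bounded, [n ^ 4] is bounded by
   a multiple of [n ^ 3]. *)
Lemma smean_pos f : continuous f ->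
  (forall g, continuous g -> 0 <= complex.Re (smean (fun x => f x * `|g x| ^+ 2 : C))) ->
  forall x, 0 <= complex.Re (f x).
Proof.
move=> cf hf; pose r x := complex.Re (f x).
pose n x : R := (`|r x| - r x) / 2.
have n0 x : 0 <= n x by rewrite divr_ge0 // subr_ge0 ler_norm.
have cr : continuous (fun x => (r x)%:C : C) := contRe cf.
have cn : continuous (fun x => (n x)%:C : C).
  have -> : (fun x => (n x)%:C : C) = fun x => 2^-1 * (`|(r x)%:C| - (r x)%:C).
    apply/funext => x; rewrite cmodE cmodR -rmorphB /n mulrC rmorphM fmorphV rmorph_nat.
    by [].
  exact: (@contM R X _ _ (@cont_cst R X 2^-1) (contB (cont_norm cr) cr)).
have rn x : r x * n x ^+ 2 = - n x ^+ 3.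
  rewrite /n; have [h|h] := ger0P (r x); first by rewrite subrr mul0r !expr0n /= mulr0 oppr0.
  by field.
have cn3 : continuous (fun x => (n x ^+ 3)%:C : C).
  have -> : (fun x => (n x ^+ 3)%:C : C) = fun x => (n x)%:C * ((n x)%:C * (n x)%:C).
    by apply/funext => x; rewrite -!rmorphM exprS expr2.
  exact: (@contM R X _ _ cn (@contM R X _ _ cn cn)).
have cn2 : continuous (fun x => (n x ^+ 2)%:C : C).
  have -> : (fun x => (n x ^+ 2)%:C : C) = fun x => (n x)%:C * (n x)%:C.
    by apply/funext => x; rewrite -!rmorphM expr2.
  exact: (@contM R X _ _ cn cn).
have n3 : smean (fun x => (n x ^+ 3)%:C : C) = 0.
  apply/eqP; rewrite eq_le; apply/andP; split; last by apply: (smean_ge0 cn3) => x; rewrite ler0c exprn_ge0.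
  rewrite -oppr_ge0 -mulN1r -(smeanZ _ cn3).
  have := hf _ cn; rewrite -lecR Re_smean; last exact: (@contM R X f _ cf (cont_abs2 cn)).
  rewrite (_ : (fun x => _) = (-1 *: (fun x => (n x ^+ 3)%:C : C))) //.
  apply/funext => x; rewrite -[RHS]/(-1 *: (n x ^+ 3)%:C) scaleN1r -rmorphN -rn; congr (_%:C).
  rewrite (ger0_norm (_ : 0 <= (n x)%:C)) ?ler0c // -rmorphXn /r.
  by case: (f x) => p q; rewrite /= mulr0 subr0.
have [B B0 hB] := s_bounded cn.
have /(smean_faithful cn2) n2 : smean (fun x => `|(n x ^+ 2)%:C| ^+ 2 : C) = 0.
  apply: (smean_ge_eq0 (B := B) cn3 (cont_abs2 cn2) _ _ n3) => x; first by rewrite exprn_ge0.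
  rewrite (ger0_norm (_ : 0 <= (n x ^+ 2)%:C)) ?ler0c ?exprn_ge0 // -rmorphXn -rmorphM lecR.
  rewrite -exprM (exprS _ 3) ler_wpM2r ?exprn_ge0 //.
  by have := hB x; rewrite cmodC.
move=> x; have := congr1 (fun h => h x) n2 => /= /complexI /eqP.
rewrite expf_eq0 /= mulf_eq0 invr_eq0 pnatr_eq0 orbF subr_eq0 => /eqP h.
by rewrite -/(r x) -h normr_ge0.
Qed.

(** For a real symmetry [f] one has [<f u f h, h> = <u f h, f h>], so pinching preserves positivity
    of the form. After all pinchings only multiplication by [a 1%g] remains, to which [smean_pos]
    applies. *)
Lemma coef_pos a : Cc a ->
  (forall h : H, 0 <= complex.Re (inner H (crho (iota a) h) h)) -> forall x, 0 <= complex.Re (a 1%g x).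
Proof.
move=> Ca ha; have [L hL] := pinches_ex Ca.
have pL : forall h, 0 <= complex.Re (inner H (crho (apinches L (iota a)) h) h).
  elim: L {hL} => //= p L IH h; set u := apinches L (iota a).
  have cp := @sgn_cont R G S p.
  have sa : cadj (un (sgn p)) = un (sgn p).
    rewrite un_adj //; congr un; apply/funext => x.
    by rewrite /sgn; case: ifP => _; rewrite ?rmorphN rmorph1.
  have e2 : (2^-1 : R[i]) = (2^-1 : R)%:C by rewrite fmorphV rmorph_nat.
  have E : crho (apinch (sgn p) u) h = 2^-1 *: (crho u h + crho (un (sgn p)) (crho u (crho (un (sgn p)) h))).
    by rewrite crhoZ crhoD !crho_mul.
  rewrite E iZl iDl; have -> : inner H (crho (un (sgn p)) (crho u (crho (un (sgn p)) h))) h =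
      inner H (crho u (crho (un (sgn p)) h)) (crho (un (sgn p)) h).
    by have := crho_adj (un (sgn p)) (crho u (crho (un (sgn p)) h)) h; rewrite sa.
  rewrite e2; have := IH h; have := IH (crho (un (sgn p)) h).
  by case: (inner _ _ _) => p1 p2; case: (inner _ _ _) => q1 q2 /= h1 h2; rewrite mul0r subr0 mulr_ge0 ?addr_ge0 ?invr_ge0.
apply: smean_pos (Ca.1 1%g) _ => g cg.
have := pL (ci K g); rewrite -apinches_iota // hL -/(un _) (un_op (Ca.1 1%g) cg).
rewrite (ci_inner K (@contM R X _ g (Ca.1 1%g) cg) cg).
congr (0 <= complex.Re _); congr smean; apply/funext => x.
by rewrite normCK mulrA.
Qed.

End KoopmanFacts.

(** * Domination of the reduced norm *)

Section RegularFacts.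
Context (R : realType) (G : groupType) (S : system R G).
Local Notation X := (sX S).
Local Notation C := (R[i]^o).
Local Notation Cc := (@Cc R G X).
Local Notation act := (@sact R G S).
Local Notation Y := (G * X)%type.
Context (L : @covalg R G X act Y (@rtau G X) (@rpr G X act) (@finsupp R G X) (@fip R G X)).
Implicit Types (a b : G -> X -> C) (f : X -> C) (u v : Y -> C) (x : X).
Local Notation rrep := (rep (@rtau G X) (@rpr G X act)).

Lemma fip_sqr u : finsupp u -> fip u u = (\sum_(p \in [set: Y]) cmod (u p) ^+ 2)%:C.
Proof.
move=> fu; have [s [us hs]] := finsuppP fu; rewrite (fipE _ us hs).
rewrite (fsumE us) => [|p /hs ->]; last by rewrite cmod0 expr0n.
by rewrite rmorph_sum; apply: eq_bigr => p _; rewrite -cmod_sqr.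
Qed.

Lemma l2norm_ci u : finsupp u -> l2norm u = rnorm (ci L u).
Proof.
move=> fu; rewrite /l2norm -[RHS]ger0_norm ?rnorm_ge0 // -sqrtr_sqr; congr Num.sqrt.
by apply: complexI; rewrite (ci_sqr L fu) (fip_sqr fu).
Qed.

(** The supremum defining the reduced norm involves finitely supported vectors only; their density
    turns it into the operator norm on the completion. *)
Lemma reduced_normE a : Cc a -> reduced_norm act a = rnorm (ciota L a).
Proof.
move=> Ca; rewrite /reduced_norm; set T := [set _ | _ in _].
have hT u : finsupp u -> rnorm (ci L u) <= 1 -> T (rnorm (crho (ciota L a) (ci L u))).
  move=> fu u1; exists u; first by rewrite /= l2norm_ci.
  by rewrite crho_iota // -l2norm_ci //; exact: (crep_D L Ca fu).
have ub t : T t -> t <= rnorm (ciota L a).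
  case=> u [fu]; rewrite l2norm_ci // => u1 <-.
  rewrite l2norm_ci; last exact: (crep_D L Ca fu).
  rewrite -[X in ci L X]/(rrep a u) -crho_iota //.
  by rewrite (le_trans (crho_le _ _)) // ler_piMr ?rnorm_ge0.
have f0 : finsupp (0 : Y -> C) := (@finsupp_submod R G X).1.
have T0 : T 0.
  have ci0 : ci L 0 = 0 by rewrite (lin_on0 (@finsupp_submod R G X) (ci_lin L)).
  by have := hT 0 f0; rewrite ci0 (lin0 (crho_lin _)) !rnorm0; exact.
have hs : has_sup T by split; [exists 0 | exists (rnorm (ciota L a))].
apply/eqP; rewrite eq_le; apply/andP; split; first by apply: ge_sup => //; exists 0.
have s0 : 0 <= sup T by apply: ub_le_sup => //; case: hs.
apply: rnorm_dense => // u fu.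
have [n0|n0] := eqVneq (rnorm (ci L u)) 0.
  by rewrite (rnorm_eq0 n0) (lin0 (crho_lin _)) rnorm0 mulr0.
have n1 : 0 < rnorm (ci L u) by rewrite lt_neqAle eq_sym n0 rnorm_ge0.
have sf := @finsupp_submod R G X.
have := ub_le_sup hs.2 (hT ((rnorm (ci L u))^-1%:C *: u) (submodZ sf _ fu) _).
rewrite (lin_onZ sf (ci_lin L)) // (linZ (crho_lin _)) !rnormZ cmodC ?invr_ge0 ?rnorm_ge0 //.
by rewrite mulVf // lexx => /(_ isT); rewrite mulrC ler_pdivrMr.
Qed.

Definition dlt (p : Y) : Y -> C := fun q => if q == p then 1 else 0.

Lemma finsupp_dlt p : finsupp (dlt p).
Proof.
by apply: (@finsupp_intro R G X _ [:: p]) => q; rewrite inE /dlt => /negbTE ->.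
Qed.

Lemma fip_dltr u p : fip u (dlt p) = u p.
Proof.
rewrite /fip (@fsumE _ _ [:: p]) // ?big_seq1 /dlt ?eqxx ?rmorph1 ?mulr1 // => q.
by rewrite inE => /negbTE ->; rewrite rmorph0 mulr0.
Qed.

Lemma fip_dlt p : fip (dlt p) (dlt p) = 1.
Proof. by rewrite fip_dltr /dlt eqxx. Qed.

Lemma rep_dlt a r x p : rrep a (dlt (r, x)) p =
  if p.2 == x then a (p.1 * r^-1)%g (act p.1 x) else 0.
Proof.
rewrite /rep (@fsumE _ _ [:: (p.1 * r^-1)%g]) // ?big_seq1 /dlt /rtau /rpr => [|s].
  by rewrite xpair_eqE invgM invgK mulgVK eqxx /=; case: eqP => [->|_]; rewrite ?mulr1 ?mulr0.
rewrite inE xpair_eqE => hs; case: eqP => [h|_]; last by rewrite mulr0.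
by case/eqP: hs; rewrite -h invgM invgK mulVKg.
Qed.

Lemma fip_rep a x : fip (rrep a (dlt (1%g, x))) (dlt (1%g, x)) = a 1%g x.
Proof.
rewrite fip_dltr rep_dlt eqxx invg1 mulg1.
by case: (s_action S) => ->.
Qed.

Lemma inner_dlt a x : Cc a ->
  inner (ch L) (crho (ciota L a) (ci L (dlt (1%g, x)))) (ci L (dlt (1%g, x))) = a 1%g x.
Proof.
move=> Ca; have fd := finsupp_dlt (1%g, x).
by rewrite crho_iota // (ci_inner L) ?fip_rep //; exact: (crep_D L Ca fd).
Qed.

Definition fibre x u : Y -> C := fun p => if p.2 == x then u p else 0.

Lemma rep_fibre a x u : rrep a (fibre x u) = fibre x (rrep a u).
Proof.
apply/funext => p; rewrite /rep /fibre /rtau /=; case: eqP => // _.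
by rewrite fsbig1 // => s _; rewrite mulr0.
Qed.

Lemma finsupp_fibre x u : finsupp u -> finsupp (fibre x u).
Proof.
move=> fu; have [s [_ hs]] := finsuppP fu.
by apply: (@finsupp_intro R G X _ s) => p /hs h; rewrite /fibre h; case: ifP.
Qed.

Lemma fip_fibre u (w : seq X) : finsupp u -> uniq w -> (forall p, p.2 \notin w -> u p = 0) ->
  fip u u = \sum_(x <- w) fip (fibre x u) (fibre x u).
Proof.
move=> fu uw hw; have [s [us hs]] := finsuppP fu; rewrite (fipE _ us hs).
under [RHS]eq_bigr => x _.
  rewrite (@fipE _ _ _ _ _ s) // => [|p /hs h]; last by rewrite /fibre h; case: ifP.
  over.
rewrite exchange_big; apply: eq_bigr => p _; rewrite /fibre.
have [pw|pw] := boolP (p.2 \in w).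
  rewrite (bigD1_seq p.2) //= eqxx big1 ?addr0 // => x /negbTE.
  by rewrite eq_sym => ->; rewrite mul0r.
by rewrite hw // mul0r big1 // => x _; case: ifP => _; rewrite ?hw // mul0r.
Qed.

Context (K : @covalg R G X act X act id [set f : X -> C | continuous f] (@kip R G S)).

(* With [u = b delta] for a constant-coefficient [b], the claim is that the
   coefficient at the unit of [N^2 b*b - (ab)*(ab)] is nonnegative, where [N] is
   the norm of [a]. *)
Lemma fip_rep_le a x u : Cc a -> finsupp u -> (forall p, p.2 != x -> u p = 0) ->
  fip (rrep a u) (rrep a u) <= (rnorm (ciota K a) ^+ 2)%:C * fip u u.
Proof.
move=> Ca fu hu; have [s [us hs]] := finsuppP fu; have hact := s_action S.
pose b : G -> X -> C := fun t _ => u (t, x).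
have Cb : Cc b.
  apply: (@Cc_intro R G X _ (map fst s)) => [t|t ht]; first exact: cont_cst.
  apply/funext => y; rewrite /b hs //; apply: contra ht => h.
  by apply/mapP; exists (t, x).
set N := rnorm (ciota K a).
pose d : G -> X -> C := (N ^+ 2)%:C *: conv act (ccadj act b) b -
  conv act (ccadj act (conv act a b)) (conv act a b).
have Cab := Cc_conv hact Ca Cb; have Cbb := Cc_conv hact (Cc_adj hact Cb) Cb.
have Cabab := Cc_conv hact (Cc_adj hact Cab) Cab; have sC := @Cc_submod R G X.
have Cd : Cc d by apply: submodB => //; apply: submodZ.
have dx : fip u u = conv act (ccadj act b) b 1%g x /\
   fip (rrep a u) (rrep a u) = conv act (ccadj act (conv act a b)) (conv act a b) 1%g x.
  have fd := finsupp_dlt (1%g, x).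
  have E : u = rrep b (dlt (1%g, x)).
    apply/funext => -[t y]; rewrite rep_dlt invg1 mulg1 /=; case: eqP => [->//|/eqP yx].
    exact: hu.
  have e c : Cc c -> fip (rrep c (dlt (1%g, x))) (rrep c (dlt (1%g, x))) =
      conv act (ccadj act c) c 1%g x.
    move=> Cc'; have Cs := Cc_adj hact Cc'.
    have fc := crep_D L Cc' fd.
    rewrite -(inner_dlt x (Cc_conv hact Cs Cc')) (ciota_conv L) // (ciota_adj L) //.
    by rewrite crho_mul crho_adj crho_iota // (ci_inner L).
  split; first by rewrite {1 2}E e.
  have Er : rrep a u = rrep (conv act a b) (dlt (1%g, x)).
    rewrite E (@rep_conv R G X act Y) //.
    - by move=> s' t [r y]; rewrite /rtau /= mulgA.
    - by move=> s' [t y]; rewrite /rpr /=; case: hact => _ ->.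
  by rewrite Er e.
have := @coef_pos R G S K d Cd _ x; rewrite dx.1 dx.2.
have r0 : 0 <= fip u u /\ 0 <= fip (rrep a u) (rrep a u).
  have fr := crep_D L Ca fu.
  by rewrite !fip_sqr // !ler0c; split; apply: fsumr_ge0 => p _; exact: exprn_ge0 (cmod_ge0 _).
rewrite dx.1 dx.2 in r0.
have dE : d 1%g x = (N ^+ 2)%:C * conv act (ccadj act b) b 1%g x -
   conv act (ccadj act (conv act a b)) (conv act a b) 1%g x by [].
rewrite dE; move: r0 => [r1 r2] h.
rewrite -subr_ge0 -[leRHS]RRe_real ?ler0c; last first.
  by rewrite rpredB // ?rpredM // ger0_real // ler0c exprn_ge0 // rnorm_ge0.
apply: h => h.
(* At a vector [h] the form of [d] is [N^2 |b h|^2 - |a b h|^2], nonnegative by the choice of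
   [N]. *)
rewrite /d (lin_onB (ciota_lin K)) //; last exact: submodZ.
rewrite (lin_onZ sC (ciota_lin K)) // !(ciota_conv K) //; try exact: Cc_adj.
rewrite !(ciota_adj K) // (ciota_conv K) // crhoB crhoZ.
rewrite iBl iZl !crho_mul !crho_adj -!crho_mul !inner_sqr -rmorphM -rmorphB /=.
rewrite subr_ge0 -exprMn ler_sqr ?nnegrE ?mulr_ge0 ?rnorm_ge0 // crho_mul.
exact: crho_le.
Qed.

(** The regular representation is the orthogonal sum of its fibres over the points of [X], so
    vectors supported in one fibre suffice. *)
Theorem reduced_le a : Cc a -> rnorm (ciota L a) <= rnorm (ciota K a).
Proof.
move=> Ca; apply: ciota_le => //; first exact: rnorm_ge0.
move=> u fu; have fr := crep_D L Ca fu.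
have [s [us hs]] := finsuppP fu; have [r [ur hr]] := finsuppP fr.
pose w := undup (map snd s ++ map snd r).
have hw p : p.2 \notin w -> u p = 0 /\ rrep a u p = 0.
  rewrite mem_undup mem_cat negb_or => /andP[h1 h2]; split.
    by apply: hs; apply: contra h1; exact: map_f.
  by apply: hr; apply: contra h2; exact: map_f.
rewrite !(@fip_fibre _ w) ?undup_uniq // => [|p /hw [] //|p /hw [] //].
rewrite mulr_sumr; apply: ler_sum => x _; rewrite -rep_fibre.
by apply: (@fip_rep_le a x) => // [|p /negbTE h]; [exact: finsupp_fibre | rewrite /fibre h].
Qed.

End RegularFacts.

(** * The canonical conditional expectation *)

Section Expectation.
Context (R : realType) (G : groupType) (S : system R G).
Local Notation X := (sX S).
Local Notation C := (R[i]^o).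
Local Notation Cc := (@Cc R G X).
Local Notation act := (@sact R G S).
Local Notation Y := (G * X)%type.
Context (L : @covalg R G X act Y (@rtau G X) (@rpr G X act) (@finsupp R G X) (@fip R G X)).
Implicit Types (a b : G -> X -> C) (f : X -> C) (x : X) (p q : ca L).
Local Notation rrep := (rep (@rtau G X) (@rpr G X act)).
Local Notation dl := (fun y : Y => ci L (@dlt R G S y)).

Definition expectation p : X -> C := fun x => inner (ch L) (crho p (dl (1%g, x))) (dl (1%g, x)).

Lemma rnorm_dlt (y : Y) : rnorm (dl y) = 1.
Proof.
have : rnorm (dl y) ^+ 2 = 1.
  by apply: complexI; rewrite (ci_sqr L (@finsupp_dlt R G S y)) fip_dlt.
move=> /eqP; rewrite sqrf_eq1 => /orP[/eqP //|/eqP h].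
by have := rnorm_ge0 (dl y); rewrite h; lra.
Qed.

Lemma expectation_le p x : cmod (expectation p x) <= rnorm p.
Proof.
rewrite (le_trans (inner_CS _ _)) // (rnorm_dlt (1%g, x)) mulr1.
by rewrite (le_trans (crho_le _ _)) // (rnorm_dlt (1%g, x)) mulr1.
Qed.

Lemma expectation_linear : linear expectation.
Proof. by move=> k p q; apply/funext => x; rewrite /expectation crho_linl ilin. Qed.

Lemma expectation_iota a : Cc a -> expectation (ciota L a) = a 1%g.
Proof. by move=> Ca; apply/funext => x; exact: inner_dlt. Qed.

Lemma expectation_cont p : continuous (expectation p).
Proof.
apply/contP => x d d0; have d3 : 0 < d / 3 by rewrite divr_gt0.
have [a Ca ha] := ciota_dense p d3.
have /contP := Ca.1 1%g; move=> /(_ x _ d3); apply: filterS => y /= hy.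
have e z : cmod (expectation p z - a 1%g z) < d / 3.
  apply: le_lt_trans ha; rewrite -(expectation_iota Ca).
  have -> : expectation p z - expectation (ciota L a) z = expectation (p - ciota L a) z.
    by rewrite (linB expectation_linear).
  exact: expectation_le.
have h1 := e x; have h2 := e y.
have r1 := rnorm_dist (a 1%g y : C) (expectation p y) (expectation p x).
have r2 := rnorm_dist (a 1%g x : C) (a 1%g y) (expectation p x).
have r3 := rnormB (a 1%g x : C) (expectation p x).
rewrite !rnorm_cmod in r1 r2 r3; lra.
Qed.

Lemma expectation_pos p x : expectation (cmul (cadj p) p) x = ((rnorm (crho p (dl (1%g, x)))) ^+ 2)%:C.
Proof. by rewrite /expectation crho_mul crho_adj inner_sqr. Qed.

Lemma unit_dlt f x : continuous f ->
  crho (ciota L (at_unit f)) (dl (1%g, x)) = f x *: dl (1%g, x).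
Proof.
move=> cf; have Cf : Cc (at_unit f) := @Cc_mon R G X 1%g f cf; have fd := @finsupp_dlt R G S (1%g, x).
rewrite (crho_iota L Cf fd) -(lin_onZ (@finsupp_submod R G X) (ci_lin L)) //.
congr (ci L); apply/funext => -[t y]; rewrite rep_dlt /=.
rewrite -[RHS]/(f x * (if (t, y) == (1%g, x) then 1 else 0)) xpair_eqE invg1 mulg1 /at_unit.
case: (t =P 1%g) => [->|_] /=; last by rewrite mulr0; case: ifP.
by case: (s_action S) => -> _ _; case: ifP => _; rewrite ?mulr1 ?mulr0.
Qed.

Lemma expectation_unitr f p : continuous f ->
  expectation (cmul p (ciota L (at_unit f))) = fun x => expectation p x * f x.
Proof.
move=> cf; apply/funext => x.
by rewrite /expectation crho_mul unit_dlt // (linZ (crho_lin p)) iZl mulrC.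
Qed.

Lemma cadj_unit f : continuous f ->
  cadj (ciota L (at_unit f)) = ciota L (at_unit (fun x => Num.conj (f x))).
Proof.
move=> cf; rewrite -(ciota_adj L) ?(ccadj_mon act) ?invg1; last exact: (@Cc_mon R G X 1%g f cf).
by congr (ciota L (mon _ _)); apply/funext => x; case: (s_action S) => ->.
Qed.

Lemma expectation_unitl f p : continuous f ->
  expectation (cmul (ciota L (at_unit f)) p) = fun x => f x * expectation p x.
Proof.
move=> cf; apply/funext => x; rewrite /expectation crho_mul -[ciota L (at_unit f)]cadjK crho_adj.
by rewrite (cadj_unit cf) (unit_dlt x (contJ cf)) iZr conjCK.
Qed.

(* Right translations by [G] are unitary and commute with the regular
   representation. *)
Lemma crho_dlt_translate p t x : rnorm (crho p (dl (t, x))) = rnorm (crho p (dl (1%g, act t x))).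
Proof.
have hact := s_action S.
have iota a : Cc a -> rnorm (crho (ciota L a) (dl (t, x))) = rnorm (crho (ciota L a) (dl (1%g, act t x))).
  move=> Ca; have f1 := @finsupp_dlt R G S (t, x); have f2 := @finsupp_dlt R G S (1%g, act t x).
  apply/eqP; rewrite -(eqrXn2 (n := 2)) ?rnorm_ge0 //; apply/eqP/complexI.
  rewrite !crho_iota // !ci_sqr //; try exact: (crep_D L Ca).
  rewrite /fip [RHS](reindex_fsbigT (fun p : Y => ((p.1 * t^-1)%g, act t p.2))); last first.
    exists (fun p : Y => ((p.1 * t)%g, act t^-1%g p.2)) => -[r y] /=; case: hact => a1 aM _.
      by rewrite mulgVK -aM mulVg a1.
    by rewrite mulgK -aM mulgV a1.
  apply: eq_fsbigr => -[r y] _; rewrite !rep_dlt /=.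
  have -> : (act t y == act t x) = (y == x).
    apply/eqP/eqP => [h|-> //]; case: hact => a1 aM _.
    by rewrite -[y]a1 -(mulVg t) aM h -aM mulVg a1.
  by case: eqP => // _; case: hact => _ aM _; rewrite invg1 mulg1 -aM mulgVK.
apply/eqP; rewrite eq_le; apply/andP; split; apply/ler_addgt0Pr => e e0;
  have e2 : 0 < e / 2 by rewrite divr_gt0.
all: have [a Ca ha] := ciota_dense p e2.
all: have hd (y : Y) : `|rnorm (crho p (dl y)) - rnorm (crho (ciota L a) (dl y))| <= e / 2 by
  rewrite (le_trans (rnorm_diff _ _)) // -crhoB (le_trans (crho_le _ _)) // (rnorm_dlt y) mulr1 ltW.
all: have := hd (t, x); have := hd (1%g, act t x); have := iota a Ca; rewrite !ler_norml.
all: by move=> -> /andP[h1 h2] /andP[h3 h4]; clear -h1 h2 h3 h4; lra.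
Qed.

(** The hypothesis says that [p] annihilates the basis vectors at [(1, x)]. Translation carries this
    to [(t, x)], because the first coordinate can be absorbed into the point of [X]; finite
    combinations of basis vectors are dense. *)
Lemma expectation_faithful p : expectation (cmul (cadj p) p) = 0 -> p = 0.
Proof.
move=> h; have d0 (y : Y) : crho p (dl y) = 0.
  case: y => t x; apply: rnorm_eq0; rewrite crho_dlt_translate; apply/eqP.
  rewrite -sqrf_eq0 -(inj_eq (@complexI R)) -expectation_pos h.
  by [].
apply: rnorm_eq0; apply/eqP; rewrite eq_le rnorm_ge0 andbT; apply: rnorm_dense => // u fu.
have [s [us hs]] := finsuppP fu.
have E : u = \sum_(y <- s) u y *: @dlt R G S y.
  apply/funext => y; rewrite fct_sumE; have [ys|ys] := boolP (y \in s).
    rewrite (bigD1_seq y) //= big1 => [|z /negbTE zy].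
      by rewrite addr0 -[RHS]/(u y * @dlt R G S y y) /dlt eqxx mulr1.
    by rewrite -[LHS]/(u z * @dlt R G S z y) /dlt eq_sym zy mulr0.
  rewrite hs // big_seq big1 // => z zs; rewrite -[LHS]/(u z * @dlt R G S z y) /dlt.
  case: eqP => [yz|_]; last by rewrite mulr0.
  by rewrite yz zs in ys.
have sf := @finsupp_submod R G X.
rewrite E (lin_on_sum sf (ci_lin L)) => [|y]; last exact: (submodZ sf _ (@finsupp_dlt R G S y)).
rewrite (lin_sum (crho_lin p)) big1 ?rnorm0 ?mul0r // => y _.
rewrite (lin_onZ sf (ci_lin L)); last exact: finsupp_dlt.
by rewrite (linZ (crho_lin p)) (d0 y) scaler0.
Qed.

Theorem canonical_expectation : is_canonical_expectation (ciota L) expectation.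
Proof.
split; split.
- exact: expectation_cont.
- by move=> k p q; exact: expectation_linear.
- by move=> p x; rewrite (cmodE (expectation p x)) normE lecR; exact: expectation_le.
- by move=> p x; rewrite expectation_pos ler0c exprn_ge0 ?rnorm_ge0.
- by move=> f p cf; exact: expectation_unitl.
- by move=> f p cf; exact: expectation_unitr.
- exact: expectation_faithful.
- exact: expectation_iota.
Qed.

End Expectation.

(** * Geometric convergence *)

Section Geometric.
Context (R : realType).

Lemma expr_small (c : R) : 0 <= c -> c < 1 -> forall e : R, 0 < e ->
  exists N, forall n, (N <= n)%N -> c ^+ n <= e.
Proof.
move=> c0 c1 e e0; have : `|c| < 1 by rewrite ger0_norm.
move=> /cvg_expr /cvgrPdist_le /(_ e e0) [N _ hN]; exists N => n /hN /=.
by rewrite sub0r normrN ger0_norm // exprn_ge0.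
Qed.

Lemma geometric_cvs (V : completeNormedModType R[i]) (u : nat -> V) (c M : R) :
  0 <= c -> c < 1 -> 0 <= M -> (forall n, rnorm (u n.+1 - u n) <= M * c ^+ n) ->
  exists l, cvs u l.
Proof.
move=> c0 c1 M0 hu; have d0 : 0 < 1 - c by rewrite subr_gt0.
have hk n k : rnorm (u (n + k)%N - u n) <= M / (1 - c) * (c ^+ n - c ^+ (n + k)).
  elim: k => [|k IH]; first by rewrite addn0 !subrr rnorm0 mulr0.
  rewrite addnS; apply: le_trans (rnorm_dist (u (n + k)%N) _ _) _.
  apply: le_trans (lerD (hu _) IH) _; rewrite le_eqVlt; apply/orP; left; apply/eqP.
  by rewrite exprS; field; rewrite gt_eqF.
have hn n k : rnorm (u (n + k)%N - u n) <= M / (1 - c) * c ^+ n.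
  apply: le_trans (hk n k) _; rewrite ler_wpM2l ?divr_ge0 ?(ltW d0) // gerBl exprn_ge0 //.
apply: complete_seq => e e0; set B := M / (1 - c) in hn.
have B0 : 0 <= B by rewrite divr_ge0 // ltW.
have B1 : 0 < 2 * B + 1 by lra.
have [N hN] := expr_small c0 c1 (divr_gt0 e0 B1).
have hN' : B * c ^+ N <= B * (e / (2 * B + 1)) by rewrite ler_wpM2l // hN.
have hB : (2 * B + 1) * (e / (2 * B + 1)) = e by rewrite mulrC divfK ?gt_eqF.
have e1 : 0 < e / (2 * B + 1) by rewrite divr_gt0.
have h k : (N <= k)%N -> rnorm (u k - u N) <= B * c ^+ N by move=> hk'; have := hn N (k - N)%N; rewrite subnKC.
exists N => m n /h h1 /h h2; apply: le_trans (rnorm_dist (u N) _ _) _.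
by rewrite (rnormB (u N)); nra.
Qed.

End Geometric.

Lemma rnormD_sqr (R : realType) (H : hilbertSpace R) (x y : H) (s t : R) : inner H x y = s%:C ->
  rnorm (x + t%:C *: y) ^+ 2 = rnorm x ^+ 2 + 2 * t * s + t ^+ 2 * rnorm y ^+ 2.
Proof.
move=> h; have h' : inner H y x = s%:C by rewrite iconj h conj_conjc conjc_real.
apply: complexI; rewrite -inner_sqr iDl !iDr !iZl !iZr h h' !inner_sqr conj_conjc conjc_real.
by rewrite -!rmorphM -!rmorphD /=; congr (_%:C); ring.
Qed.

(** * The unit, a resolvent and norm-controlled lifts *)

Section Unit.
Context (R : realType) (G : groupType) (S : system R G).
Local Notation X := (sX S).
Local Notation C := (R[i]^o).
Local Notation act := (@sact R G S).
Context (K : @covalg R G X act X act id [set f : X -> C | continuous f] (@kip R G S)).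
Local Notation A := (ca K).
Implicit Types a u v : A.

Definition cone : A := un K (fun=> 1).

Lemma crho_cone x : crho cone x = x.
Proof.
have l1 : linear (id : ch K -> ch K) by [].
apply: (@dense_eq R _ _ _ (ci K) (@ci_dense _ _ _ _ _ _ _ _ _ K) _ (crho cone) id (rnorm cone) 1) => //.
- exact: crho_lin.
- exact: rnorm_ge0.
- exact: crho_le.
- by move=> y; rewrite mul1r.
- move=> f cf; rewrite /cone (un_op K (@kcont1 R G S) cf).
  by congr (ci K); apply/funext => x'; rewrite mul1r.
Qed.

Lemma cone_mul u : cmul cone u = u.
Proof. by apply: crho_inj; apply/funext => x; rewrite crho_mul crho_cone. Qed.

Lemma mul_cone u : cmul u cone = u.
Proof. by apply: crho_inj; apply/funext => x; rewrite crho_mul crho_cone. Qed.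

Lemma rnorm_crho_le u (M : R) : 0 <= M -> (forall x, rnorm (crho u x) <= M * rnorm x) -> rnorm u <= M.
Proof. by move=> M0 h; rewrite -crho_norm; exact: opnorm_le. Qed.

Lemma inner_cadjM a x : inner _ (crho (cmul (cadj a) a) x) x = (rnorm (crho a x) ^+ 2)%:C.
Proof. by rewrite crho_mul crho_adj inner_sqr. Qed.

(** A Neumann series for the inverse of [1 + a^* a]. With [q = t (m - c)] one has
    [1 - q = t (1 + c)], and [0 <= c <= m] keeps the norm of [q] below 1. *)
Lemma resolvent a : exists r, r + cmul (cmul (cadj a) a) r = cone.
Proof.
set c := cmul (cadj a) a; set m := rnorm a ^+ 2.
have m0 : 0 <= m by exact: sqr_ge0.
have m1 : 0 < 1 + m by lra.
(* This value makes the constant term of [1 - q] equal to [t], that is [1 - t m = t]. *)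
pose t := (1 + m)^-1; have t0 : 0 < t by rewrite invr_gt0.
have tm : t * m = 1 - t by rewrite /t; field; rewrite gt_eqF.
pose q := t%:C *: (m%:C *: cone - c).
have hq : rnorm q <= t * m.
  rewrite rnormZ cmodC ?(ltW t0) // ler_wpM2l ?(ltW t0) //; apply: rnorm_crho_le => // x.
  rewrite -ler_sqr ?nnegrE ?mulr_ge0 ?rnorm_ge0 // crhoB crhoZ crho_cone.
  (* As [c = a^* a], [|c x|^2 <= m |a x|^2 = m <c x, x>]; expanding the square then bounds
     [|m x - c x|] by [m |x|]. *)
  have -> : m%:C *: x - crho c x = - (crho c x + (- m)%:C *: x) by rewrite rmorphN scaleNr opprB addrC.
  rewrite rnormN (rnormD_sqr _ (inner_cadjM a x)).
  have h : rnorm (crho c x) ^+ 2 <= m * rnorm (crho a x) ^+ 2.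
    rewrite -exprMn ler_sqr ?nnegrE ?mulr_ge0 ?rnorm_ge0 // crho_mul -(rnorm_cadj a).
    exact: crho_le.
  have := mulr_ge0 m0 (sqr_ge0 (rnorm (crho a x))); rewrite exprMn; lra.
pose s := fix s n := if n is n'.+1 then cone + cmul q (s n') else 0.
have sE n : s n.+1 = cone + cmul q (s n) by [].
have [||||l hl] := @geometric_cvs R A s (t * m) (rnorm cone).
- by rewrite mulr_ge0 // ltW.
- by rewrite tm; lra.
- exact: rnorm_ge0.
- elim=> [|n IH]; first by rewrite sE /= (lin0 (cmul_linearr q)) addr0 subr0 mulr1.
  rewrite [s n.+2]sE {2}[s n.+1]sE opprD addrACA subrr add0r -(linB (cmul_linearr q)).
  apply: le_trans (rnorm_cmul _ _) _; rewrite exprS mulrCA.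
  by apply: ler_pM; rewrite ?rnorm_ge0.
have El : l = cone + cmul q l.
  have h1 : cvs (fun n => s n.+1) l.
    by move=> e e0; have [N hN] := hl e e0; exists N => n hn; apply: hN; apply: leqW.
  apply: cvs_eq h1 (cvsD (cvs_cst cone) (cvs_op (cmul_linearr q) (rnorm_ge0 q) (rnorm_cmul q) hl)).
  by move=> n; exact: sE.
exists (t%:C *: l).
have -> : cone = l - cmul q l by rewrite {1}El addrK.
rewrite /q (linZ (cmul_linearl l)) (linB (cmul_linearl l)) (linZ (cmul_linearl l)) cone_mul.
rewrite (linZ (cmul_linearr c)) scalerBr scalerA -rmorphM tm rmorphB scalerBl scale1r.
by rewrite -[l - _ - _]addrA -opprD opprB [in RHS]addrC subrK.
Qed.

(** [a'] is [a] times the inverse of [1 + a^* a]. Its norm is bounded however large [a] is, and the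
    defect [a a^* a'] is quadratically small in any homomorphic image where [a] is small. This
    supplies lifts of controlled norm without the theory of quotient C*-algebras. *)
Lemma bounded_lift a : exists a', rnorm a' <= 1 /\ a = a' + cmul (cmul a (cadj a)) a'.
Proof.
have [r hr] := resolvent a; exists (cmul a r); split; last first.
  rewrite -{1}[a]mul_cone -hr (linD (cmul_linearr a)).
  by rewrite !cmulA.
apply: rnorm_crho_le => // x; rewrite mul1r crho_mul; set y := crho r x.
have E : crho (cmul (cadj a) a) y + 1%:C *: y = x.
  rewrite -[RHS](crho_cone x) -hr crhoD (crho_mul (cmul _ _)) -/y scale1r addrC //.
rewrite -ler_sqr ?nnegrE ?rnorm_ge0 // -E (rnormD_sqr _ (inner_cadjM a y)).
have := sqr_ge0 (rnorm y); have := sqr_ge0 (rnorm (crho a y)).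
have := sqr_ge0 (rnorm (crho (cmul (cadj a) a) y)); lra.
Qed.

End Unit.

(** * The epimorphism onto the reduced crossed product *)

Section QuotientMap.
Context (R : realType) (G : groupType) (S : system R G).
Local Notation X := (sX S).
Local Notation C := (R[i]^o).
Local Notation Cc := (@Cc R G X).
Local Notation act := (@sact R G S).
Local Notation Y := (G * X)%type.
Context (L : @covalg R G X act Y (@rtau G X) (@rpr G X act) (@finsupp R G X) (@fip R G X)).
Context (K : @covalg R G X act X act id [set f : X -> C | continuous f] (@kip R G S)).
Local Notation A := (ca K).
Local Notation B := (ca L).

Lemma quotient_map : exists Lambda : A -> B, [/\ star_hom Lambda,
  forall u, rnorm (Lambda u) <= rnorm u & forall a, Cc a -> Lambda (ciota K a) = ciota L a].
Proof.
have hact := s_action S.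
have fM a : Cc a -> rnorm (ciota L a) <= 1 * rnorm (ciota K a) by move=> Ca; rewrite mul1r reduced_le.
have [F [lF Fi Fb]] := @extension R _ Cc A B (@complete_seq R B) (ciota K) (ciota L) 1
  (@Cc_submod R G X) (ciota_lin K) (ciota_lin L) ler01 fM (@ciota_dense _ _ _ _ _ _ _ _ _ K).
have Fb1 u : rnorm (F u) <= rnorm u by rewrite (le_trans (Fb u)) ?mul1r.
exists F; split=> //; split=> // [u v|u].
- have hB (p : B) w : rnorm (cmul p (F w)) <= rnorm p * rnorm w.
    by rewrite (le_trans (rnorm_cmul _ _)) // ler_wpM2l ?rnorm_ge0.
  have dA := @ciota_dense _ _ _ _ _ _ _ _ _ K.
  have step1 a : Cc a -> forall w, F (cmul (ciota K a) w) = cmul (ciota L a) (F w).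
    move=> Ca; apply: (@dense_eq R _ _ _ (ciota K) dA B (fun w => F (cmul (ciota K a) w))
      (fun w => cmul (ciota L a) (F w)) (rnorm (ciota K a)) (rnorm (ciota L a))).
    + by move=> k x y; rewrite cmul_linearr lF.
    + by move=> k x y; rewrite lF cmul_linearr.
    + exact: rnorm_ge0.
    + exact: rnorm_ge0.
    + by move=> x; rewrite (le_trans (Fb1 _)) // rnorm_cmul.
    + exact: hB.
    + by move=> b Cb; rewrite -(ciota_conv K) // !Fi ?(ciota_conv L) //; exact: Cc_conv.
  apply: (@dense_eq R _ _ _ (ciota K) dA B (fun w => F (cmul w v))
      (fun w => cmul (F w) (F v)) (rnorm v) (rnorm (F v))).
  + by move=> k x y; rewrite cmul_linearl lF.
  + by move=> k x y; rewrite lF cmul_linearl.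
  + exact: rnorm_ge0.
  + exact: rnorm_ge0.
  + by move=> x; rewrite (le_trans (Fb1 _)) // mulrC rnorm_cmul.
  + by move=> x; rewrite (le_trans (rnorm_cmul _ _)) // mulrC ler_wpM2l ?rnorm_ge0.
  + by move=> a Ca; rewrite step1 // Fi.
- rewrite -[LHS]cadjK; congr cadj.
  apply: (@dense_eq R _ _ _ (ciota K) (@ciota_dense _ _ _ _ _ _ _ _ _ K) B
    (fun w => cadj (F (cadj w))) F 1 1) => //.
  + by move=> k x y; rewrite cadj_antilinear lF cadj_antilinear conjCK.
  + by move=> x; rewrite rnorm_cadj mul1r (le_trans (Fb1 _)) // rnorm_cadj.
  + by move=> a Ca; rewrite -(ciota_adj K) // !Fi ?(ciota_adj L) ?cadjK //; exact: Cc_adj.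
Qed.

Context (F : A -> B).
Hypothesis hF : star_hom F.
Hypothesis Fle : forall u, rnorm (F u) <= rnorm u.
Hypothesis Fiota : forall a, Cc a -> F (ciota K a) = ciota L a.

(** A finitely supported element near [b] has a small reduced norm but possibly a large norm above;
    [bounded_lift] tames it at the price of a quadratic error. *)
Lemma approximate_lift (b : B) (r : R) : 0 < r -> rnorm b <= r / 8 ->
  exists a, rnorm a <= r /\ rnorm (b - F a) <= r / 16.
Proof.
move=> r0 hb; have [lF FM FJ] := hF.
have r1 : (r%:C : R[i]) != 0 by rewrite (inj_eq (@complexI R)) gt_eqF.
have hb' : rnorm (r^-1%:C *: b) <= 1 / 8.
  by rewrite rnormZ cmodC ?invr_ge0 ?(ltW r0) // ler_pdivrMl // mulrA mulr1.
(* After rescaling, the errors add up to [1 / 32 + (1 / 8 + 1 / 32)^2], which is at most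
   [1 / 16]. *)
have e0 : (0 : R) < 1 / 32 by lra.
have [y Cy hy] := ciota_dense (r^-1%:C *: b) e0.
have [a [a1 ha]] := bounded_lift (ciota K y).
exists (r%:C *: a); split; first by rewrite rnormZ cmodC ?(ltW r0) // ler_piMr // ltW.
have -> : b - F (r%:C *: a) = r%:C *: (r^-1%:C *: b - F a).
  rewrite (linZ lF) scalerBr scalerA -rmorphM divff ?scale1r //.
  by rewrite gt_eqF.
rewrite rnormZ cmodC ?(ltW r0) // ler_wpM2l ?(ltW r0) //.
have hny : rnorm (ciota L y) <= 5 / 32.
  have := rnormD (ciota L y - r^-1%:C *: b) (r^-1%:C *: b); rewrite subrK rnormB; lra.
have E : ciota L y - F a = cmul (cmul (ciota L y) (cadj (ciota L y))) (F a).
  rewrite -(Fiota Cy) {1}ha (linD lF) addrAC subrr add0r !FM.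
  by rewrite FJ.
have h2 : rnorm (ciota L y - F a) <= (5 / 32) ^+ 2.
  rewrite E (le_trans (rnorm_cmul _ _)) // -[leRHS]mulr1 ler_pM ?rnorm_ge0 //; last first.
    exact: le_trans (Fle a) a1.
  rewrite (le_trans (rnorm_cmul _ _)) // rnorm_cadj expr2 ler_pM ?rnorm_ge0 //.
have := rnorm_dist (ciota L y) (r^-1%:C *: b) (F a); lra.
Qed.

(** Successive approximation as in the open mapping theorem: the remainder bound [r / 16] is the
    hypothesis of [approximate_lift] for [r / 2], so the corrections decrease geometrically. *)
Theorem quotient_surj : set_surj [set: A] [set: B] F.
Proof.
move=> b _; have [lF FM FJ] := hF.
have /choice [g hg] : forall p : B * R, exists a, 0 < p.2 -> rnorm p.1 <= p.2 / 8 ->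
    rnorm a <= p.2 /\ rnorm (p.1 - F a) <= p.2 / 16.
  move=> [p r] /=; have [[r0 hp]|h] := pselect (0 < r /\ rnorm p <= r / 8).
    by have [a ha] := approximate_lift r0 hp; exists a.
  by exists 0 => r0 hp; case: h.
pose M := 8 * (rnorm b + 1); have M0 : 0 < M by rewrite mulr_gt0 // ltr_wpDl ?rnorm_ge0.
pose r n := M * 2^-1 ^+ n.
have r0 n : 0 < r n by rewrite mulr_gt0 // exprn_gt0.
pose s := fix s n := if n is n'.+1 then s n' + g (b - F (s n'), r n') else 0.
have hs n : rnorm (b - F (s n)) <= r n / 8.
  elim: n => [|n IH]; first by rewrite /= (lin0 lF) subr0 /r mulr1 /M; lra.
  have [_ h] := hg (b - F (s n), r n) (r0 n) IH.
  rewrite -[s n.+1]/(s n + g (b - F (s n), r n)) (linD lF) opprD addrA.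
  by apply: le_trans h _; rewrite /r exprS /=; lra.
have [||||l hl] := @geometric_cvs R A s 2^-1 M; rewrite ?(ltW M0) ?invr_ge0 //.
- by rewrite invf_lt1 // ltr1n.
- move=> n; have [h _] := hg (b - F (s n), r n) (r0 n) (hs n).
  by rewrite -[s n.+1]/(s n + g (b - F (s n), r n)) (addrC (s n)) addrK.
exists l => //; apply/esym.
have F1 u : rnorm (F u) <= 1 * rnorm u by rewrite mul1r.
have h2 := cvs_op lF ler01 F1 hl; apply: cvs_unique _ h2 => e e0.
have i0 : (0 : R) <= 2^-1 by rewrite invr_ge0.
have i1 : (2^-1 : R) < 1 by rewrite invf_lt1 // ltr1n.
have [N hN] := expr_small i0 i1 (divr_gt0 e0 M0).
exists N => n /hN; rewrite ler_pdivlMr // mulrC -/(r n) => h.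
by have := hs n; rewrite /= rnormB; have := r0 n; lra.
Qed.

End QuotientMap.

(** * Proper ideals and the expectation *)

Section Ideals.
Context (R : realType) (G : groupType) (S : system R G).
Local Notation X := (sX S).
Local Notation C := (R[i]^o).
Local Notation Cc := (@Cc R G X).
Local Notation act := (@sact R G S).
Local Notation Y := (G * X)%type.
Context (K : @covalg R G X act X act id [set f : X -> C | continuous f] (@kip R G S)).
Local Notation A := (ca K).
Local Notation H := (ch K).
Implicit Types (u v : A) (f g : X -> C) (x y : H).

Definition trans s : A := ciota K (mon s (fun=> 1)).

Lemma trans_conj s f : continuous f ->
  cmul (cmul (trans s^-1%g) (un K f)) (trans s) = un K (f \o act s).
Proof.
move=> cf; have c1 := @kcont1 R G S; have hact := s_action S.
have C1 := @Cc_mon R G X s^-1%g _ c1; have C2 := @Cc_mon R G X 1%g f cf.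
have C3 := @Cc_mon R G X s _ c1; have C4 := Cc_conv hact C1 C2.
rewrite /trans /un -(ciota_conv K C1 C2) -(ciota_conv K C4 C3) !conv_mon_mon mulg1 mulVg.
by congr (ciota K (mon _ _)); apply/funext => z; rewrite mulr1 mul1r invgK.
Qed.

Lemma ideal_sum (J : set A) (I : Type) (s : seq I) (F : I -> A) : ideal J ->
  (forall i, J (F i)) -> J (\sum_(i <- s) F i).
Proof.
move=> [_ J0 Jl _] h; elim: s => [|i s IH]; first by rewrite big_nil.
by rewrite big_cons -[F i]scale1r; exact: Jl.
Qed.

Lemma un_sum (I : Type) (s : seq I) (F : I -> X -> C) : (forall i, continuous (F i)) ->
  un K (fun z => \sum_(i <- s) F i z) = \sum_(i <- s) un K (F i).
Proof.
move=> h; have c0 := @cont_cst R X 0; elim: s => [|i s IH].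
  have -> : (fun z => \sum_(i <- [::]) F i z) = -1 *: (fun=> 0 : C) + (fun=> 0 : C).
    by apply/funext => z; rewrite big_nil -[RHS]/(-1 * 0 + 0) mulr0 addr0.
  by rewrite (un_lin K (-1) c0 c0) scaleN1r addNr big_nil.
rewrite big_cons -IH -[un K (F i)]scale1r -(un_lin K 1 (h i) (@cont_sum R X _ s _ h)).
by congr (un K); apply/funext => z; rewrite big_cons -[RHS]/(1 * F i z + _) mul1r.
Qed.

Lemma cont_inv f : continuous f -> (forall z, f z != 0) -> continuous (fun z => (f z)^-1 : C).
Proof. by move=> cf f0 z; apply: cvgV; [exact: f0 | exact: cf]. Qed.

(* By minimality finitely many translates of [|f|^2] add up to an invertible
   function. *)
Lemma ideal_unit (J : set A) f : ideal J -> continuous f -> f <> 0 -> J (un K f) -> J = [set: A].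
Proof.
move=> iJ cf f0 Jf; have [_ J0 Jl Jm] := iJ; have [F [d [d0 hF]]] := s_minimal cf f0.
pose h : X -> C := fun z => `|f z| ^+ 2; have ch : continuous h := cont_abs2 cf.
have cs s : continuous (h \o act s) := @act_cont R G X act (s_action S) s h ch.
pose g : X -> C := fun z => \sum_(s <- F) (h \o act s) z.
have cg : continuous g := @cont_sum R X _ F _ cs.
have Jh : J (un K h).
  have -> : un K h = cmul (un K (fun z => Num.conj (f z))) (un K f).
    rewrite (unM K (contJ cf) cf); congr (un K); apply/funext => z.
    by rewrite /h normCK mulrC.
  by case: (Jm (un K (fun z => Num.conj (f z))) _ Jf).
have Jg : J (un K g).
  rewrite /g (un_sum F cs); apply: ideal_sum => // s; rewrite -(trans_conj s ch).
  by case: (Jm (trans s) _ (Jm (trans s^-1%g) _ Jh).1).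
have g0 z : g z != 0.
  apply/eqP => gz; have := hF z; rewrite -[X in _ <= X]/(g z) gz.
  by rewrite -[X in _ <= X]/(0%:C) lecR leNgt d0.
have ci := cont_inv cg g0.
have J1 : J (cone K).
  have -> : cone K = cmul (un K (fun z => (g z)^-1)) (un K g).
    rewrite (unM K ci cg); congr (un K); apply/funext => z.
    by rewrite mulVf.
  by case: (Jm (un K (fun z => (g z)^-1)) _ Jg).
by apply/seteqP; split=> // u _; rewrite -[u]mul_cone; case: (Jm u _ J1).
Qed.

Context (L : @covalg R G X act Y (@rtau G X) (@rpr G X act) (@finsupp R G X) (@fip R G X)).
Context (F : A -> ca L).
Hypothesis lF : linear F.
Hypothesis Fle : forall u, rnorm (F u) <= rnorm u.
Hypothesis Fiota : forall a, Cc a -> F (ciota K a) = ciota L a.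

Lemma ideal_apinches (J : set A) (l : seq (G * 'I_3)) u : ideal J -> J u -> J (apinches l u).
Proof.
move=> [_ J0 Jl Jm] Ju; elim: l => //= p l IH.
rewrite /apinch -[_ *: _]addr0; apply: (Jl) => //; rewrite -[apinches l u]scale1r.
apply: (Jl) => //; rewrite scale1r.
by case: (Jm (un K (sgn (S := S) p)) _ (Jm (un K (sgn (S := S) p)) _ IH).1).
Qed.

(** Pinching an element [u] of [J], with colours adapted to a finitely supported approximant, stays
    in [J] and comes arbitrarily close to the expectation of [u]. As [J] is closed, it contains this
    function; were it nonzero, [J] would be everything. *)
Theorem ideal_expectation (J : set A) u : ideal J -> J <> [set: A] -> J u -> expectation (F u) = 0.
Proof.
move=> iJ JT Ju; apply: contrapT => g0.
have cg : continuous (expectation (F u)) := @expectation_cont R G S L (F u).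
apply: JT; apply: (ideal_unit iJ cg g0).
have [cJ _ _ _] := iJ; move/closed_approx : cJ; apply => e e0.
have e2 : 0 < e / 2 by rewrite divr_gt0.
have [c Cc' hc] := ciota_dense u e2; have [l hl] := pinches_ex Cc'.
exists (apinches l u); first exact: ideal_apinches.
have h1 := apinches_dist l (ciota K c) u; rewrite (rnormB _ u) in h1.
rewrite -(apinches_iota _ l Cc') hl -/(un K (c 1%g)) in h1.
have h2 : rnorm (un K (expectation (F u)) - un K (c 1%g)) <= e / 2.
  have -> : un K (expectation (F u)) - un K (c 1%g) = un K (-1 *: c 1%g + expectation (F u)).
    by rewrite (un_lin K (-1) (Cc'.1 1%g) cg) scaleN1r addrC.
  apply: un_le => [||z]; [exact: (@contD R X _ _ (@contZ R X (-1) _ (Cc'.1 1%g)) cg)|exact: ltW|].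
  rewrite -[X in cmod X]/(-1 * c 1%g z + expectation (F u) z) -(expectation_iota L Cc') -(Fiota Cc').
  rewrite mulN1r addrC; apply: le_trans (_ : rnorm (F (u - ciota K c)) <= _).
    rewrite -[expectation (F u) z - _]/((expectation (F u) - expectation (F (ciota K c))) z).
    by rewrite (linB lF) -(linB (@expectation_linear R G S L)); exact: expectation_le.
  by rewrite (le_trans (Fle _)) // ltW.
apply: le_lt_trans (rnorm_dist (un K (c 1%g)) _ _) _; lra.
Qed.

End Ideals.

Lemma cvs_Re_ge0 (R : realType) (z : nat -> R[i]^o) (l : R[i]^o) :
  cvs z l -> (forall n, 0 <= z n) -> 0 <= complex.Re l.
Proof.
move=> hz z0; rewrite leNgt; apply/negP => l0.
have e0 : 0 < - complex.Re l / 2 by lra.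
have [N hN] := hz _ e0; have := z0 N; rewrite lecE /= => /andP[_ h1].
have := le_trans (Re_le_cmod _) (hN N (leqnn N)).
by rewrite ReD ReN ler_norml => /andP[_]; lra.
Qed.

(** * Compact operators in the Koopman algebra *)

Section Compacts.
Context (R : realType) (G : groupType) (S : system R G).
Local Notation X := (sX S).
Local Notation C := (R[i]^o).
Local Notation Cc := (@Cc R G X).
Local Notation act := (@sact R G S).
Context (K : @covalg R G X act X act id [set f : X -> C | continuous f] (@kip R G S)).
Local Notation A := (ca K).
Local Notation H := (ch K).
Implicit Types (u v : A) (f g : X -> C) (x y : H).

Let cdense : forall x (d : R), 0 < d -> exists2 f, continuous f & rnorm (x - ci K f) < d :=
  @ci_dense _ _ _ _ _ _ _ _ _ K.

Definition hone : H := ci K (fun=> 1).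

Lemma inner_hone f : continuous f -> inner H (ci K f) hone = smean f.
Proof.
move=> cf; rewrite /hone (ci_inner K cf (@kcont1 R G S)); congr smean.
by apply/funext => z; rewrite rmorph1 mulr1.
Qed.

Lemma inner_hone1 : inner H hone hone = 1.
Proof. by rewrite (inner_hone (@kcont1 R G S)) smean_cst. Qed.

Lemma rnorm_hone : rnorm hone = 1.
Proof.
have : rnorm hone ^+ 2 = 1 by apply: complexI; rewrite -inner_sqr inner_hone1.
move=> /eqP; rewrite sqrf_eq1 => /orP[/eqP //|/eqP h].
by have := rnorm_ge0 hone; rewrite h; lra.
Qed.

Definition dev s : A := trans K s - cone K.

Lemma dev_ci s f : continuous f -> crho (dev s) (ci K f) = ci K (fun z => f (act s^-1%g z) - f z : C).
Proof.
move=> cf; have c1 := @kcont1 R G S; have C1 := @Cc_mon R G X s _ c1.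
have cs : continuous (f \o act s^-1%g) := @act_cont R G X act (s_action S) s^-1%g f cf.
rewrite crhoB crho_cone (crho_iota K C1 cf).
have -> : rep act id (mon s (fun=> 1)) f = f \o act s^-1%g.
  by apply/funext => z; rewrite rep_mon mul1r.
have -> : (fun z => f (act s^-1%g z) - f z : C) = -1 *: f + (f \o act s^-1%g).
  by apply/funext => z; rewrite -[RHS]/(-1 * f z + f (act s^-1%g z)) mulN1r addrC.
by rewrite (ci_lin K (-1) cf cs) scaleN1r addrC.
Qed.

Lemma dev_hone s : crho (dev s) hone = 0.
Proof.
have c1 := @kcont1 R G S; rewrite /hone (dev_ci s c1).
have c0 := @cont_cst R X 0.
have -> : (fun z : X => 1 - 1 : C) = -1 *: (fun=> 0 : C) + (fun=> 0 : C).
  by apply/funext => z; rewrite -[RHS]/(-1 * 0 + 0) mulr0 addr0 subrr.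
by rewrite (ci_lin K (-1) c0 c0) scaleN1r addNr.
Qed.

Definition laplacian (Q : seq G) : A := \sum_(s <- Q) cmul (cadj (dev s)) (dev s).

Lemma crho_laplacian Q x : crho (laplacian Q) x = \sum_(s <- Q) crho (cadj (dev s)) (crho (dev s) x).
Proof.
rewrite /laplacian; elim: Q => [|s Q IH]; first by rewrite !big_nil crho0.
by rewrite !big_cons crhoD IH crho_mul.
Qed.

Lemma inner_laplacian Q x y :
  inner H (crho (laplacian Q) x) y = \sum_(s <- Q) inner H (crho (dev s) x) (crho (dev s) y).
Proof.
rewrite crho_laplacian (lin_sum (inner_lin y)); apply: eq_bigr => s _.
exact: crho_adj.
Qed.

Lemma laplacian_sqr Q x :
  inner H (crho (laplacian Q) x) x = (\sum_(s <- Q) rnorm (crho (dev s) x) ^+ 2)%:C.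
Proof. by rewrite inner_laplacian rmorph_sum; apply: eq_bigr => s _; rewrite inner_sqr. Qed.

Lemma laplacian_hone Q : crho (laplacian Q) hone = 0.
Proof.
by rewrite crho_laplacian big1 // => s _; rewrite dev_hone (lin0 (crho_lin _)).
Qed.

(** The Poincare inequality of the mean, carried by density from continuous functions to all vectors
    orthogonal to the constants. *)
Lemma laplacian_gap : exists (Q : seq G) (eps : R), 0 < eps /\ forall x, inner H x hone = 0 ->
  eps ^+ 2 * rnorm x ^+ 2 <= \sum_(s <- Q) rnorm (crho (dev s) x) ^+ 2.
Proof.
have [Q [eps [e0 hQ]]] := @smean_poincare R G S; exists Q, eps; split=> // x x1.
set D := laplacian Q; have [f [cf hf]] := dense_seq cdense x.
have h1 : cvs (fun n => inner H (crho D (ci K (f n))) (ci K (f n)) : C) (inner H (crho D x) x).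
  exact: (cvs_inner (cvs_op (crho_lin D) (rnorm_ge0 D) (crho_le D) hf) hf).
have h2 := cvs_inner hf hf; have h3 := cvs_inner hf (cvs_cst hone); have h4 := cvs_conj h3.
have := cvs_Re_ge0 (cvsB h1 (cvsZ (eps ^+ 2)%:C (cvsB h2 (cvsM h3 h4)))).
rewrite x1 mul0r subr0 inner_sqr laplacian_sqr -[_ *: _]rmorphM -rmorphB subr_ge0; apply=> n.
have cfn := cf n; rewrite /= laplacian_sqr (ci_inner K cfn cfn) (inner_hone cfn) -normCK kip_sqr subr_ge0.
rewrite rmorph_sum; apply: le_trans (hQ _ cfn) _; rewrite le_eqVlt; apply/orP; left; apply/eqP.
apply: eq_bigr => s _; pose g := f n \o act s^-1%g.
have cg : continuous g := @act_cont R G X act (s_action S) s^-1%g _ cfn.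
by rewrite (dev_ci s cfn) -kip_sqr /= (ci_sqr K (contB cg cfn)).
Qed.

Definition rank1 x y : H -> H := fun z => inner H z y *: x.

Lemma rank1_le x y z : rnorm (rank1 x y z) <= rnorm x * rnorm y * rnorm z.
Proof.
rewrite /rank1 rnormZ mulrC -mulrA ler_wpM2l ?rnorm_ge0 // mulrC.
exact: inner_CS.
Qed.

(* The projection onto the constants is the limit of the powers of
   [1 - t laplacian] for small [t]. *)
Lemma constants_projection : exists p : A, crho p = rank1 hone hone.
Proof.
have [Q [eps [e0 hQ]]] := laplacian_gap; set D := laplacian Q in hQ *.
set d := rnorm D; have d0 : 0 <= d by exact: rnorm_ge0.
(* The resulting [t] satisfies [t d^2 <= eps^2] and [t eps^2 <= 1]. On the complement of the
   constants, [|x - t D x|^2] is then at most [(1 - 2 t eps^2 + t eps^2) |x|^2]. *)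
pose den := d ^+ 2 + eps ^+ 4 + 1.
have den0 : 0 < den by rewrite ltr_wpDl // addr_ge0 ?exprn_ge0 // ltW.
have den1 : den != 0 by rewrite gt_eqF.
pose t := eps ^+ 2 / den; have t0 : 0 < t by rewrite divr_gt0 // exprn_gt0.
have td : t * d ^+ 2 <= eps ^+ 2.
  rewrite /t mulrAC ler_pdivrMr // ler_wpM2l ?sqr_ge0 // /den -addrA lerDl addr_ge0 // exprn_ge0 //.
  exact: ltW.
have te1 : t * eps ^+ 2 <= 1.
  rewrite /t mulrAC -exprD ler_pdivrMr // mul1r /den; have := sqr_ge0 d; lra.
have te0 : 0 < t * eps ^+ 2 by rewrite mulr_gt0 // exprn_gt0.
pose c := Num.sqrt (1 - t * eps ^+ 2).
have c0 : 0 <= c by exact: sqrtr_ge0.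
have c2 : c ^+ 2 = 1 - t * eps ^+ 2 by rewrite sqr_sqrtr // subr_ge0.
have c1 : c < 1.
  by rewrite -(@ltr_pXn2r _ 2) ?nnegrE // c2 expr1n; lra.
pose M x := x + (- t)%:C *: crho D x.
have hM x : inner H x hone = 0 -> inner H (M x) hone = 0 /\ rnorm (M x) <= c * rnorm x.
  move=> x1; split.
    rewrite iDl iZl x1 add0r inner_laplacian big1 ?mulr0 // => s _.
    by rewrite dev_hone i0r.
  rewrite -ler_sqr ?nnegrE ?mulr_ge0 ?rnorm_ge0 // exprMn c2.
  have q : inner H x (crho D x) = (\sum_(s <- Q) rnorm (crho (dev s) x) ^+ 2)%:C.
    by rewrite iconj laplacian_sqr conj_conjc conjc_real.
  rewrite (rnormD_sqr _ q); have h1 := hQ _ x1.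
  have h2 : rnorm (crho D x) ^+ 2 <= d ^+ 2 * rnorm x ^+ 2.
    by rewrite -exprMn ler_sqr ?nnegrE ?mulr_ge0 ?rnorm_ge0 //; exact: crho_le.
  set q0 := \sum_(s <- Q) _ in h1 *; set n := rnorm x ^+ 2 in h1 h2 *.
  have n0 : 0 <= n by exact: sqr_ge0.
  have h3 : t * (eps ^+ 2 * n) <= t * q0 by rewrite ler_wpM2l // ltW.
  have h4 : t * (t * rnorm (crho D x) ^+ 2) <= t * (t * (d ^+ 2 * n)) by rewrite !ler_wpM2l // ltW.
  have h5 : t * (t * d ^+ 2 * n) <= t * (eps ^+ 2 * n) by rewrite ler_wpM2l ?ler_wpM2r // ltW.
  nra.
pose pw := fix pw n := if n is n'.+1 then cmul (cone K + (- t)%:C *: D) (pw n') else cone K.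
have pwE n x : crho (pw n.+1) x = M (crho (pw n) x).
  by rewrite -[pw n.+1]/(cmul _ (pw n)) crho_mul crhoD crhoZ crho_cone.
apply: crho_closed => e e0'; have [N hN] := expr_small c0 c1 e0'.
exists (pw N) => x.
have key n : inner H (crho (pw n) x - rank1 hone hone x) hone = 0 /\
    rnorm (crho (pw n) x - rank1 hone hone x) <= c ^+ n * rnorm x.
  elim: n => [|n [IH1 IH2]].
    rewrite /= crho_cone; have o : inner H (x - rank1 hone hone x) hone = 0.
      by rewrite iBl /rank1 iZl inner_hone1 mulr1 subrr.
    split=> //; rewrite expr0 mul1r.
    have o' : inner H (x - rank1 hone hone x) (inner H x hone *: hone) = 0%:C.
      by rewrite iZr o mulr0.
    have := rnormD_sqr 1 o'; rewrite scale1r -/(rank1 hone hone x) subrK mulr0 addr0 expr1n mul1r => h.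
    rewrite -ler_sqr ?nnegrE ?rnorm_ge0 // h lerDl sqr_ge0 //.
  have E : crho (pw n.+1) x - rank1 hone hone x = M (crho (pw n) x - rank1 hone hone x).
    rewrite pwE /M (linB (crho_lin D)) {3}/rank1 (linZ (crho_lin D)) laplacian_hone scaler0 subr0.
    by rewrite addrAC.
  rewrite E; have [h1 h2] := hM _ IH1; split=> //; apply: le_trans h2 _.
  by rewrite exprS -mulrA ler_wpM2l.
rewrite rnormB (le_trans (key N).2) // ler_wpM2r ?rnorm_ge0 //; exact: hN.
Qed.

(** Multiplying the projection onto the constants by [un f] on the left and by the adjoint of [un g]
    on the right gives the rank-one operator of [f] and [g]; density of continuous functions does
    the rest, one variable at a time. *)
Lemma rank1_in x y : exists p : A, crho p = rank1 x y.
Proof.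
have [p hp] := constants_projection.
have onef f : continuous f -> crho (un K f) hone = ci K f.
  move=> cf; rewrite /hone (un_op K cf (@kcont1 R G S)); congr (ci K).
  by apply/funext => z; rewrite mulr1.
have s1 f g : continuous f -> continuous g -> exists q : A, crho q = rank1 (ci K f) (ci K g).
  move=> cf cg; exists (cmul (cmul (un K f) p) (cadj (un K g))); apply/funext => z.
  rewrite !crho_mul hp /rank1 (linZ (crho_lin (un K f))) (onef f cf); congr (_ *: _).
  by rewrite crho_adj (onef g cg).
have s2 g : continuous g -> exists q : A, crho q = rank1 x (ci K g).
  move=> cg; apply: crho_closed => d d0.
  have k0 : 0 < rnorm (ci K g) + 1 by rewrite ltr_wpDl ?rnorm_ge0.
  have [f cf hf] := cdense x (divr_gt0 d0 k0); have [q hq] := s1 f g cf cg.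
  exists q => z; rewrite hq /rank1 -scalerBr; apply: le_trans (rank1_le (x - ci K f) (ci K g) z) _.
  rewrite ler_wpM2r ?rnorm_ge0 //; move: hf; rewrite ltr_pdivlMr //.
  have := rnorm_ge0 (x - ci K f); have := rnorm_ge0 (ci K g); nra.
apply: crho_closed => d d0.
have k0 : 0 < rnorm x + 1 by rewrite ltr_wpDl ?rnorm_ge0.
have [g cg hg] := cdense y (divr_gt0 d0 k0); have [q hq] := s2 g cg.
exists q => z; rewrite hq /rank1 -scalerBl -iBr; apply: le_trans (rank1_le x (y - ci K g) z) _.
rewrite ler_wpM2r ?rnorm_ge0 //; move: hg; rewrite ltr_pdivlMr //.
have := rnorm_ge0 (y - ci K g); have := rnorm_ge0 x; nra.
Qed.

Lemma frank_in (J : set A) (s : seq (H * H)) : ideal J ->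
  (forall x y, exists2 p, J p & crho p = rank1 x y) -> exists2 p, J p & crho p = frank s.
Proof.
move=> [_ J0 Jl _] h; elim: s => [|q s [p Jp hp]].
  by exists 0 => //; apply/funext => x; rewrite crho0 /frank big_nil.
have [r Jr hr] := h q.1 q.2; exists (r + p); first by rewrite -[r]scale1r; exact: Jl.
by apply/funext => x; rewrite crhoD hp hr /frank big_cons.
Qed.

Lemma ideal_setT : ideal [set: A].
Proof. by split=> //; exact: closedT. Qed.

Lemma compact_in (T : H -> H) : compact_operator T -> exists p : A, crho p = T.
Proof.
move=> cT; apply: crho_closed => d d0; have [s hs] := compact_approx cT d0.
have [|p _ hp] := @frank_in [set: A] s ideal_setT; last by exists p => z; rewrite hp.
by move=> x y; have [p hp] := rank1_in x y; exists p.
Qed.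

Lemma compacts_ideal : ideal (compacts_in (@crho _ _ _ _ _ _ _ _ _ K)).
Proof.
have bd p : bounded_operator (crho p : H -> H) by case: (crho_iso K) => h _; exact: h.
split.
- apply/closed_approx => u hu; apply: (compact_lim (crho_lin u)) => e e0.
  have [v cv hv] := hu e e0; exists (crho v) => // x.
  by rewrite -crhoB (le_trans (crho_le _ _)) // ler_wpM2r ?rnorm_ge0 // ltW.
- rewrite /compacts_in /= (_ : crho (0 : A) = fun=> 0); first exact: compact0.
  by apply/funext => x; rewrite crho0.
- move=> k u v cu cv; rewrite /compacts_in /= (_ : crho _ = fun x => k *: crho u x + crho v x).
    exact: compact_lin.
  by apply/funext => x; rewrite crho_linl.
- move=> u v cv; split; rewrite /compacts_in /=.
    rewrite (_ : crho _ = crho u \o crho v); last by apply/funext => x; rewrite crho_mul.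
    exact: compact_comp_left.
  rewrite (_ : crho _ = crho v \o crho u); last by apply/funext => x; rewrite crho_mul.
  exact: compact_comp_right.
Qed.

(** If [u] in [J] does not annihilate [x], placing [u] between the rank-one operators into [x] and
    out of [u x] yields every rank-one operator up to a nonzero scalar. These generate the compact
    operators. *)
Theorem compacts_sub_ideal (J : set A) : ideal J -> J <> [set 0] ->
  compacts_in (@crho _ _ _ _ _ _ _ _ _ K) `<=` J.
Proof.
move=> iJ Jn0; have [cJ J0 Jl Jm] := iJ.
have [u Ju u0] : exists2 u, J u & u <> 0.
  apply: contrapT => h; apply: Jn0; apply/seteqP; split=> [u Ju|_ -> //].
  by apply: contrapT => un0; apply: h; exists u.
have [x ux] : exists x, crho u x <> 0.
  apply: contrapT => /forallNP h; apply/u0/crho_inj/funext => x.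
  by rewrite crho0; apply: contrapT; exact: h.
have n0 : inner H (crho u x) (crho u x) != 0.
  rewrite inner_sqr (inj_eq (@complexI R)) sqrf_eq0; apply/eqP => /rnorm_eq0; exact: ux.
have r1 (y z : H) : exists2 p, J p & crho p = rank1 y z.
  have [p hp] := rank1_in x z; have [q hq] := rank1_in y (crho u x).
  exists ((inner H (crho u x) (crho u x))^-1 *: cmul q (cmul u p)).
    rewrite -[_ *: _]addr0; apply: (Jl) => //.
    by case: (Jm q _ (Jm p _ Ju).2); case: (Jm q _ (Jm p _ Ju).1).
  apply/funext => h; rewrite crhoZ !crho_mul hp hq /rank1 (linZ (crho_lin u)) iZl.
  by rewrite !scalerA mulrCA mulVf // mulr1.
move=> v cv; move/closed_approx : (cJ); apply => e e0; have e2 : 0 < e / 2 by rewrite divr_gt0.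
have [s hs] := compact_approx cv e2; have [p Jp hp] := frank_in s iJ r1.
exists p => //; apply: (@le_lt_trans _ _ (e / 2)); last lra.
by apply: rnorm_crho_le (ltW e2) _ => y; rewrite crhoB hp.
Qed.

(** Disjoint functions provide more orthonormal vectors than a net of the unit ball of radius
    [1 / 2] has points. Two of them would share a net point and lie within 1, although their squared
    distance is 2. *)
Lemma cone_not_compact : ~ compact_operator (crho (cone K) : H -> H).
Proof.
move=> /compactP [_ tb]; have [|s hs] := tb (1 / 2); first lra.
have [f [cf f0 fd]] := @s_disjoint R G S (size s).+1.
have n0 i : 0 < rnorm (ci K (f i)).
  rewrite lt_neqAle rnorm_ge0 andbT eq_sym; apply/eqP => h; apply: (f0 i).
  by apply: (smean_faithful (cf i)); rewrite -kip_sqr -(ci_sqr K (cf i)) h expr0n.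
pose v i := (rnorm (ci K (f i)))^-1%:C *: ci K (f i).
have v1 i : rnorm (v i) = 1 by rewrite rnormZ cmodC ?invr_ge0 ?rnorm_ge0 // mulVf // gt_eqF.
have vo i j : (i < (size s).+1)%N -> (j < (size s).+1)%N -> i <> j -> inner H (v i) (v j) = 0%:C.
  move=> hi hj ij; rewrite iZl iZr (ci_inner K (cf i) (cf j)).
  rewrite (_ : kip _ _ = 0) ?mulr0 //; rewrite /kip -[RHS](smean0 S); congr smean.
  apply/funext => z; have := fd i j z hi hj ij => /eqP; rewrite mulf_eq0 => /orP[/eqP ->|/eqP ->].
    by rewrite mul0r.
  by rewrite rmorph0 mulr0.
have /choice [y hy] : forall i, exists y, y \in s /\ rnorm (v i - y) <= 1 / 2.
  move=> i; have [|y ys h] := hs (v i); last by exists y.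
  by exists (v i); rewrite /= ?v1 ?crho_cone.
have uy : uniq [seq y i | i <- iota 0 (size s).+1].
  rewrite map_inj_in_uniq ?iota_uniq // => i j; rewrite !mem_iota /= !add0n => hi hj yij.
  apply: contrapT => ij; have := rnormD_sqr (-1) (vo i j hi hj ij).
  rewrite !v1 rmorphN scaleN1r mulr0 addr0 expr1n sqrrN expr1n mulr1 => h.
  have h1 := rnorm_dist (y i) (v i) (v j); rewrite {2}yij (rnormB (y j)) in h1.
  have h2 : rnorm (v i - v j) <= 1 by have := (hy i).2; have := (hy j).2; lra.
  have := rnorm_ge0 (v i - v j); nra.
have := uniq_leq_size uy (s2 := s); rewrite size_map size_iota ltnn; case/(_ _)/notF => z.
by case/mapP => i _ ->; case: (hy i).
Qed.

(** A nonzero function in the ideal of compact operators would force this ideal to contain the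
    unit. *)
Theorem compact_unit f : continuous f -> compact_operator (crho (un K f) : H -> H) -> f = 0.
Proof.
move=> cf ccf; apply: contrapT => f0.
have E := ideal_unit compacts_ideal cf f0 ccf.
apply: cone_not_compact; rewrite -[compact_operator _]/(compacts_in _ (cone K)) E.
by [].
Qed.

Lemma rank1_hone_neq0 : rank1 hone hone <> (fun=> 0).
Proof.
move=> /(congr1 (fun T => T hone)); rewrite /rank1 inner_hone1 scale1r => h.
by have := rnorm_hone; rewrite h rnorm0; lra.
Qed.

End Compacts.

(** * The exotic crossed product and its ideals *)

Theorem theorem3p7 (R : realType) (G : groupType)
    (Gcountable : countable [set: G]) (Ginfinite : infinite_set [set: G])
    (GT : property_T R G) :
  exists (X : topologicalType) (act : G -> X -> X)
         (eta : (G -> X -> R[i]^o) -> R) (H : hilbertSpace R)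
         (* A is the crossed product for eta, rho identifies it with a
            subalgebra of B(H); B is the reduced crossed product. *)
         (A : cstarAlgebra R) (iota : (G -> X -> R[i]^o) -> A)
         (rho : A -> H -> H)
         (B : cstarAlgebra R) (iotar : (G -> X -> R[i]^o) -> B)
         (Lambda : A -> B) (Er : B -> X -> R[i]^o),
    (compact [set: X] /\ hausdorff_space X) /\
    (continuous_action act /\ free_action act) /\
    (cstar_norm act eta /\ is_completion act eta iota) /\
    (is_reduced_crossed_product act iotar /\
     is_canonical_expectation iotar Er) /\
    [/\ star_hom Lambda, set_surj [set: A] [set: B] Lambda
      & forall a, Cc a -> Lambda (iota a) = iotar a] /\
    isometric_star_rep rho /\
    contains_compacts_as_exotic_ideal iota rho /\
    (forall J : set A, ideal J -> J <> [set 0] -> J <> [set: A] ->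
       compacts_in rho `<=` J /\ J `<=` null_ideal Lambda Er).
Proof.
have [M] := mshift_ex Gcountable.
have [S] := minimal_system M Ginfinite GT.
have [K] := koopman_algebra S.
have [L] := regular_algebra (s_action S) (@s_bounded R G S).
have [F [hF Fle Fiota]] := quotient_map L K; have lF : linear F by case: hF.
exists (sX S), (@sact R G S), (fun a => rnorm (ciota K a)), (ch K), (ca K), (ciota K).
exists (@crho _ _ _ _ _ _ _ _ _ K), (ca L), (ciota L), F, (@expectation R G S L).
split; first by split; [exact: s_compact | exact: s_hausdorff].
split.
  split=> [|x s s1 sx]; first exact: s_action.
  by case: (@scol_sep R G S s x s1); rewrite sx.
split; first by split; [exact: eta_cstar_norm | exact: ciota_completion].
split.
  split; last exact: canonical_expectation.
  have [c1 c2 c3 c4 c5] := ciota_completion L.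
  by split=> // a Ca; rewrite (reduced_normE L).
split; first by split=> //; exact: quotient_surj.
split; first exact: crho_iso.
split.
  split.
  - exists (rank1 (hone K) (hone K)); split; last exact: rank1_hone_neq0.
    exact: compact_rank1.
  - exact: compact_in.
  - exact: compacts_ideal.
  - by move=> f; exact: compact_unit.
move=> J iJ J0 JT; split; first exact: compacts_sub_ideal.
move=> u Ju; rewrite /null_ideal /=.
by apply: (ideal_expectation lF Fle Fiota iJ JT); case: iJ => _ _ _ Jm; case: (Jm (cadj u) _ Ju).
Qed.
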